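(* Let $n\ge2$, $\mu>0$ and $D=\{x\in\mathbb{H}^n:x_1>0\}$. For every $x,y\in D$ and $t>0$, $$p_D^{(\mu)}(t,x,y)=p^{(\mu)}(t,x,y)-p^{(\mu)}(t,x,\bar y).$$
   Context: $\mathbb{H}^n=\{x=(x_1,\dots,x_n)\in\mathbb{R}^n:x_n>0\}$ with volume element $dV_n=x_n^{-n}dx_1\cdots dx_n$. For $x\in\mathbb{R}^n$, $\bar x=(-x_1,x_2,\dots,x_n)$. For $\mu>0$, $X^{(\mu)}$ (hyperbolic Brownian motion with drift) is the diffusion on $\mathbb{H}^n$ with generator $\frac12\Delta_\mu$, where $\Delta_\mu=x_n^2\sum_{k=1}^n\frac{\partial^2}{\partial x_k^2}-(2\mu-1)x_n\frac{\partial}{\partial x_n}$. Equivalently, in law, $X^{(\mu)}_t=(\beta(A_t),Y_t)$, where $Y_t=x_n\exp(B_t-\mu t)$ with $B$ a standard one-dimensional Brownian motion, $A_t=\int_0^tY_s^2\,ds$, and $\beta$ is an $(n-1)$-dimensional Brownian motion independent of $B$ starting from $(x_1,\dots,x_{n-1})$. $p^{(\mu)}(t,x,y)$ is the (continuous) transition density of $X^{(\mu)}$ with respect to $dV_n$. Let $\tau_D=\inf\{t>0:X^{(\mu)}_t\notin D\}$. $p_D^{(\mu)}$ is the transition density with respect to $dV_n$ of the process $X^{(\mu)}$ killed when exiting $D$, given by the Hunt formula $p_D^{(\mu)}(t,x,y)=p^{(\mu)}(t,x,y)-\mathbf{E}^x[\tau_D<t;\,p^{(\mu)}(t-\tau_D,X^{(\mu)}_{\tau_D},y)]$.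 *)

(* Defs.v *)
From HB Require Import structures.
From mathcomp Require Import all_boot all_order all_algebra.
From mathcomp Require Import all_classical all_reals all_analysis.

Set Implicit Arguments.
Unset Strict Implicit.
Unset Printing Implicit Defensive.

Import Order.TTheory GRing.Theory Num.Theory.
Import numFieldNormedType.Exports.

Local Open Scope classical_set_scope.
Local Open Scope ring_scope.

(* The ambient dimension is written n.+1, so that points are x : 'rV[R]_n.+1
   with first coordinate x ord0 ord0 and last coordinate x ord0 ord_max. *)

Section Geometry.
Context {R : realType}.

Definition borel_rV (n : nat) : set (set 'rV[R]_n) := <<s [set U | open U] >>.

Definition hyp_space (n : nat) : set 'rV[R]_n.+1 := [set x | 0 < x ord0 ord_max].

Definition half_space (n : nat) : set 'rV[R]_n.+1 :=
  [set x | hyp_space x /\ 0 < x ord0 ord0].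

Definition reflect1 (n : nat) (x : 'rV[R]_n.+1) : 'rV[R]_n.+1 :=
  \row_i (if i == ord0 then - x ord0 i else x ord0 i).

(* The integral of f against dx_1 ... dx_n, as an iterated Lebesgue integral
   with x_1 outermost. By Tonelli this is the integral against n-dimensional
   Lebesgue measure; it is only used for nonnegative Borel functions. *)
Fixpoint lebesgue_integral_rV (n : nat) : ('rV[R]_n -> \bar R) -> \bar R :=
  match n with
  | 0 => fun f => f 0
  | m.+1 => fun f : 'rV[R]_(1 + m) -> \bar R =>
      (\int[lebesgue_measure]_a lebesgue_integral_rV
         (fun v : 'rV[R]_m => f (row_mx (const_mx (a : R)) v)))%E
  end.

(* The integral of f over A against dV; f \_ A extends f by 0 outside A. *)
Definition hyp_integral (n : nat) (A : set 'rV[R]_n.+1)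
    (f : 'rV[R]_n.+1 -> \bar R) : \bar R :=
  lebesgue_integral_rV
    ((fun x => ((x ord0 ord_max) ^- n.+1)%:E * f x)%E \_ A).

End Geometry.

(* Processes are indexed by all of R, but only times t >= 0 are meaningful. *)
Section Brownian.
Context {R : realType} {d : measure_display} {T : measurableType d}.
Variable P : probability T R.

(* Since each G i is a sigma-algebra, taking some E i = setT yields the
   product rule for all subfamilies. *)
Definition mutually_independent (I : finType) (G : I -> set (set T)) : Prop :=
  forall E : I -> set T, (forall i, G i (E i)) ->
    P (\bigcap_i E i) = (\prod_(i : I) P (E i))%E.

Definition process_sigma (W : R -> T -> R) : set (set T) :=
  <<s [set E | exists (t : R) (A : set R), [/\ 0 <= t, measurable A & E = W t @^-1` A] ] >>.

(* normal_prob takes the standard deviation as its second argument. *)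
Definition brownian_motion (a : R) (W : R -> T -> R) : Prop :=
  [/\ forall t : R, 0 <= t -> measurable_fun setT (W t),
      {ae P, forall w, W 0 w = a},
      forall w, {within `[0, +oo[, continuous (fun t : R => W t w)},
      forall (s t : R) (A : set R), 0 <= s -> s < t -> measurable A ->
        P [set w | A (W t w - W s w)] = normal_prob 0 (Num.sqrt (t - s)) A &
      forall (k : nat) (t : nat -> R), 0 <= t 0%N ->
        (forall i, t i <= t i.+1) ->
        mutually_independent (fun i : 'I_k =>
          preimage_set_system setT (W (t i.+1) \- W (t i)) measurable)].

(* B is a standard Brownian motion and beta an n-dimensional Brownian motion
   starting from a and independent of B; mutual independence of the n + 1
   scalar processes (B at None, beta i at Some i) expresses both the
   independence of the components of beta and that of beta and B. *)
Definition driving_brownian_motions (n : nat) (a : 'I_n -> R)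
    (B : R -> T -> R) (beta : 'I_n -> R -> T -> R) : Prop :=
  [/\ brownian_motion 0 B,
      forall i, brownian_motion (a i) (beta i) &
      mutually_independent (fun o : option 'I_n =>
        process_sigma (oapp beta B o))].

End Brownian.

Section HyperbolicBrownianMotion.
Context {R : realType}.

Definition vertical_part (T : Type) (mu b : R) (B : R -> T -> R)
    (t : R) (w : T) : R :=
  b * expR (B t w - mu * t).

Definition clock (T : Type) (mu b : R) (B : R -> T -> R) (t : R) (w : T) : R :=
  \int[lebesgue_measure]_(s in `[0, t]) (vertical_part mu b B s w) ^+ 2.

(* (beta(A_t), Y_t), with Y_t in the last coordinate *)
Definition hyp_representation (T : Type) (n : nat) (mu b : R) (B : R -> T -> R)
    (beta : 'I_n -> R -> T -> R) (t : R) (w : T) : 'rV[R]_n.+1 :=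
  \row_i (if unlift ord_max i is Some j then beta j (clock mu b B t w) w
          else vertical_part mu b B t w).

Definition same_law (n : nat)
    (d : measure_display) (T : measurableType d) (P : probability T R)
    (X : R -> T -> 'rV[R]_n)
    (d' : measure_display) (T' : measurableType d') (P' : probability T' R)
    (X' : R -> T' -> 'rV[R]_n) : Prop :=
  forall (k : nat) (t : 'I_k -> R) (A : 'I_k -> set 'rV[R]_n),
    (forall j, 0 <= t j) -> (forall j, borel_rV (A j)) ->
    P [set w | forall j, A j (X (t j) w)] =
    P' [set w | forall j, A j (X' (t j) w)].

(* Under P, X is a continuous hyp_space-valued process with the law of the
   hyperbolic Brownian motion with drift mu started at x. The Brownian motions
   B and beta may live on another probability space: as A_oo is a.s. finite, beta
   cannot be recovered from X in general. *)
Definition hyp_brownian_motion (n : nat) (mu : R) (x : 'rV[R]_n.+1)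
    (d : measure_display) (T : measurableType d) (P : probability T R)
    (X : R -> T -> 'rV[R]_n.+1) : Prop :=
  [/\ forall (t : R) w, 0 <= t -> hyp_space (X t w),
      forall (t : R) A, 0 <= t -> borel_rV A -> measurable (X t @^-1` A),
      forall w, {within `[0, +oo[, continuous (fun t : R => X t w)} &
      exists (d' : measure_display) (T' : measurableType d')
        (P' : probability T' R) (B : R -> T' -> R)
        (beta : 'I_n -> R -> T' -> R),
        driving_brownian_motions P' (fun i => x ord0 (lift ord_max i)) B beta /\
        same_law P X P' (hyp_representation mu (x ord0 ord_max) B beta)].

Section Densities.
Context {d : measure_display} {T : measurableType d} {n : nat}.
Variables (P : 'rV[R]_n.+1 -> probability T R) (X : R -> T -> 'rV[R]_n.+1).

Definition continuous_transition_density
    (p : R -> 'rV[R]_n.+1 -> 'rV[R]_n.+1 -> R) : Prop :=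
  [/\ forall (t : R) x y, 0 < t -> hyp_space x -> hyp_space y -> 0 <= p t x y,
      {within [set z : R * 'rV[R]_n.+1 * 'rV[R]_n.+1 |
                [/\ 0 < z.1.1, hyp_space z.1.2 & hyp_space z.2] ],
        continuous (fun z => p z.1.1 z.1.2 z.2)} &
      forall (t : R) x A, 0 < t -> hyp_space x -> borel_rV A -> A `<=` @hyp_space R n ->
        P x [set w | A (X t w)] = hyp_integral A (fun y => (p t x y)%:E)].

Definition exit_time (D : set 'rV[R]_n.+1) (w : T) : \bar R :=
  ereal_inf [set t%:E | t in [set t : R | 0 < t /\ ~ D (X t w)] ].

(* Hunt's formula. It is valued in the extended reals, so that an equality
   with a real number also asserts that the expectation is finite. *)
Definition killed_density (p : R -> 'rV[R]_n.+1 -> 'rV[R]_n.+1 -> R)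
    (D : set 'rV[R]_n.+1) (t : R) (x y : 'rV[R]_n.+1) : \bar R :=
  ((p t x y)%:E -
   \int[P x]_(w in [set w | exit_time D w < t%:E])
     (p (t - fine (exit_time D w)) (X (fine (exit_time D w)) w) y)%:E)%E.

End Densities.

End HyperbolicBrownianMotion.

(* Main.v *)
Require Import Defs.
From HB Require Import structures.
From mathcomp Require Import all_boot all_order all_algebra.
From mathcomp Require Import all_classical all_reals all_analysis.
From mathcomp Require Import measurable_realfun.
From mathcomp Require Import ring lra.

Set Implicit Arguments.
Unset Strict Implicit.
Unset Printing Implicit Defensive.

Import Order.TTheory GRing.Theory Num.Theory.
Import numFieldNormedType.Exports.

Local Open Scope classical_set_scope.
Local Open Scope ring_scope.

(* By Hunt's formula, E^x[tau < t; p(t - tau, X_tau, y)] = p(t, x, ybar) is needed for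
   the exit time tau of D. As X_tau lies on the hyperplane {x_1 = 0}, where the
   law of X is invariant under the reflection, y may be replaced by ybar on the
   left; and a path from x to ybar has to leave D, so that the claim becomes the
   strong Markov property of X at tau. The latter is derived from the ordinary
   one. On a grid of mesh h = t / N, tau is rounded up to the end of its cell
   and the event {X_t in box} is split according to the cell; its probability
   is then the expectation of the probability of the box after the rounded
   time. With boxes of half-width r shrinking to ybar, everything is divided by
   (2 r)^n and h, r go to 0 together. Dominated convergence applies since a
   path started near {x_1 = 0} hits such a box at time u with probability at
   most K (2 r)^n, uniformly in u <= t and in the starting point.

   The Markov property itself comes from the representation (beta(A_t), Y_t):
   given Y, the horizontal increments are Gaussian with variance A_(s+u) - A_s,
   and the latter is, by scaling with Y_s, a functional of the increments of B
   after s. *)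

(** * Independence and measure theory *)

(** No hypothesis relates the measures [P z] for different [z]; each comes with driving motions of
    its own. The link is the explicit kernel [box_prob], a functional of Wiener measure: taken at
    X_s it is the conditional probability of a box given the past under [P x], and it is also the
    probability of the box under [P z]. The past is that of the first coordinate alone, which
    suffices because leaving D depends on nothing else. The obstacle is the double limit. For fixed
    r, letting h tend to 0 makes the expectation of the grid sum converge to the normalised
    probability of the box; but the grid sum converges pathwise to the integrand of Hunt's formula
    only if r tends to 0 as well. Hence h is chosen after r along a sequence, and joint continuity
    of p in time, start and end makes the pathwise limit insensitive to the relative speed. The same
    limit gives the measurability of that integrand, so that neither tau nor X at tau is studied as
    a random variable. *)

Lemma finite_measure_ext (R : realType) (d : measure_display)
    (T : measurableType d) (G : set (set T))
    (m1 m2 : {measure set T -> \bar R}) :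
  G `<=` measurable -> setI_closed G -> G setT -> (m1 setT < +oo)%E ->
  (forall E, G E -> m1 E = m2 E) -> forall E, <<s G >> E -> m1 E = m2 E.
Proof.
move=> Gm GI GT m1T m12 E sE.
apply: (@g_sigma_algebra_measure_unique d R T G Gm (fun=> setT)) => //.
by rewrite bigcup_const.
Qed.

(* [nnintegral] is a supremum over simple minorants, so that monotonicity holds
   without measurability; this is needed for iterated integrals. *)
Lemma ge0_le_integral_nonmeas (R : realType) (d : measure_display)
    (T : measurableType d) (mu : {measure set T -> \bar R}) (D : set T)
    (f g : T -> \bar R) :
  (forall x, D x -> 0 <= f x)%E -> (forall x, D x -> f x <= g x)%E ->
  (\int[mu]_(x in D) f x <= \int[mu]_(x in D) g x)%E.
Proof.
Import HBNNSimple.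
move=> f0 fg.
have g0 x : D x -> (0 <= g x)%E by move=> Dx; exact: le_trans (f0 _ Dx) (fg _ Dx).
rewrite integral_mkcond [leRHS]integral_mkcond !ge0_integralTE; last 2 first.
- by move=> x; rewrite patchE; case: ifPn => // /set_mem; exact: g0.
- by move=> x; rewrite patchE; case: ifPn => // /set_mem; exact: f0.
apply: ereal_sup_le => /= _ [h hf <-]; exists h => // x; apply: le_trans (hf x) _.
by rewrite !patchE; case: ifPn => // /set_mem /fg.
Qed.

Section Independence.
Context {R : realType} {d : measure_display} {T : measurableType d}.
Variable P : probability T R.

Definition independent (G1 G2 : set (set T)) : Prop :=
  forall E F, G1 E -> G2 F -> P (E `&` F) = (P E * P F)%E.

Lemma independent_sym (G1 G2 : set (set T)) :
  independent G1 G2 -> independent G2 G1.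
Proof. by move=> i E F GE GF; rewrite setIC i// muleC. Qed.

Lemma independent_sigmal (G1 G2 : set (set T)) :
  G1 `<=` measurable -> G2 `<=` measurable -> setI_closed G1 -> G1 setT ->
  independent G1 G2 -> independent <<s G1 >> G2.
Proof.
move=> G1m G2m G1I G1T ind E F sE GF.
have mF := G2m _ GF.
have PF : 0 <= fine (P F) by rewrite fine_ge0.
pose c := NngNum PF.
suff: mrestr P mF E = mscale c P E.
  by rewrite /mrestr /mscale/= muleC => ->; rewrite fineK ?fin_num_measure.
apply: (finite_measure_ext G1m G1I G1T _ _ sE).
  by rewrite /= /mrestr setTI ltey_eq fin_num_measure.
move=> A GA; rewrite /= /mrestr /mscale/= ind// muleC fineK//.
by rewrite fin_num_measure.
Qed.

Lemma independent_sigma (G1 G2 : set (set T)) :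
  G1 `<=` measurable -> G2 `<=` measurable ->
  setI_closed G1 -> setI_closed G2 -> G1 setT -> G2 setT ->
  independent G1 G2 -> independent <<s G1 >> <<s G2 >>.
Proof.
move=> G1m G2m G1I G2I G1T G2T ind.
apply: independent_sym; apply: independent_sigmal => //.
  exact: smallest_sub (sigma_algebra_measurable _) G1m.
by apply: independent_sym; exact: independent_sigmal.
Qed.

End Independence.

(* Freezing: [f] is integrated last, [g] may be replaced by an independent copy. *)
Lemma integral_freeze (R : realType) (d d1 d2 : measure_display)
    (T : measurableType d) (U : measurableType d1) (V : measurableType d2)
    (P : probability T R) (Q : probability V R) (f : T -> U) (g : T -> V)
    (phi : U * V -> \bar R) :
  measurable_fun setT f -> measurable_fun setT g ->
  (forall E F, measurable E -> measurable F ->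
    P (f @^-1` E `&` g @^-1` F) = (P (f @^-1` E) * Q F)%E) ->
  measurable_fun setT phi -> (forall z, 0 <= phi z)%E ->
  (\int[P]_w phi (f w, g w) = \int[P]_w \int[Q]_v phi (f w, v))%E.
Proof.
move=> mf mg ind mphi phi0.
pose f' : {mfun T >-> U} := HB.pack f (isMeasurableFun.Build _ _ _ _ f mf).
pose h w := (f w, g w).
have mh : measurable_fun setT h by exact: measurable_fun_pair.
pose h' : {mfun T >-> (U * V)%type} := HB.pack h (isMeasurableFun.Build _ _ _ _ h mh).
pose m1 : probability U R := distribution P f'.
pose m2 : probability _ R := distribution P h'.
(* The hypothesis on rectangles says that the joint law of [f] and [g] is the product of the law of
   [f] with [Q]; the rest is Tonelli. *)
have E12 X : measurable X -> (m1 \x Q)%E X = m2 X.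
  apply: product_measure_unique => A B mA mB.
  by rewrite /m1 /m2 /= /distribution /pushforward /= -ind.
transitivity (\int[m2]_z phi z)%E.
  by rewrite /m2 ge0_integral_distribution.
transitivity (\int[m1 \x Q]_z phi z)%E.
  by apply: eq_measure_integral => A mA _; exact/esym/E12.
rewrite (fubini_tonelli1 phi)// /m1 ge0_integral_distribution//.
- exact: measurable_fun_fubini_tonelli_F.
- by move=> x; apply: integral_ge0.
Qed.

(** Paths are continuous on [0, +oo[ only. Clamping the time makes them continuous on the whole line
    without changing them at meaningful times. *)
Lemma continuous_clamp (R : realType) (f : R -> R) :
  {within `[0, +oo[, continuous f} -> continuous (fun t : R => f (Num.max t 0)).
Proof.
move=> cf x.
have A0 : `[0, +oo[%classic (Num.max x 0).
  by rewrite /= in_itv/= andbT le_max lexx orbT.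
have fc : f @ within `[0, +oo[%classic (nbhs (Num.max x 0)) --> f (Num.max x 0).
  by rewrite (nbhs_subspace_in A0); exact: cf.
apply: (cvg_comp (fun t => Num.max t 0) f _ fc).
have cm : (fun t : R => Num.max t 0) @ x --> Num.max x 0.
  exact: (@continuous_max R R id (fun=> 0) x cvg_id (cvg_cst _)).
move=> U nU; change (nbhs x (fun t => U (Num.max t 0))).
apply: (@filterS _ (nbhs x) _ _ _ _ (cm _ nU)) => t /=; apply.
by rewrite in_itv/= andbT le_max lexx orbT.
Qed.

(** Rounding the time down to a multiple of 1 / (m + 1) gives a function whose preimages are
    countable unions of rectangles; by continuity in time these functions converge pointwise. *)
Lemma measurable_caratheodory (R : realType) (d : measure_display)
    (T : measurableType d) (W : R -> T -> R) :
  (forall t, measurable_fun setT (W t)) ->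
  (forall w, continuous (fun t : R => W t w)) ->
  measurable_fun setT (fun z : R * T => W z.1 z.2).
Proof.
move=> mW cW.
pose q (m : nat) (t : R) : R := (Num.floor (t * m.+1%:R))%:~R / m.+1%:R.
apply: (@measurable_fun_cvg _ _ _ _ (fun m (z : R * T) => W (q m z.1) z.2)).
- move=> m _ A mA; rewrite setTI.
  rewrite (_ : _ @^-1` _ = \bigcup_(k : int)
    ([set t | Num.floor (t * m.+1%:R) = k] `*` (W (k%:~R / m.+1%:R) @^-1` A))).
    apply: countable_bigcupT_measurable => // k; apply: measurableX; last first.
      by rewrite -[X in measurable X]setTI; exact: mW.
    rewrite (_ : [set _ | _] = (fun t => t * m.+1%:R) @^-1` `[k%:~R, (k + 1)%:~R[).
      rewrite -[X in measurable X]setTI.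
      have : measurable_fun setT (fun t : R => t * m.+1%:R) by exact: measurable_funM.
      exact.
    apply/seteqP; split => t /=; rewrite in_itv/=.
      by move=> <-; rewrite ge_floor lt_succ_floor.
    by move=> /floor_def.
  apply/seteqP; split => [[t w] /= h|[t w] /= [k _ [/= <-]]//].
  by exists (Num.floor (t * m.+1%:R)).
- move=> [t w] _ /=.
  suff qc : q ^~ t @ \oo --> t by apply: cvg_comp qc (cW w t).
  apply/cvgrPdist_le => e e0.
  have h := near_infty_natSinv_lt (PosNum e0).
  near=> m.
  have m0 : 0 < m.+1%:R :> R by [].
  rewrite /q; set k := Num.floor _.
  have /andP[k1 k2] : (k%:~R <= t * m.+1%:R < (k + 1)%:~R).
    by rewrite floor_itv.
  have -> : t - k%:~R / m.+1%:R = (t * m.+1%:R - k%:~R) / m.+1%:R.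
    by rewrite mulrBl mulfK// gt_eqF.
  rewrite ger0_norm; last by rewrite divr_ge0// subr_ge0.
  apply: (@le_trans _ _ (m.+1%:R^-1)).
    by rewrite ler_pdivrMr// mulVf ?gt_eqF// lerBlDl; move: k2; rewrite intrD => /ltW.
  by apply/ltW; near: m.
Unshelve. all: by end_near. Qed.

(** * Path space and the Markov property of Brownian motion *)

Section Cylinders.
Context {R : realType} {T : Type}.
Implicit Types (W : R -> T -> R) (I : set R).

Definition process_gen W I : set (set T) :=
  [set E | exists (t : R) (A : set R), [/\ I t, measurable A & E = W t @^-1` A] ].

(** A π-system generating the same σ-algebra as [process_gen]. The constraints are indexed by the
    time itself and not by its position in the list, so repeated times are harmless. *)
Definition fin_cylinder W I : set (set T) :=
  [set E | exists (l : seq R) (A : R -> set R),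
    [/\ forall r, r \in l -> I r, forall r, measurable (A r) &
        E = [set w | forall r, r \in l -> A r (W r w)] ] ].

Lemma fin_cylinderT W I : fin_cylinder W I setT.
Proof. by exists [::], (fun=> setT); split => //; apply/seteqP; split. Qed.

Lemma fin_cylinderI W I : setI_closed (fin_cylinder W I).
Proof.
move=> _ _ [l1 [A1 [I1 mA1 ->]]] [l2 [A2 [I2 mA2 ->]]].
exists (l1 ++ l2), (fun r => (if r \in l1 then A1 r else setT) `&`
                             (if r \in l2 then A2 r else setT)).
split.
- by move=> r; rewrite mem_cat => /orP[/I1|/I2].
- by move=> r; apply: measurableI; case: ifP.
- apply/seteqP; split => [w [h1 h2] r _|w h].
    by split; case: ifPn => // ?; [exact: h1|exact: h2].
  split=> r rl; have := h r; rewrite mem_cat rl ?orbT => /(_ isT)[].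
    by [].
  by [].
Qed.

Lemma sub_process_gen_fin_cylinder W I :
  <<s process_gen W I >> `<=` <<s fin_cylinder W I >>.
Proof.
apply: smallest_sub; first exact: smallest_sigma_algebra.
move=> _ [t [A [It mA ->]]]; apply: sub_sigma_algebra.
exists [:: t], (fun=> A); split => // [r|]; first by rewrite inE => /eqP ->.
apply/seteqP; split => [w /= Aw r|w /= /(_ t)]; first by rewrite inE => /eqP ->.
by rewrite inE eqxx; exact.
Qed.

End Cylinders.

Lemma fin_cylinder_measurable (R : realType) (d : measure_display)
    (T : measurableType d) (W : R -> T -> R) (I : set R) :
  (forall t, I t -> measurable_fun setT (W t)) ->
  fin_cylinder W I `<=` measurable.
Proof.
move=> mW _ [l [A [Il mA ->]]].
rewrite (_ : [set _ | _] = \bigcap_(r in [set` l]) (W r @^-1` A r)) //.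
apply: fin_bigcap_measurable; first exact: finite_seq.
by move=> r /Il Ir; rewrite -[X in measurable X]setTI; exact: mW.
Qed.

Lemma measurable_process_gen (R : realType) (T : pointedType)
    (W : R -> T -> R) (I : set R) (t : R) : I t ->
  measurable_fun (setT : set (g_sigma_algebraType (process_gen W I))) (W t).
Proof.
by move=> It _ A mA; rewrite setTI; apply: sub_sigma_algebra; exists t, A.
Qed.

Section PathSpace.
Variable R : realType.

Record cpath := CPath {
  path_fun :> R -> R;
  path_cont : {within `[0, +oo[, continuous path_fun} }.

HB.instance Definition _ := gen_eqMixin cpath.
HB.instance Definition _ := gen_choiceMixin cpath.

Lemma path0_cont : {within `[0, +oo[, continuous (fun _ : R => 0 : R)}.
Proof. by apply: continuous_subspaceT => x; exact: cvg_cst. Qed.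

HB.instance Definition _ := isPointed.Build cpath (CPath path0_cont).

Definition path_eval (t : R) (f : cpath) : R := f t.

Definition pathT := g_sigma_algebraType (process_gen path_eval [set t | 0 <= t]).

End PathSpace.

Section PathOf.
Context {R : realType} {T : pointedType} {W : R -> T -> R}.
Hypothesis cW : forall w, {within `[0, +oo[, continuous (fun t : R => W t w)}.

Definition path_of (w : T) : pathT R := CPath (@cW w).

(** The map [f] allows the path map to be measured against a smaller σ-algebra on the same space: it
    is then the identity from a [g_sigma_algebraType]. *)
Lemma measurable_path_of (d : measure_display) (T' : measurableType d)
   (f : T' -> T) : (forall t, 0 <= t -> measurable_fun setT (W t \o f)) ->
  measurable_fun setT (path_of \o f).
Proof.
move=> mW.
pose G := process_gen (@path_eval R) [set t | 0 <= t].
apply: (@measurability _ _ T' (g_sigma_algebraType G) setT (path_of \o f) G) => //.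
move=> _ [_ [t [A [t0 mA ->]]] <-].
exact: mW.
Qed.

End PathOf.

(** [brownian_motion] speaks of increments along nondecreasing sequences. Finitely many past and
    future times are embedded in one such sequence, in which [s] is a grid point separating them. *)
Lemma grid_exists (R : realType) (s : R) (l1 l2 : seq R) :
  0 <= s -> (forall r, r \in l1 -> 0 <= r <= s) ->
  (forall r, r \in l2 -> s <= r) ->
  exists (t : nat -> R) (k1 k : nat),
    [/\ t 0%N = 0, forall i, t i <= t i.+1, t k1 = s /\ (k1 <= k)%N,
      forall r, r \in l1 -> exists2 j, (j <= k1)%N & t j = r &
      forall r, r \in l2 -> exists2 j, (k1 <= j <= k)%N & t j = r].
Proof.
move=> s0 h1 h2.
pose L := sort <=%R (0 :: s :: l1 ++ l2).
have memL r : (r \in L) = (r \in (0 :: s :: l1 ++ l2)) by rewrite mem_sort.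
have sL : sorted <=%R L by apply: sort_sorted; exact: le_total.
have szL : (0 < size L)%N by rewrite size_sort.
(* Capping the index at the last entry makes the sequence constant from there on, hence
   nondecreasing on all of [nat]. *)
pose t i := nth 0 L (minn i (size L).-1).
have tle i j : (i <= j)%N -> t i <= t j.
  move=> ij; apply: (sorted_leq_nth le_trans lexx 0 sL); rewrite ?inE.
  - by rewrite -(prednK szL) ltnS geq_minr.
  - by rewrite -(prednK szL) ltnS geq_minr.
  - by rewrite leq_min geq_minr andbT (leq_trans (geq_minl _ _)).
have tidx r : r \in L -> t (index r L) = r.
  move=> rL; rewrite /t (minn_idPl _) ?nth_index//.
  by rewrite -ltnS (prednK szL) index_mem.
have L0 : 0 \in L by rewrite memL inE eqxx.
have Ls : s \in L by rewrite memL !inE eqxx orbT.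
have t0 : t 0%N = 0.
  apply/eqP; rewrite eq_le; apply/andP; split.
    by rewrite -[leRHS](tidx _ L0); exact: tle.
  have : t 0%N \in L by rewrite mem_nth// /t min0n.
  rewrite memL !inE mem_cat => /or3P[/eqP->//|/eqP->//|/orP[/h1/andP[]//|]].
  by move=> /h2; exact: le_trans.
exists t, (index s L), (size L).-1; split => //.
- by move=> i; exact: tle.
- by split; [exact: tidx|rewrite -ltnS (prednK szL) index_mem].
- move=> r rl; have rL : r \in L by rewrite memL !inE mem_cat rl !orbT.
  have [jk|kj] := leqP (index r L) (index s L).
    by exists (index r L) => //; exact: tidx.
  exists (index s L) => //; rewrite tidx//; apply/eqP; rewrite eq_le.
  have := tle _ _ (ltnW kj); rewrite !tidx// => ->.
  by have /andP[] := h1 _ rl.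
- move=> r rl; have rL : r \in L by rewrite memL !inE mem_cat rl !orbT.
  have jn : (index r L <= (size L).-1)%N by rewrite -ltnS (prednK szL) index_mem.
  have [kj|jk] := leqP (index s L) (index r L).
    by exists (index r L); [rewrite kj|exact: tidx].
  exists (index s L); first by rewrite leqnn -ltnS (prednK szL) index_mem.
  apply/eqP; rewrite eq_le tidx// h2//=.
  by have := tle _ _ (ltnW jk); rewrite !tidx.
Qed.

Section BrownianIncrements.
Context {R : realType} {d : measure_display} {T : measurableType d}.
Variables (P : probability T R) (a : R) (W : R -> T -> R).
Hypothesis bm : brownian_motion P a W.

Lemma bm_measurable t : 0 <= t -> measurable_fun setT (W t).
Proof. by case: bm => + _ _ _ _; exact. Qed.

Lemma bm_continuous w : {within `[0, +oo[, continuous (fun t : R => W t w)}.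
Proof. by case: bm => _ _ + _ _; exact. Qed.

Lemma bm_start : {ae P, forall w, W 0 w = a}.
Proof. by case: bm. Qed.

Lemma bm_rect (t : nat -> R) (k : nat) (C : nat -> set R) :
  0 <= t 0%N -> (forall i, t i <= t i.+1) -> (forall i, measurable (C i)) ->
  P [set w | forall i, (i < k)%N -> C i (W (t i.+1) w - W (t i) w)] =
  (\prod_(i < k) P [set w | C i (W (t i.+1) w - W (t i) w)%R])%E.
Proof.
move=> t0 ti mC; case: bm => _ _ _ _ /(_ k t t0 ti).
move=> /(_ (fun i : 'I_k => [set w | C i (W (t i.+1) w - W (t i) w)])) <-.
  congr (P _); apply/seteqP; split => [w h i _|w h i ik]; first exact: h.
  exact: (h (Ordinal ik)).
by move=> i; exists (C i); rewrite ?setTI.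
Qed.

End BrownianIncrements.

Lemma bm_incr_law (R : realType) (d d' : measure_display)
    (T : measurableType d) (T' : measurableType d')
    (P : probability T R) (P' : probability T' R) (a a' : R)
    (W : R -> T -> R) (W' : R -> T' -> R) (s t s' t' : R) (A : set R) :
  brownian_motion P a W -> brownian_motion P' a' W' ->
  0 <= s -> s <= t -> 0 <= s' -> t - s = t' - s' -> measurable A ->
  P [set w | A (W t w - W s w)] = P' [set w | A (W' t' w - W' s' w)].
Proof.
move=> [_ _ _ h _] [_ _ _ h' _] s0; rewrite le_eqVlt => /orP[/eqP <-|st] s'0 e mA.
  have -> : t' = s' by apply/eqP; rewrite -subr_eq0 -e subrr.
  (* The definition gives the law of an increment only for distinct times; for equal times both
     increments are 0 and the two events are both full or both empty. *)
  under eq_fun do rewrite subrr.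
  under [in RHS]eq_fun do rewrite subrr.
  have [A0|nA0] := pselect (A 0).
    rewrite (_ : [set _ | _] = setT) ?probability_setT; last by apply/seteqP; split.
    by rewrite (_ : [set _ | _] = setT) ?probability_setT//; apply/seteqP; split.
  rewrite (_ : [set _ | _] = set0) ?measure0; last by apply/seteqP; split.
  by rewrite (_ : [set _ | _] = set0) ?measure0//; apply/seteqP; split.
rewrite h// e h'//.
by rewrite -subr_gt0 -e subr_gt0.
Qed.

Section Markov.
Context {R : realType} {d : measure_display} {T : measurableType d}.
Variables (P : probability T R) (a : R) (W : R -> T -> R).
Hypothesis bm : brownian_motion P a W.

Let incr (t : nat -> R) (i : nat) (w : T) := W (t i.+1) w - W (t i) w.

Let incr_gen (t : nat -> R) (k1 k : nat) : set (set T) :=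
  [set E | exists2 C : nat -> set R, (forall i, measurable (C i)) &
    E = [set w | forall i, (k1 <= i < k)%N -> C i (incr t i w)] ].

Lemma incr_genT t k1 k : incr_gen t k1 k setT.
Proof. by exists (fun=> setT) => //; apply/seteqP; split. Qed.

Lemma incr_genI t k1 k : setI_closed (incr_gen t k1 k).
Proof.
move=> _ _ [C mC ->] [C' mC' ->]; exists (fun i => C i `&` C' i).
  by move=> i; exact: measurableI.
apply/seteqP; split => [w [h h'] i ik|w h].
  by split; [exact: h|exact: h'].
by split => i ik; have [] := h i ik.
Qed.

Lemma measurable_incr t i : 0 <= t 0%N -> (forall i, t i <= t i.+1) ->
  measurable_fun setT (incr t i).
Proof.
move=> t0 ti; have tge0 j : 0 <= t j.
  by elim: j => // j; move=> /le_trans; apply.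
by apply: measurable_funB; exact: (bm_measurable bm).
Qed.

Lemma incr_gen_measurable t k1 k : 0 <= t 0%N -> (forall i, t i <= t i.+1) ->
  incr_gen t k1 k `<=` measurable.
Proof.
move=> t0 ti _ [C mC ->].
rewrite (_ : [set _ | _] = \bigcap_(i in [set i | (k1 <= i < k)%N]) (incr t i @^-1` C i))//.
apply: bigcap_measurableType => i _.
by rewrite -[X in measurable X]setTI; apply: measurable_incr.
Qed.

(** Padding with [setT] turns a rectangle in the first [k1] increments and one in the others into
    rectangles in all [k] of them; the product formula then splits factor by factor. *)
Lemma incr_gen_independent t k1 k : 0 <= t 0%N -> (forall i, t i <= t i.+1) ->
  (k1 <= k)%N ->
  independent P <<s incr_gen t 0 k1 >> <<s incr_gen t k1 k >>.
Proof.
move=> t0 ti k1k; apply: independent_sigma; try exact: incr_genI;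
  try exact: incr_genT; try exact: incr_gen_measurable.
move=> _ _ [C mC ->] [C' mC' ->].
pose D i := if (i < k1)%N then C i else setT.
pose D' i := if (i < k1)%N then setT else C' i.
have mD i : measurable (D i) by rewrite /D; case: ifP.
have mD' i : measurable (D' i) by rewrite /D'; case: ifP.
transitivity (P [set w | forall i, (i < k)%N -> (D i `&` D' i) (incr t i w)]).
  congr (P _); apply/seteqP; split => [w [h h'] i ik|w h].
    rewrite /D /D'; case: ltnP => ik1; split => //; first exact: h.
    by apply: h'; rewrite ik1.
  split => i /=.
    move=> ik1; have := h i (leq_trans ik1 k1k).
    by rewrite /D /D' ik1 => -[].
  move=> /andP[k1i ik]; have := h i ik.
  by rewrite /D /D' ltnNge k1i => -[].
etransitivity.
  apply: (@bm_rect _ _ _ _ _ _ bm t k (fun i => D i `&` D' i)) => // i.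
  exact: measurableI.
transitivity ((\prod_(i < k) P [set w | D i (incr t i w)]) *
              (\prod_(i < k) P [set w | D' i (incr t i w)]))%E.
  rewrite -big_split/=; apply: eq_bigr => i _.
  have P1 : P [set w | [set: R] (incr t i w)] = 1%E.
    by rewrite -(@probability_setT _ _ _ P); congr (P _); apply/seteqP; split.
  by rewrite /D /D'; case: ifPn => _; rewrite P1 ?mule1 ?mul1e; congr (P _);
    apply/seteqP; split => w; [case|split|case|split].
congr (_ * _)%E; (etransitivity; first by apply/esym; exact: (bm_rect bm k t0 ti)).
  congr (P _); apply/seteqP; split => [w h i /= ik1|w h i ik].
    by have := h i (leq_trans ik1 k1k); rewrite /D ik1.
  by rewrite /D; case: ifPn => // ik1; exact: h.
congr (P _); apply/seteqP; split => [w h i /= /andP[k1i ik]|w h i ik].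
  by have := h i ik; rewrite /D' ltnNge k1i.
by rewrite /D'; case: ltnP => // ik1; apply: h; rewrite ik1.
Qed.

Lemma measurable_incr_sum t k1 k i j : (k1 <= i)%N -> (i <= j)%N -> (j <= k)%N ->
  measurable_fun (setT : set (g_sigma_algebraType (incr_gen t k1 k)))
    (fun w => W (t j) w - W (t i) w).
Proof.
move=> k1i ij jk.
rewrite (_ : (fun w => W (t j) w - W (t i) w) = (fun w => \sum_(i <= l < j) incr t l w)); last first.
  by apply/funext => w; rewrite /incr (telescope_sumr (fun l => W (t l) w) ij).
(* The guard is always true on the summation range; it makes every summand measurable for the
   σ-algebra of the increments between [k1] and [k]. *)
rewrite (_ : (fun w => \sum_(i <= l < j) incr t l w) = (fun w => \sum_(l <- index_iota i j)
    if (k1 <= l < k)%N then incr t l w else 0)); last first.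
  apply/funext => w; rewrite [LHS]big_seq_cond [RHS]big_seq_cond.
  apply: eq_bigr => l; rewrite andbT mem_index_iota => /andP[il lj].
  by rewrite (leq_trans k1i il) (leq_trans lj jk).
apply: measurable_sum => l; case: (boolP (k1 <= l < k)%N) => lk; last exact: measurable_cst.
move=> _ A mA; rewrite setTI; apply: sub_sigma_algebra.
exists (fun i => if i == l then A else setT).
  by move=> m; case: ifP.
apply/seteqP; split => [w Aw m _|w h]; first by case: eqVneq => // ->.
by have := h l lk; rewrite eqxx.
Qed.

(** The past contains [W 0], which is no function of increments but equals [a] almost surely. A past
    cylinder is therefore replaced by [E'], where W_r is rewritten as a + (W_r - W_0), at no cost in
    probability. *)
Lemma bm_independent_increments s : 0 <= s ->
  independent P <<s process_gen W `[0, s] >>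
    <<s process_gen (fun r w => W (s + r) w - W s w) [set t | 0 <= t] >>.
Proof.
move=> s0.
set W' := fun r w => W (s + r) w - W s w.
suff: independent P <<s fin_cylinder W `[0, s] >>
                    <<s fin_cylinder W' [set t | 0 <= t] >>.
  by move=> h E F /sub_process_gen_fin_cylinder sE
    /sub_process_gen_fin_cylinder sF; exact: h.
have mW t : `[0, s]%classic t -> measurable_fun setT (W t).
  by rewrite /= in_itv/= => /andP[t0 _]; exact: (bm_measurable bm).
have mW' t : [set t | 0 <= t] t -> measurable_fun setT (W' t).
  move=> /= t0; apply: measurable_funB; last exact: (bm_measurable bm).
  by apply: (bm_measurable bm); rewrite addr_ge0.
apply: independent_sigma; try exact: fin_cylinderI; try exact: fin_cylinderT;
  try exact: fin_cylinder_measurable.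
move=> E F cE cF.
have mE := fin_cylinder_measurable mW cE.
have mF := fin_cylinder_measurable mW' cF.
case: cE mE => l1 [A [l1s mA ->]] mE.
case: cF mF => l2 [C [l2s mC ->]] mF.
have [||t [k1 [k [t0 ti [tk1 k1k] h1 h2]]]] :=
    @grid_exists R s l1 [seq s + r | r <- l2] s0.
- by move=> r /l1s; rewrite /= in_itv.
- by move=> _ /mapP[r /l2s /= r0 ->]; rewrite lerDl.
have t0' : 0 <= t 0%N by rewrite t0.
pose E' : set T := [set w | forall r, r \in l1 -> A r (a + (W r w - W 0 w))].
have sE' : <<s incr_gen t 0 k1 >> E'.
  rewrite [E'](_ : _ = \bigcap_(r in [set` l1])
     ((fun w => a + (W r w - W 0 w)) @^-1` A r))//.
  apply: (@fin_bigcap_measurable _ (g_sigma_algebraType (incr_gen t 0 k1))) => //.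
  move=> r /= /h1[j jk1 <-].
  rewrite -[X in measurable X]setTI -t0.
  have m1 := @measurable_incr_sum t 0%N k1 0%N j (leqnn _) (leq0n _) jk1.
  exact: (measurable_funD (measurable_cst a) m1).
have sF' : <<s incr_gen t k1 k >> [set w | forall r, r \in l2 -> C r (W' r w)].
  rewrite [X in <<s _ >> X](_ : _ = \bigcap_(r in [set` l2]) (W' r @^-1` C r))//.
  apply: (@fin_bigcap_measurable _ (g_sigma_algebraType (incr_gen t k1 k))) => //.
  move=> r /= rl2; have /h2[j /andP[k1j jk] tj] : s + r \in [seq s + r | r <- l2].
    by rewrite map_f.
  rewrite -[X in measurable X]setTI /W' -tj -tk1.
  by have m1 := @measurable_incr_sum t k1 k k1 j (leqnn _) k1j jk; exact: m1.
have mE' : measurable E'.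
  exact: (smallest_sub (sigma_algebra_measurable _) (incr_gen_measurable t0' ti) sE').
have ae F0 : measurable F0 ->
    P ([set w | forall r, r \in l1 -> A r (W r w)] `&` F0) = P (E' `&` F0).
  move=> mF0; have [N [mN N0 sN]] := bm_start bm.
  have aux X : measurable X -> P (X `&` F0) = P ((X `&` F0) `\` N).
    move=> mX; have mXF : measurable (X `&` F0) by exact: measurableI.
    rewrite measureD ?ltey_eq ?fin_num_measure//.
    rewrite [X in (_ - X)%E](_ : _ = 0%E) ?sube0//.
    by apply: subset_measure0 N0 => //; exact: measurableI.
  rewrite aux// [RHS]aux//; congr (P _).
  have st w : ~ N w -> W 0 w = a by apply: contra_notP => h; exact: sN.
  apply/seteqP; split => w [[h Fw] Nw]; split=> //; split => // r rl.
    by rewrite st// addrC subrK; exact: h.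
  by have := h r rl; rewrite st// addrC subrK.
rewrite ae// (incr_gen_independent t0' ti k1k)//; congr (_ * _)%E.
by have := ae setT measurableT; rewrite !setIT.
Qed.

End Markov.

Section BrownianLaw.
Context {R : realType} {d d' : measure_display}.
Context {T : measurableType d} {T' : measurableType d'}.
Variables (P : probability T R) (P' : probability T' R) (a a' : R).
Variables (W : R -> T -> R) (W' : R -> T' -> R).

Definition seq_gen (k : nat) : set (set (nat -> R)) :=
  [set E | exists2 C : nat -> set R, (forall i, measurable (C i)) &
    E = [set x | forall i, (i < k)%N -> C i (x i)] ].

(** Over a common grid the sequences of increments have the same rectangle probabilities, hence the
    same law; the event is read off from their partial sums. *)
Lemma bm_law s s' : brownian_motion P a W -> brownian_motion P' a' W' ->
  0 <= s -> 0 <= s' ->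
  forall (l : seq R) (A : R -> set R),
  (forall r, r \in l -> 0 <= r) -> (forall r, measurable (A r)) ->
  P [set w | forall r, r \in l -> A r (W (s + r) w - W s w)] =
  P' [set w | forall r, r \in l -> A r (W' (s' + r) w - W' s' w)].
Proof.
move=> bm bm' s0 s'0 l A l0 mA.
have [||t [k1 [k [t0 ti [tk1 k1k] _ h2]]]] := @grid_exists R 0 [::] l (lexx _).
- by [].
- by move=> r /l0.
have t0' : 0 <= t 0%N by rewrite t0.
pose N := g_sigma_algebraType (seq_gen k).
pose D (w : T) : N := fun i => W (s + t i.+1) w - W (s + t i) w.
pose D' (w : T') : N := fun i => W' (s' + t i.+1) w - W' (s' + t i) w.
have mD : measurable_fun setT D.
  apply: (@measurability _ _ T N setT D (seq_gen k)) => //.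
  move=> _ [_ [C mC ->] <-]; rewrite setTI.
  apply: (@incr_gen_measurable _ _ _ _ _ _ bm (fun i => s + t i) 0%N k).
  - by rewrite t0 addr0.
  - by move=> i; rewrite lerD2l.
  - by exists C.
have mD' : measurable_fun setT D'.
  apply: (@measurability _ _ T' N setT D' (seq_gen k)) => //.
  move=> _ [_ [C mC ->] <-]; rewrite setTI.
  apply: (@incr_gen_measurable _ _ _ _ _ _ bm' (fun i => s' + t i) 0%N k).
  - by rewrite t0 addr0.
  - by move=> i; rewrite lerD2l.
  - by exists C.
pose fD : {mfun T >-> N} := HB.pack D (isMeasurableFun.Build _ _ _ _ D mD).
pose fD' : {mfun T' >-> N} := HB.pack D' (isMeasurableFun.Build _ _ _ _ D' mD').
pose m1 : probability N R := distribution P fD.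
pose m2 : probability N R := distribution P' fD'.
have E12 : forall E, <<s seq_gen k >> E -> m1 E = m2 E.
  apply: (@finite_measure_ext R _ N (seq_gen k) m1 m2).
  - by move=> X; exact: sub_sigma_algebra.
  - move=> _ _ [C mC ->] [C' mC' ->]; exists (fun i => C i `&` C' i).
      by move=> i; exact: measurableI.
    apply/seteqP; split => [w [h h'] i ik|w h].
      by split; [exact: h|exact: h'].
    by split => i ik; have [] := h i ik.
  - by exists (fun=> setT) => //; apply/seteqP; split.
  - by rewrite ltey_eq fin_num_measure.
  move=> _ [C mC ->]; rewrite /m1 /m2/= /distribution /pushforward/=.
  have tk i : 0 <= t i by elim: i => // i; move=> /le_trans; apply.
  have := @bm_rect _ _ _ _ _ _ bm (fun i => s + t i) k C.
  have := @bm_rect _ _ _ _ _ _ bm' (fun i => s' + t i) k C.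
  rewrite /preimage/= /D /D' => -> //; first move=> -> //.
  - apply: eq_bigr => i _; apply: (bm_incr_law bm bm') => //.
    + by rewrite addr_ge0.
    + by rewrite lerD2l.
    + by rewrite addr_ge0.
    + ring.
  - by rewrite t0 addr0.
  - by move=> i; rewrite lerD2l.
  - by rewrite t0 addr0.
  - by move=> i; rewrite lerD2l.
(* Quantifying over every grid index of [r] avoids choosing one; [h2] provides at least one. *)
pose F : set N := [set x | forall r, r \in l ->
  forall j, (j <= k)%N -> t j = r -> A r (\sum_(i <- iota 0 j) x i)].
have mF : measurable F.
  rewrite [F](_ : _ = \bigcap_(r in [set` l]) \bigcap_(j in [set j | (j <= k)%N /\ t j = r])
     ((fun x : N => \sum_(i <- iota 0 j) x i) @^-1` A r)); last first.
    apply/seteqP; split => [x Fx r rl j [jk tj]|x Fx r rl j jk tj]; first exact: Fx.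
    by apply: (Fx r rl); split.
  apply: fin_bigcap_measurable => // r _; apply: bigcap_measurableType => j [jk _].
  rewrite -[X in measurable X]setTI.
  suff mS : measurable_fun setT (fun x : N => \sum_(i <- iota 0 j) x i) by exact: mS.
  rewrite (_ : (fun x : N => _) =
      (fun x : N => \sum_(i <- iota 0 j) if (i < k)%N then x i else 0)); last first.
    apply/funext => x; rewrite [LHS]big_seq_cond [RHS]big_seq_cond.
    apply: eq_bigr => i; rewrite andbT mem_iota add0n => /andP[_ ij].
    by rewrite (leq_trans ij jk).
  apply: measurable_sum => i; case: (ltnP i k) => ik; last exact: measurable_cst.
  move=> _ B mB; rewrite setTI; apply: sub_sigma_algebra.
  exists (fun m => if m == i then B else setT); first by move=> m; case: ifP.
  apply/seteqP; split => [x Bx m _|x h]; first by case: eqVneq => // ->.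
  by have := h i ik; rewrite eqxx.
have DE r j w : (j <= k)%N -> t j = r -> \sum_(i <- iota 0 j) D w i = W (s + r) w - W s w.
  move=> jk <-; rewrite /D -{1}(subn0 j) -/(index_iota 0 j).
  by rewrite (telescope_sumr (fun l => W (s + t l) w))// t0 addr0.
have DE' r j w : (j <= k)%N -> t j = r ->
    \sum_(i <- iota 0 j) D' w i = W' (s' + r) w - W' s' w.
  move=> jk <-; rewrite /D' -{1}(subn0 j) -/(index_iota 0 j).
  by rewrite (telescope_sumr (fun l => W' (s' + t l) w))// t0 addr0.
have := E12 _ mF; rewrite /m1 /m2 /= /distribution /pushforward/= => h.
transitivity (P (D @^-1` F)); [|rewrite h]; congr (_ _);
    apply/seteqP; split => w Fw r rl.
- by move=> j jk tj; rewrite (DE r)//; exact: Fw.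
- have [j /andP[_ jk] tj] := h2 _ rl.
  by have := Fw r rl j jk tj; rewrite (DE r).
- have [j /andP[_ jk] tj] := h2 _ rl.
  by have := Fw r rl j jk tj; rewrite (DE' r).
- by move=> j jk tj; rewrite (DE' r)//; exact: Fw.
Qed.

End BrownianLaw.

(** * The clock and the box probabilities *)

Lemma lebesgue_measure_shift (R : realType) (s : R) (A : set R) : measurable A ->
  pushforward lebesgue_measure (fun x : R => s + x : measurableTypeR R) A =
  lebesgue_measure A.
Proof.
move=> mA; apply/esym.
have mh : measurable_fun setT (fun x : R => s + x : measurableTypeR R).
  exact: measurable_funD.
apply: lebesgue_measure_unique => //= _ [[x y]] _ <-.
rewrite /pushforward (_ : _ @^-1` _ = `]x - s, y - s]%classic); last first.
  by apply/seteqP; split => z /=; rewrite !in_itv/= ltrBlDl lerBrDl.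
rewrite !lebesgue_measure_itv/= !lte_fin ltrD2r; case: ifP => // _.
by rewrite -!EFinB; congr (_%:E); ring.
Qed.

Lemma lebesgue_integral_shift (R : realType) (f : R -> \bar R) (D : set R) (s : R) :
  measurable D -> measurable_fun setT f -> (forall x, 0 <= f x)%E ->
  (\int[lebesgue_measure]_(x in D) f x =
   \int[lebesgue_measure]_(x in [set x | D (s + x)%R]) f (s + x)%R)%E.
Proof.
move=> mD mf f0.
pose h : R -> measurableTypeR R := fun x => s + x.
have mh : measurable_fun setT h by exact: measurable_funD.
transitivity (\int[pushforward lebesgue_measure h]_(x in D) f x)%E.
  by apply: eq_measure_integral => A mA _; exact/esym/lebesgue_measure_shift.
by rewrite ge0_integral_pushforward//; exact: measurable_funTS.
Qed.

Lemma shift_path_cont (R : realType) (f : R -> R) (s : R) :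
  {within `[0, +oo[, continuous f} -> 0 <= s ->
  {within `[0, +oo[, continuous (fun r : R => f (s + r) - f s)}.
Proof.
move=> /continuous_clamp cf s0.
apply: (@subspace_eq_continuous _ _ _ (fun r : R => f (Num.max (s + r) 0) - f s)).
  by move=> r; rewrite inE/= in_itv/= andbT => r0; rewrite max_l// addr_ge0.
apply: continuous_subspaceT => r; apply: cvgB; last exact: cvg_cst.
apply: (@continuous_comp _ _ _ (fun r : R => s + r) (fun x => f (Num.max x 0))).
  by apply: cvgD; [exact: cvg_cst|exact: cvg_id].
exact: cf.
Qed.

Section PathClock.
Context {R : realType}.
Implicit Types (mu b s t u : R) (f : R -> R).

(* [clock] along a single path: [clock mu b B t w] is convertible to
   [path_clock mu b (B^~ w) t]. *)
Definition path_clock mu b f t : R :=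
  \int[lebesgue_measure]_(s in `[0, t]) (b * expR (f s - mu * s)) ^+ 2.

(** The integrand of [path_clock], made continuous on the whole line. *)
Let clamped mu b f s : R := (b * expR (f (Num.max s 0) - mu * s)) ^+ 2.

Lemma continuous_clamped mu b f : {within `[0, +oo[, continuous f} ->
  continuous (clamped mu b f).
Proof.
move=> /continuous_clamp cf x; apply: cvgM; apply: cvgM => //; try exact: cvg_cst.
- apply: continuous_comp; last exact: continuous_expR.
  by apply: cvgB; [exact: cf|apply: cvgM; [exact: cvg_cst|exact: cvg_id]].
- apply: continuous_comp; last exact: continuous_expR.
  by apply: cvgB; [exact: cf|apply: cvgM; [exact: cvg_cst|exact: cvg_id]].
Qed.

Lemma path_clockE mu b f t :
  path_clock mu b f t = \int[lebesgue_measure]_(s in `[0, t]) clamped mu b f s.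
Proof.
apply: eq_Rintegral => s; rewrite inE/= in_itv/= => /andP[s0 _].
by rewrite /clamped max_l.
Qed.

Lemma clamped_ge0 mu b f s : 0 <= clamped mu b f s.
Proof. exact: sqr_ge0. Qed.

Lemma measurable_clamped mu b f : {within `[0, +oo[, continuous f} ->
  measurable_fun setT (clamped mu b f).
Proof. by move=> /continuous_clamped cf; exact: continuous_measurable_fun. Qed.

Lemma integrable_clamped mu b f x y : {within `[0, +oo[, continuous f} ->
  lebesgue_measure.-integrable `[x, y] (EFin \o clamped mu b f).
Proof.
move=> cf; apply: continuous_compact_integrable; first exact: segment_compact.
by apply: continuous_subspaceT; exact: continuous_clamped.
Qed.

Lemma path_clockZ mu b f t : {within `[0, +oo[, continuous f} ->
  path_clock mu b f t = b ^+ 2 * path_clock mu 1 f t.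
Proof.
move=> cf; rewrite !path_clockE -RintegralZl//; last exact: integrable_clamped.
by apply: eq_Rintegral => s _; rewrite /clamped mul1r exprMn.
Qed.

Lemma path_clock_ge0 mu b f t : 0 <= path_clock mu b f t.
Proof. by apply: Rintegral_ge0 => s _; exact: sqr_ge0. Qed.

Lemma path_clock0 mu b f : path_clock mu b f 0 = 0.
Proof. by rewrite /path_clock set_itv1 Rintegral_set1. Qed.

Lemma path_clock_fineE mu b f t : {within `[0, +oo[, continuous f} ->
  (path_clock mu b f t)%:E =
  (\int[lebesgue_measure]_(s in `[0%R, t]) (clamped mu b f s)%:E)%E.
Proof.
move=> cf; rewrite path_clockE /Rintegral fineK//.
by apply: integrable_fin_num => //; exact: integrable_clamped.
Qed.

(** The clock is an additive functional: after [s] it is the clock of the increment path, started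
    from the height reached at [s]. This is why the motion after [s] needs only the current position
    from the past. *)
Lemma path_clockD mu b f s u : {within `[0, +oo[, continuous f} ->
  0 <= s -> 0 <= u ->
  path_clock mu b f (s + u) = path_clock mu b f s +
    path_clock mu (b * expR (f s - mu * s)) (fun r => f (s + r) - f s) u.
Proof.
move=> cf s0 u0.
have cf' := shift_path_cont cf s0.
have mcl : measurable_fun setT (fun x => (clamped mu b f x)%:E).
  by apply/measurable_EFinP; exact: measurable_clamped.
have isu := @integrable_clamped mu b f s (s + u) cf.
have i0 := @integrable_clamped mu b f 0 (s + u) cf.
suff H : path_clock mu b f (s + u) - path_clock mu b f s =
    path_clock mu (b * expR (f s - mu * s)) (fun r => f (s + r) - f s) u.
  by rewrite -H; move: (path_clock mu b f (s + u)) => z; rewrite subrKC.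
rewrite [X in X - _]path_clockE [X in _ - X]path_clockE.
rewrite Rintegral_itvB; first last.
- by rewrite bnd_simp lerDl.
- by rewrite bnd_simp.
- exact: i0.
rewrite Rintegral_itv_obnd_cbnd; last first.
  by apply: integrableS isu => //; apply: subset_itv; rewrite bnd_simp.
apply: EFin_inj; rewrite [RHS](path_clock_fineE _ _ _ cf') /Rintegral fineK; last first.
  by apply: integrable_fin_num isu.
transitivity (\int[lebesgue_measure]_(x in `[(s + 0)%R, (s + u)%R])
    (clamped mu b f x)%:E)%E; first by rewrite addr0.
rewrite (lebesgue_integral_shift s _ mcl); last 2 first.
- exact: measurable_itv.
- by move=> x; rewrite lee_fin clamped_ge0.
rewrite (_ : [set x | _] = `[0, u]%classic); last first.
  by apply/seteqP; split => x /=; rewrite !in_itv/= !lerD2l.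
apply: eq_integral => x; rewrite inE/= in_itv/= => /andP[x0 _].
rewrite /clamped !max_l// ?addr_ge0//; congr (_ ^+ 2)%:E.
by rewrite -mulrA -expRD; congr (_ * expR _); ring.
Qed.

Lemma path_clock_gt0 mu b f t : {within `[0, +oo[, continuous f} ->
  b != 0 -> 0 < t -> 0 < path_clock mu b f t.
Proof.
move=> cf b0 t0.
have [|c _ cmin] := @EVT_min _ (clamped mu b f) 0 t (ltW t0).
  by apply: continuous_subspaceT; exact: continuous_clamped.
have c0 : 0 < clamped mu b f c.
  by rewrite lt_neqAle sqr_ge0 andbT eq_sym sqrf_eq0 mulf_neq0// gt_eqF// expR_gt0.
apply: (@lt_le_trans _ _ (clamped mu b f c * t)); first exact: mulr_gt0.
rewrite -lee_fin path_clock_fineE//.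
rewrite (_ : (_ * t)%:E = \int[lebesgue_measure]_(s in `[0%R, t]) (clamped mu b f c)%:E)%E.
  apply: ge0_le_integral; first by [].
  - by move=> x _; rewrite lee_fin sqr_ge0.
  - exact: measurable_cst.
  - by apply/measurable_EFinP/measurable_funTS; exact: measurable_clamped.
  - by move=> x; rewrite lee_fin; exact: cmin.
by rewrite integral_cst//= lebesgue_measure_itv/= lte_fin t0 sube0 EFinM.
Qed.

End PathClock.

(** Tonelli, with the time clamped to [0, t]. Only W_r for r in [0, t] has to be measurable, so the
    result applies to the σ-algebra of the past of [t]. *)
Lemma measurable_path_clock (R : realType) (d : measure_display)
    (T : measurableType d) (W : R -> T -> R) (mu b t : R) :
  (forall r, 0 <= r <= t -> measurable_fun setT (W r)) ->
  (forall w, {within `[0, +oo[, continuous (fun r : R => W r w)}) ->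
  0 <= t -> measurable_fun setT (fun w => path_clock mu b (W^~ w) t).
Proof.
move=> mW cW t0.
pose V r w := W (Num.max (Num.min r t) 0) w.
have mV r : measurable_fun setT (V r).
  by apply: mW; rewrite le_max lexx orbT ge_max ge_min lexx orbT t0.
have cV w : continuous (fun r => V r w).
  move=> r; apply: (@continuous_comp _ _ _ (fun r : R => Num.min r t)
    (fun x => W (Num.max x 0) w)); last exact: (continuous_clamp (@cW w)).
  exact: (@continuous_min R R id (fun=> t) r cvg_id (cvg_cst _)).
have mVV := measurable_caratheodory mV cV.
pose h (z : R * T) : \bar R :=
  (((b * expR (V z.1 z.2 - mu * z.1)) ^+ 2) * \1_(`[0, t]%classic : set R) z.1)%:E.
have mh : measurable_fun setT h.
  apply/measurable_EFinP/measurable_funM.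
    apply: measurable_funX; apply: measurable_funM => //.
    apply: measurableT_comp => //; apply: measurable_funB => //.
    by apply: measurable_funM => //; exact: measurable_fst.
  by apply: measurableT_comp; [exact: measurable_indic|exact: measurable_fst].
have h0 z : (0 <= h z)%E by rewrite lee_fin mulr_ge0// sqr_ge0.
rewrite (_ : (fun w => _) = fine \o (fubini_G lebesgue_measure h)); last first.
  apply/funext => w; rewrite /path_clock /Rintegral /=; congr fine.
  rewrite integral_mkcond; apply: eq_integral => s _; rewrite patchE /h /=.
  case: ifPn => st; last by rewrite indicE (negbTE st) mulr0.
  rewrite indicE st mulr1; move: st; rewrite inE/= in_itv/= => /andP[s0 st].
  by rewrite /V min_l// max_l.
apply: measurableT_comp => //; exact: measurable_fun_fubini_tonelli_G.
Qed.

(** * Wiener measure and the simple Markov property *)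

Section WienerLaw.
Context {R : realType} {d : measure_display} {T : measurableType d}.
Variables (P : probability T R) (a : R) (W : R -> T -> R).
Hypothesis bm : brownian_motion P a W.

Definition incr_path_cont (s : R) (s0 : 0 <= s) (w : T) :
    {within `[0, +oo[, continuous (fun r : R => W (s + r) w - W s w)} :=
  shift_path_cont (@bm_continuous _ _ _ _ _ _ bm w) s0.

Definition incr_path (s : R) (s0 : 0 <= s) : T -> pathT R :=
  path_of (incr_path_cont s0).

Lemma measurable_incr_path s (s0 : 0 <= s) : measurable_fun setT (incr_path s0).
Proof.
apply: (@measurable_path_of _ _ _ (incr_path_cont s0) _ T id) => t t0.
by apply: measurable_funB; apply: (bm_measurable bm) => //; rewrite addr_ge0.
Qed.

HB.instance Definition _ s (s0 : 0 <= s) :=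
  isMeasurableFun.Build _ _ _ _ (incr_path s0) (measurable_incr_path s0).

(** Wiener measure, obtained as the law of a Brownian motion that is already given; subtracting the
    value at time 0 makes it independent of the starting point. *)
Definition wiener : probability (pathT R) R :=
  distribution P (incr_path (lexx 0)).

End WienerLaw.

(** Uniqueness of Wiener measure and stationarity of increments in one: the two motions may live on
    different spaces and [s] is arbitrary. *)
Lemma incr_path_law (R : realType) (d d' : measure_display)
    (T : measurableType d) (T' : measurableType d')
    (P : probability T R) (P' : probability T' R) (a a' : R)
    (W : R -> T -> R) (W' : R -> T' -> R)
    (bm : brownian_motion P a W) (bm' : brownian_motion P' a' W')
    (s : R) (s0 : 0 <= s) (S : set (pathT R)) : measurable S ->
  P (incr_path bm s0 @^-1` S) = wiener bm' S.
Proof.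
move=> mS.
pose m1 : probability (pathT R) R := distribution P (incr_path bm s0).
suff : m1 S = wiener bm' S by [].
apply: (@finite_measure_ext R _ (pathT R) (fin_cylinder (@path_eval R) [set t | 0 <= t])).
- by apply: fin_cylinder_measurable => t t0; exact: measurable_process_gen.
- exact: fin_cylinderI.
- exact: fin_cylinderT.
- by rewrite ltey_eq fin_num_measure.
- move=> _ [l [A [l0 mA ->]]].
  exact: (bm_law bm bm' s0 (lexx 0) l0 mA).
- exact: sub_process_gen_fin_cylinder.
Qed.

(** The Markov property at [s]: the past is kept, and the path of increments after [s] is replaced
    by an independent Wiener path. *)
Lemma markov_freeze (R : realType) (d d' : measure_display)
    (T : measurableType d) (T' : measurableType d')
    (P : probability T R) (P' : probability T' R) (a a' : R)
    (W : R -> T -> R) (W' : R -> T' -> R)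
    (bm : brownian_motion P a W) (bm' : brownian_motion P' a' W')
    (s : R) (s0 : 0 <= s)
    (phi : g_sigma_algebraType (process_gen W `[0, s]) * pathT R -> \bar R) :
  measurable_fun setT phi -> (forall z, 0 <= phi z)%E ->
  (\int[P]_w phi (w, incr_path bm s0 w) =
   \int[P]_w \int[wiener bm']_v phi (w, v))%E.
Proof.
move=> mphi phi0.
pose U := g_sigma_algebraType (process_gen W `[0, s]).
have sub : <<s process_gen W `[0, s] >> `<=` @measurable _ T.
  apply: smallest_sub; first exact: sigma_algebra_measurable.
  move=> _ [t [A [+ mA ->]]]; rewrite /= in_itv/= => /andP[t0 _].
  by rewrite -[X in measurable X]setTI; apply: (bm_measurable bm).
apply: (@integral_freeze _ _ _ _ T U (pathT R) P (wiener bm') id (incr_path bm s0) phi) => //.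
- by move=> _ A mA; rewrite setTI; exact: sub.
- move=> E S mE mS; rewrite -(incr_path_law bm bm' s0 mS).
  apply: (bm_independent_increments bm s0) => //.
  pose W1 r w := W (s + r) w - W s w.
  pose G := process_gen W1 [set t | 0 <= t].
  have : measurable_fun setT (path_of (incr_path_cont bm s0) \o
      (id : g_sigma_algebraType G -> T)).
    apply: measurable_path_of => t t0.
    exact: (@measurable_process_gen _ _ W1 [set t | 0 <= t] t t0).
  by move=> /(_ measurableT S mS); rewrite setTI.
Qed.

Section PathMeasurability.
Context {R : realType}.
Implicit Types (mu t : R).

Lemma measurable_path_eval t : 0 <= t ->
  measurable_fun setT (fun v : pathT R => (v : cpath R) t).
Proof. by move=> t0; exact: (@measurable_process_gen R (cpath R) (@path_eval R) [set t | 0 <= t] t t0). Qed.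

Lemma measurable_path_eval2 :
  measurable_fun setT
    (fun z : R * pathT R => (z.2 : cpath R) (Num.max z.1 0)).
Proof.
apply: (@measurable_caratheodory R _ (pathT R)
  (fun t v => (v : cpath R) (Num.max t 0))).
  by move=> t; apply: measurable_path_eval; rewrite le_max lexx orbT.
by move=> v; apply: continuous_clamp; exact: path_cont.
Qed.

Lemma measurable_clock_pathT mu t : 0 <= t ->
  measurable_fun setT (fun v : pathT R => path_clock mu 1 (v : cpath R) t).
Proof.
move=> t0; apply: (@measurable_path_clock R _ (pathT R) (fun t v => (v : cpath R) t)) => //.
  by move=> r /andP[r0 _]; exact: measurable_path_eval.
by move=> v; exact: path_cont.
Qed.

End PathMeasurability.

Section BoxKernel.
Context {R : realType}.
Variable Q : probability (pathT R) R.

(* Nothing is known about the paths at negative times, hence the truncation. *)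
Definition itv_kernel (lo hi m a : R) : R :=
  fine (Q [set v : pathT R | lo <= m + (v : cpath R) (Num.max a 0) <= hi]).

Lemma measurable_itv_set (lo hi m a : R) :
  measurable [set v : pathT R | lo <= m + (v : cpath R) (Num.max a 0) <= hi].
Proof.
have mf : measurable_fun setT (fun v : pathT R => m + (v : cpath R) (Num.max a 0)).
  apply: measurable_funD => //; apply: measurable_path_eval.
  by rewrite le_max lexx orbT.
have := mf measurableT `[lo, hi]%classic (measurable_itv _).
by rewrite setTI; congr measurable; apply/seteqP; split => v; rewrite /= in_itv.
Qed.

Lemma itv_kernel_ge0 lo hi m a : 0 <= itv_kernel lo hi m a.
Proof. exact: fine_ge0. Qed.

Lemma itv_kernel_le1 lo hi m a : itv_kernel lo hi m a <= 1.
Proof.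
rewrite -lee_fin fineK; last by rewrite fin_num_measure//; exact: measurable_itv_set.
by apply: probability_le1; exact: measurable_itv_set.
Qed.

Lemma measurable_itv_kernel lo hi (d : measure_display) (U : measurableType d)
    (m a : U -> R) : measurable_fun setT m -> measurable_fun setT a ->
  measurable_fun setT (fun x => itv_kernel lo hi (m x) (a x)).
Proof.
move=> mm ma; apply: measurableT_comp => //.
pose B : set (U * pathT R) :=
  [set z | lo <= m z.1 + (z.2 : cpath R) (Num.max (a z.1) 0) <= hi].
have mB : measurable B.
  have mf : measurable_fun setT
      (fun z : U * pathT R => m z.1 + (z.2 : cpath R) (Num.max (a z.1) 0)).
    apply: measurable_funD; first by apply: measurableT_comp => //; exact: measurable_fst.
    have mp : measurable_fun setT (fun z : U * pathT R => (a z.1, z.2)).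
      apply: measurable_fun_pair => //.
      by apply: measurableT_comp => //; exact: measurable_fst.
    exact: (measurableT_comp (@measurable_path_eval2 R) mp).
  have := mf measurableT `[lo, hi]%classic (measurable_itv _).
  by rewrite setTI; congr measurable; apply/seteqP; split => v; rewrite /= in_itv.
have := measurable_fun_xsection Q mB.
by congr (measurable_fun _ _); apply/funext => x; congr (Q _);
  apply/seteqP; split => v; rewrite /xsection/= ?inE.
Qed.

Variables (mu : R) (n : nat) (lo hi : 'rV[R]_n.+1).

(* Given the vertical motion, the horizontal coordinates are independent
   Gaussians of variance [path_clock]. *)
Definition box_density (t : R) (x : 'rV[R]_n.+1) (v : pathT R) : R :=
  (\prod_(i < n) itv_kernel (lo ord0 (lift ord_max i)) (hi ord0 (lift ord_max i))
     (x ord0 (lift ord_max i)) (path_clock mu (x ord0 ord_max) (v : cpath R) t)) *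
  \1_`[lo ord0 ord_max, hi ord0 ord_max]
     (x ord0 ord_max * expR ((v : cpath R) t - mu * t)).

(** The probability that the motion started at [x] lies in the box at time [t], as
    [process_box_prob] confirms. No process occurs in it, so it is common to all starting points. *)
Definition box_prob (t : R) (x : 'rV[R]_n.+1) : \bar R :=
  (\int[Q]_v (box_density t x v)%:E)%E.

Lemma box_density_ge0 t x v : 0 <= box_density t x v.
Proof. by rewrite mulr_ge0// prodr_ge0// => i _; exact: itv_kernel_ge0. Qed.

Lemma box_density_le1 t x v : box_density t x v <= 1.
Proof.
rewrite mulr_ile1//; first by rewrite prodr_ge0// => i _; exact: itv_kernel_ge0.
by rewrite prodr_ile1// => i _; rewrite itv_kernel_ge0 itv_kernel_le1.
Qed.

Lemma measurable_box_density (d : measure_display) (U : measurableType d) t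
    (x : U -> 'rV[R]_n.+1) (v : U -> pathT R) : 0 <= t ->
  (forall i, measurable_fun setT (fun z => x z ord0 i)) -> measurable_fun setT v ->
  measurable_fun setT (fun z => box_density t (x z) (v z)).
Proof.
move=> t0 mx mv; apply: measurable_funM.
  apply: measurable_prod => i _; apply: measurable_itv_kernel => //.
  rewrite (_ : (fun z => _) = (fun z => x z ord0 ord_max ^+ 2 *
      path_clock mu 1 ((v z : pathT R) : cpath R) t)); last first.
    by apply/funext => z; rewrite path_clockZ//; exact: path_cont.
  apply: measurable_funM; first exact: measurable_funX.
  exact: (measurableT_comp (measurable_clock_pathT mu t0)).
apply: (measurableT_comp (measurable_indic (measurable_itv _))).
apply: measurable_funM => //; apply: measurableT_comp => //.
apply: measurable_funB => //.
exact: (measurableT_comp (measurable_path_eval t0)).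
Qed.

Lemma measurable_box_prob (d : measure_display) (U : measurableType d) t
    (x : U -> 'rV[R]_n.+1) : 0 <= t ->
  (forall i, measurable_fun setT (fun z => x z ord0 i)) ->
  measurable_fun setT (fun z => box_prob t (x z)).
Proof.
move=> t0 mx.
apply: (@measurable_fun_fubini_tonelli_F _ _ U (pathT R) R Q
  (fun z : U * pathT R => (box_density t (x z.1) z.2)%:E)).
  apply/measurable_EFinP.
  apply: (@measurable_box_density _ _ t (fun z : U * pathT R => x z.1) snd) => //.
  by move=> i; apply: (measurableT_comp (mx i)); exact: measurable_fst.
by move=> z; rewrite lee_fin box_density_ge0.
Qed.

Lemma box_prob_ge0 t x : (0 <= box_prob t x)%E.
Proof. by apply: integral_ge0 => v _; rewrite lee_fin box_density_ge0. Qed.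

Lemma box_prob_le1 t x : (box_prob t x <= 1)%E.
Proof.
apply: (@le_trans _ _ (\int[Q]_v 1)%E).
  apply: ge0_le_integral_nonmeas => v _; rewrite lee_fin ?box_density_ge0//.
  exact: box_density_le1.
by rewrite (integral_cst Q measurableT) mul1e; exact: probability_le1.
Qed.

Lemma box_prob_fin_num t x : box_prob t x \is a fin_num.
Proof.
rewrite ge0_fin_numE ?box_prob_ge0//.
by rewrite (le_lt_trans (box_prob_le1 t x))// ltry.
Qed.

End BoxKernel.

(** * The Markov property of hyperbolic Brownian motion *)

Lemma prod_option (R : realType) (n : nat) (F : option 'I_n -> \bar R) :
  (\prod_(o : option 'I_n) F o = F None * \prod_(i < n) F (Some i))%E.
Proof.
rewrite (bigD1 None)//=; congr (_ * _)%E.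
rewrite (reindex_omap Some id)/=; last by case.
by apply: eq_bigl => i; rewrite eqxx.
Qed.

Lemma sigma_algebraI (T : pointedType) (G : set (set T)) : setI_closed <<s G >>.
Proof.
by move=> A B mA mB; exact: (@measurableI _ (g_sigma_algebraType G)).
Qed.

Lemma sub_process_sigma (R : realType) (d : measure_display)
    (T : measurableType d) (W : R -> T -> R) (I : set R) :
  (forall t, I t -> 0 <= t) ->
  (<<s process_gen W I >> `<=` process_sigma W).
Proof.
move=> I0; apply: smallest_sub; first exact: smallest_sigma_algebra.
by move=> _ [t [A [It mA ->]]]; apply: sub_sigma_algebra; exists t, A; split => //; exact: I0.
Qed.

Lemma process_sigma_measurable (R : realType) (d : measure_display)
    (T : measurableType d) (W : R -> T -> R) :
  (forall t, 0 <= t -> measurable_fun setT (W t)) ->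
  process_sigma W `<=` measurable.
Proof.
move=> mW; apply: smallest_sub; first exact: sigma_algebra_measurable.
by move=> _ [t [A [t0 mA ->]]]; rewrite -[X in measurable X]setTI; exact: mW.
Qed.

(** For σ-algebras [G i] and finite [I], a π-system generating their join, on which
    [mutually_independent] yields a product formula. *)
Definition meet_gen (T I : Type) (G : I -> set (set T)) : set (set T) :=
  [set E | exists2 F : I -> set T, (forall i, G i (F i)) & E = \bigcap_i F i].

Lemma meet_genT (T I : Type) (G : I -> set (set T)) :
  (forall i, G i setT) -> meet_gen G setT.
Proof. by move=> GT; exists (fun=> setT) => //; rewrite bigcapT. Qed.

Lemma meet_genI (T I : Type) (G : I -> set (set T)) :
  (forall i, setI_closed (G i)) -> setI_closed (meet_gen G).
Proof.
move=> GI _ _ [F GF ->] [F' GF' ->]; exists (fun i => F i `&` F' i).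
  by move=> i; exact: GI.
by rewrite bigcapI.
Qed.

Lemma meet_gen_measurable (d : measure_display) (T : measurableType d)
    (I : finType) (G : I -> set (set T)) :
  (forall i, G i `<=` measurable) -> meet_gen G `<=` measurable.
Proof.
move=> mG _ [F GF ->]; apply: fin_bigcap_measurable; first exact: finite_finset.
by move=> i _; exact: mG.
Qed.

Lemma sub_meet_gen (T : Type) (I : eqType) (G : I -> set (set T)) i E :
  (forall i, G i setT) -> G i E -> meet_gen G E.
Proof.
move=> GT GE; exists (fun j => if j == i then E else setT).
  by move=> j; case: eqP => [->|_].
apply/seteqP; split => [w Ew j _|w /(_ i)]; first by case: ifP.
by rewrite eqxx; exact.
Qed.

Lemma itv_kernel_incr (R : realType) (d d0 : measure_display)
    (T : measurableType d) (T0 : measurableType d0)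
    (P : probability T R) (P0 : probability T0 R) (a a0 : R)
    (W : R -> T -> R) (W0 : R -> T0 -> R)
    (bm : brownian_motion P a W) (bm0 : brownian_motion P0 a0 W0)
    (lo hi m s t : R) : 0 <= s -> s <= t ->
  P [set w | lo <= m + (W t w - W s w) <= hi] =
  (itv_kernel (wiener bm0) lo hi m (t - s))%:E.
Proof.
move=> s0 st.
have mS := measurable_itv_set lo hi m (t - s).
rewrite fineK; last exact: fin_num_measure.
rewrite -(incr_path_law bm bm0 s0 mS); congr (P _).
apply/seteqP; split => w; rewrite /preimage/=.
  by rewrite max_l ?subr_ge0// subrKC.
by rewrite max_l ?subr_ge0// subrKC.
Qed.

Section DrivingMotions.
Context {R : realType} {d d0 : measure_display}.
Context {T : measurableType d} {T0 : measurableType d0}.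
Variables (P : probability T R) (P0 : probability T0 R).
Variables (n : nat) (a : 'I_n -> R) (B : R -> T -> R) (beta : 'I_n -> R -> T -> R).
Variables (a0 : R) (W0 : R -> T0 -> R).
Hypothesis drv : driving_brownian_motions P a B beta.
Hypothesis bm0 : brownian_motion P0 a0 W0.

Let Q := wiener bm0.

Let bmB : brownian_motion P 0 B. Proof. by case: drv. Qed.
Let bmb i : brownian_motion P (a i) (beta i). Proof. by case: drv. Qed.

Lemma driving_prod (E : set T) (F : 'I_n -> set T) : process_sigma B E ->
  (forall i, process_sigma (beta i) (F i)) ->
  P (E `&` \bigcap_i F i) = (P E * \prod_(i < n) P (F i))%E.
Proof.
move=> sE sF; case: drv => _ _ /(_ (fun o => if o is Some i then F i else E)).
rewrite prod_option => <-; last by case.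
congr (P _); apply/seteqP; split => [w [Ew Fw] [i|] _//|w h].
  exact: Fw.
by split; [exact: (h None)|move=> i _; exact: (h (Some i))].
Qed.

Lemma beta_prod (F : 'I_n -> set T) : (forall i, process_sigma (beta i) (F i)) ->
  P (\bigcap_i F i) = (\prod_(i < n) P (F i))%E.
Proof.
move=> sF; rewrite -[in LHS](setTI (\bigcap_i F i)) driving_prod//.
  by rewrite probability_setT mul1e.
exact: (@measurableT _ (g_sigma_algebraType _)).
Qed.

Let mbeta i t : 0 <= t -> measurable_fun setT (beta i t).
Proof. exact: (bm_measurable (bmb i)). Qed.

Definition horizontal_gen (I : set R) :=
  meet_gen (fun i => <<s process_gen (beta i) I >>).

Lemma horizontal_gen_measurable (I : set R) : (forall t, I t -> 0 <= t) ->
  horizontal_gen I `<=` measurable.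
Proof.
move=> I0; apply: meet_gen_measurable => i E /(sub_process_sigma I0).
by apply: process_sigma_measurable => t; exact: mbeta.
Qed.

Lemma measurable_horizontal (I : set R) i t : I t ->
  measurable_fun (setT : set (g_sigma_algebraType (horizontal_gen I))) (beta i t).
Proof.
move=> It _ A mA; rewrite setTI; apply: sub_sigma_algebra.
apply: (@sub_meet_gen _ _ _ i).
  by move=> j; exact: (@measurableT _ (g_sigma_algebraType _)).
by apply: sub_sigma_algebra; exists t, A.
Qed.

Section HorizontalMarkov.
Variables s t : R.
Hypotheses (s0 : 0 <= s) (st : s <= t).

Let delta i (w : T) := beta i t w - beta i s w.

Let delta_gen : set (set T) :=
  meet_gen (fun i => [set E | exists2 A : set R, measurable A & E = delta i @^-1` A]).

Let mdelta i : measurable_fun setT (delta i).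
Proof. by apply: measurable_funB; apply: mbeta => //; exact: le_trans st. Qed.

(** For each component the past is independent of the increment; mutual independence of the
    components multiplies these statements. *)
Lemma horizontal_independent :
  independent P <<s horizontal_gen `[0, s] >> <<s delta_gen >>.
Proof.
apply: independent_sigma.
- by apply: horizontal_gen_measurable => r; rewrite /= in_itv/= => /andP[].
- apply: meet_gen_measurable => i _ [A mA ->].
  by rewrite -[X in measurable X]setTI; exact: mdelta.
- by apply: meet_genI => i; exact: sigma_algebraI.
- apply: meet_genI => i _ _ [A mA ->] [A' mA' ->]; exists (A `&` A') => //.
  exact: measurableI.
- by apply: meet_genT => i; exact: (@measurableT _ (g_sigma_algebraType _)).
- by apply: meet_genT => i; exists setT.
move=> _ _ [E sE ->] [F sF ->].
have I0 r : `[0, s]%classic r -> 0 <= r by rewrite /= in_itv/= => /andP[].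
have sE' i : process_sigma (beta i) (E i) by apply: sub_process_sigma (sE i).
have sF' i : process_sigma (beta i) (F i).
  have [A mA ->] := sF i.
  rewrite -[X in process_sigma _ X]setTI.
  have mb r : 0 <= r -> measurable_fun
    (setT : set (g_sigma_algebraType (process_gen (beta i) [set t | 0 <= t]))) (beta i r).
    by move=> r0; exact: measurable_process_gen.
  have mD := measurable_funB (mb _ (le_trans s0 st)) (mb _ s0).
  exact: (mD measurableT A mA).
rewrite -bigcapI !beta_prod//; last first.
  by move=> i; apply: (@sigma_algebraI T); [exact: sE'|exact: sF'].
rewrite -big_split/=; apply: eq_bigr => i _.
apply: (bm_independent_increments (bmb i) s0); first exact: sE.
have [A mA ->] := sF i; apply: sub_sigma_algebra.
exists (t - s), A; split => //=; first by rewrite subr_ge0.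
by rewrite /delta subrKC.
Qed.

(** Here [s] and [t] are horizontal times: the lemma is applied with a frozen vertical path, at two
    values of its clock. *)
Lemma horizontal_markov (lo hi : 'I_n -> R) (E : set T) :
  <<s horizontal_gen `[0, s] >> E ->
  (\int[P]_w (\1_E w * \prod_(i < n) \1_`[lo i, hi i] (beta i t w))%:E =
   \int[P]_w (\1_E w *
      \prod_(i < n) itv_kernel Q (lo i) (hi i) (beta i s w) (t - s))%:E)%E.
Proof.
move=> sE.
pose U := g_sigma_algebraType (horizontal_gen `[0, s]).
pose V := g_sigma_algebraType delta_gen.
have subU : <<s horizontal_gen `[0, s] >> `<=` @measurable _ T.
  apply: smallest_sub; first exact: sigma_algebra_measurable.
  by apply: horizontal_gen_measurable => r; rewrite /= in_itv/= => /andP[].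
have subV : <<s delta_gen >> `<=` @measurable _ T.
  apply: smallest_sub; first exact: sigma_algebra_measurable.
  apply: meet_gen_measurable => i _ [A mA ->].
  by rewrite -[X in measurable X]setTI; exact: mdelta.
have mU : measurable_fun setT (id : T -> U) by move=> _ A mA; rewrite setTI; exact: subU.
have mV : measurable_fun setT (id : T -> V) by move=> _ A mA; rewrite setTI; exact: subV.
pose fV : {mfun T >-> V} := HB.pack (id : T -> V) (isMeasurableFun.Build _ _ _ _ (id : T -> V) mV).
pose PV : probability V R := distribution P fV.
pose phi (z : U * V) : \bar R :=
  (\1_E z.1 * \prod_(i < n) \1_`[lo i, hi i] (beta i s z.1 + delta i z.2))%:E.
have mphi : measurable_fun setT phi.
  apply/measurable_EFinP/measurable_funM.
    apply: measurableT_comp; last exact: measurable_fst.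
    exact: (@measurable_indic _ U).
  apply: measurable_prod => i _.
  apply: (measurableT_comp (measurable_indic (measurable_itv _))).
  apply: measurable_funD.
    apply: (measurableT_comp (f := fun w : U => beta i s w)); last exact: measurable_fst.
    by apply: measurable_horizontal; rewrite /= in_itv/= lexx s0.
  apply: (measurableT_comp (f := fun w : V => delta i w)); last exact: measurable_snd.
  move=> _ A mA; rewrite setTI; apply: sub_sigma_algebra.
  by apply: (@sub_meet_gen _ _ _ i); [move=> j; exists setT|exists A].
have phi0 z : (0 <= phi z)%E.
  by rewrite lee_fin mulr_ge0// prodr_ge0// => i _; rewrite indicE.
transitivity (\int[P]_w phi (w, w))%E.
  apply: eq_integral => w _; rewrite /phi/=; congr (_ * _)%:E.
  by apply: eq_bigr => i _; rewrite /delta subrKC.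
rewrite (@integral_freeze _ _ _ _ T U V P PV id id phi)//; last first.
  by move=> E' F' mE' mF'; exact: horizontal_independent.
apply: eq_integral => w _; rewrite /phi/=.
under eq_integral do rewrite EFinM.
pose C i := [set x : R | lo i <= beta i s w + x <= hi i].
have mA i : measurable (C i).
  have mf : measurable_fun setT (fun x : R => beta i s w + x) by exact: measurable_funD.
  have := mf measurableT `[lo i, hi i]%classic (measurable_itv _).
  by rewrite setTI; congr measurable; apply/seteqP; split => v; rewrite /= in_itv.
(* With the positions at [s] frozen, the product of indicators is the indicator of [A], whose
   probability factorises over the components. *)
pose A := \bigcap_i (delta i @^-1` C i).
have mAV : measurable (A : set V).
  apply: sub_sigma_algebra; exists (fun i => delta i @^-1` C i) => //.
  by move=> i; exists (C i).
have AE (v : V) : \prod_(i < n) \1_`[lo i, hi i] (beta i s w + delta i v) = \1_A v :> R.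
  have [vA|vA] := pselect (A v).
    rewrite indicE mem_set// big1// => i _; rewrite indicE mem_set//= in_itv/=.
    exact: vA.
  rewrite indicE memNset//.
  have [i nvi] : exists i, ~ (lo i <= beta i s w + delta i v <= hi i).
    by apply/existsNP => h; apply: vA => i _; exact: h.
  by rewrite (bigD1 i)//= indicE memNset ?mul0r//= in_itv/=.
under eq_integral do rewrite AE.
rewrite ge0_integralZl_EFin//; last first.
  by apply/measurable_EFinP; exact: measurable_indic.
rewrite EFinM; congr (_ * _)%E.
rewrite integral_indic// setIT.
transitivity (P A) => //.
have -> : P A = (\prod_(i < n) P (delta i @^-1` C i))%E.
  apply: beta_prod => i.
  have mb r : 0 <= r -> measurable_fun
    (setT : set (g_sigma_algebraType (process_gen (beta i) [set t | 0 <= t]))) (beta i r).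
    by move=> r0; exact: measurable_process_gen.
  have mD := measurable_funB (mb _ (le_trans s0 st)) (mb _ s0).
  by rewrite -[X in process_sigma _ X]setTI; exact: (mD measurableT _ (mA i)).
rewrite -prodEFin; apply: eq_bigr => i _.
exact: (itv_kernel_incr (bmb i) bm0).
Qed.

End HorizontalMarkov.
End DrivingMotions.

(** Under independence the diagonal (w, w) may be replaced by two independent samples (w, w'), and
    either of them may be integrated first. This lets the vertical path be frozen in one step and
    the horizontal one in the next. *)
Lemma independent_fubini (R : realType) (d : measure_display)
    (T : measurableType d) (P : probability T R) (G1 G2 : set (set T))
    (phi : g_sigma_algebraType G1 * g_sigma_algebraType G2 -> \bar R) :
  G1 `<=` measurable -> G2 `<=` measurable ->
  independent P <<s G1 >> <<s G2 >> ->
  measurable_fun setT phi -> (forall z, 0 <= phi z)%E ->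
  (\int[P]_w phi (w, w) = \int[P]_w \int[P]_w' phi (w, w'))%E /\
  (\int[P]_w \int[P]_w' phi (w, w') = \int[P]_w' \int[P]_w phi (w, w'))%E.
Proof.
move=> mG1 mG2 ind mphi phi0.
pose U := g_sigma_algebraType G1.
pose V := g_sigma_algebraType G2.
have mU : measurable_fun setT (id : T -> U).
  by move=> _ A mA; rewrite setTI; exact: (smallest_sub (sigma_algebra_measurable _) mG1 mA).
have mV : measurable_fun setT (id : T -> V).
  by move=> _ A mA; rewrite setTI; exact: (smallest_sub (sigma_algebra_measurable _) mG2 mA).
pose fU : {mfun T >-> U} := HB.pack (id : T -> U) (isMeasurableFun.Build _ _ _ _ (id : T -> U) mU).
pose fV : {mfun T >-> V} := HB.pack (id : T -> V) (isMeasurableFun.Build _ _ _ _ (id : T -> V) mV).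
pose PU : probability U R := distribution P fU.
pose PV : probability V R := distribution P fV.
have iU (f : U -> \bar R) : measurable_fun setT f -> (forall x, 0 <= f x)%E ->
    (\int[PU]_x f x = \int[P]_x f x)%E.
  by move=> mf f0; rewrite /PU ge0_integral_distribution.
have iV (f : V -> \bar R) : measurable_fun setT f -> (forall x, 0 <= f x)%E ->
    (\int[PV]_x f x = \int[P]_x f x)%E.
  by move=> mf f0; rewrite /PV ge0_integral_distribution.
have m1 w : measurable_fun setT (fun w' : V => phi (w, w')).
  exact: measurableT_comp (measurable_pair1 w).
have m2 w' : measurable_fun setT (fun w : U => phi (w, w')).
  exact: measurableT_comp (measurable_pair2 w').
have E1 : (\int[P]_w \int[PV]_w' phi (w, w') = \int[P]_w \int[P]_w' phi (w, w'))%E.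
  by apply: eq_integral => w _; rewrite iV.
split.
  by rewrite -E1 (@integral_freeze _ _ _ _ T U V P PV id id phi).
have mF : measurable_fun setT (fun w : U => \int[PV]_w' phi (w, w'))%E.
  exact: (@measurable_fun_fubini_tonelli_F _ _ U V R PV phi).
have mG : measurable_fun setT (fun w' : V => \int[PU]_w phi (w, w'))%E.
  exact: (@measurable_fun_fubini_tonelli_G _ _ U V R PU phi).
rewrite -E1 -iU//; last by move=> w; exact: integral_ge0.
rewrite (@fubini_tonelli _ _ U V R PU PV phi)//.
rewrite iV//; last by move=> w; exact: integral_ge0.
by apply: eq_integral => w _; rewrite iU.
Qed.

(** * The Markov property of the representation (beta(A_t), Y_t) *)

Section Representation.
Context {R : realType} {d d0 : measure_display}.
Context {T : measurableType d} {T0 : measurableType d0}.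
Variables (P : probability T R) (P0 : probability T0 R).
Variables (n : nat) (a : 'I_n -> R) (B : R -> T -> R) (beta : 'I_n -> R -> T -> R).
Variables (a0 : R) (W0 : R -> T0 -> R).
Hypothesis drv : driving_brownian_motions P a B beta.
Hypothesis bm0 : brownian_motion P0 a0 W0.
Variables (mu b : R).

Let Q := wiener bm0.

Let bmB : brownian_motion P 0 B. Proof. by case: drv. Qed.
Let bmb i : brownian_motion P (a i) (beta i). Proof. by case: drv. Qed.

Let GB := process_gen B [set t | 0 <= t].
Let GH := horizontal_gen beta [set t | 0 <= t].

Lemma vertical_measurable : GB `<=` measurable.
Proof.
move=> _ [t [A [t0 mA ->]]]; rewrite -[X in measurable X]setTI.
exact: (bm_measurable bmB).
Qed.

Lemma horizontal_measurable : GH `<=` measurable.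
Proof. exact: (horizontal_gen_measurable drv). Qed.

Lemma vertical_horizontal_independent : independent P <<s GB >> <<s GH >>.
Proof.
apply: independent_sym; apply: independent_sigmal.
- exact: horizontal_measurable.
- exact: smallest_sub (sigma_algebra_measurable _) vertical_measurable.
- by apply: meet_genI => i; exact: sigma_algebraI.
- by apply: meet_genT => i; exact: (@measurableT _ (g_sigma_algebraType _)).
move=> _ E [F sF ->] sE.
rewrite setIC (driving_prod drv sE sF) muleC.
by congr (_ * _)%E; rewrite (beta_prod drv).
Qed.

Let A t w := path_clock mu b (B^~ w) t.
Let Y t w := b * expR (B t w - mu * t).

(* [hyp_representation] with independent samples of the vertical and of the
   horizontal motions. *)
Let decoupled t w w' : 'rV[R]_n.+1 :=
  \row_i (if unlift ord_max i is Some j then beta j (A t w) w' else Y t w).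

Let decoupled_diag t w : decoupled t w w = hyp_representation mu b B beta t w.
Proof. by []. Qed.

Let decoupled_lift t w w' i : decoupled t w w' ord0 (lift ord_max i) = beta i (A t w) w'.
Proof. by rewrite mxE liftK. Qed.

Let decoupled_max t w w' : decoupled t w w' ord0 ord_max = Y t w.
Proof. by rewrite mxE unlift_none. Qed.

Let cB w : {within `[0, +oo[, continuous (B^~ w)}.
Proof. exact: (@bm_continuous _ _ _ _ _ _ bmB w). Qed.

Let A_ge0 t w : 0 <= A t w. Proof. exact: path_clock_ge0. Qed.

Let A_incr s u w : 0 <= s -> 0 <= u ->
  A (s + u) w - A s w = path_clock mu (Y s w) (fun r => B (s + r) w - B s w) u.
Proof. by move=> s0 u0; rewrite /A path_clockD// addrC addKr. Qed.

Let A_le s t w : 0 <= s -> s <= t -> A s w <= A t w.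
Proof.
move=> s0 st; rewrite -subr_ge0 -(subrKC s t) A_incr ?subr_ge0//.
exact: path_clock_ge0.
Qed.

Let Y_incr s u w : Y (s + u) w = Y s w * expR ((B (s + u) w - B s w) - mu * u).
Proof. by rewrite /Y -mulrA -expRD; congr (_ * expR _); ring. Qed.

Let measurable_Y (G : set (set T)) t :
  measurable_fun (setT : set (g_sigma_algebraType G)) (B t) ->
  measurable_fun (setT : set (g_sigma_algebraType G)) (Y t).
Proof.
move=> mB; apply: measurable_funM => //; apply: measurableT_comp => //.
exact: measurable_funB.
Qed.

Let measurable_A (G : set (set T)) t : 0 <= t ->
  (forall r, 0 <= r <= t -> measurable_fun (setT : set (g_sigma_algebraType G)) (B r)) ->
  measurable_fun (setT : set (g_sigma_algebraType G)) (A t).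
Proof. by move=> t0 mB; apply: (@measurable_path_clock R _ (g_sigma_algebraType G) B). Qed.

Let mBB t : 0 <= t -> measurable_fun (setT : set (g_sigma_algebraType GB)) (B t).
Proof. by move=> t0; exact: measurable_process_gen. Qed.

Let measurable_beta_A i t : 0 <= t ->
  measurable_fun setT (fun z : g_sigma_algebraType GB * g_sigma_algebraType GH =>
    beta i (A t z.1) z.2).
Proof.
move=> t0.
have mV : measurable_fun setT (fun z : R * g_sigma_algebraType GH => beta i (Num.max z.1 0) z.2).
  apply: (@measurable_caratheodory R _ (g_sigma_algebraType GH)
     (fun t w => beta i (Num.max t 0) w)).
    by move=> r; apply: measurable_horizontal; rewrite /= le_max lexx orbT.
  by move=> w; exact: (continuous_clamp (@bm_continuous _ _ _ _ _ _ (bmb i) w)).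
have mp : measurable_fun setT (fun z : g_sigma_algebraType GB * g_sigma_algebraType GH =>
    (A t z.1, z.2)).
  apply: measurable_fun_pair => //.
  have mA : measurable_fun (setT : set (g_sigma_algebraType GB)) (A t).
    by apply: measurable_A => // r /andP[r0 _]; exact: mBB.
  exact: (measurableT_comp mA measurable_fst).
have := measurableT_comp mV mp.
by congr (measurable_fun _ _); apply/funext => z; rewrite /= max_l.
Qed.

Let measurable_decoupled t i : 0 <= t ->
  measurable_fun setT (fun z : g_sigma_algebraType GB * g_sigma_algebraType GH =>
    decoupled t z.1 z.2 ord0 i).
Proof.
move=> t0; case: (unliftP ord_max i) => [j ->|->].
  by under eq_fun do rewrite decoupled_lift; exact: measurable_beta_A.
under eq_fun do rewrite decoupled_max.
have mY : measurable_fun (setT : set (g_sigma_algebraType GB)) (Y t).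
  by apply: measurable_Y; exact: mBB.
exact: (measurableT_comp mY measurable_fst).
Qed.

Lemma measurable_hyp_representation t i : 0 <= t ->
  measurable_fun setT (fun w : T => hyp_representation mu b B beta t w ord0 i).
Proof.
move=> t0.
have mU : measurable_fun setT (id : T -> g_sigma_algebraType GB).
  move=> _ X mX; rewrite setTI.
  exact: (smallest_sub (sigma_algebra_measurable _) vertical_measurable mX).
have mV : measurable_fun setT (id : T -> g_sigma_algebraType GH).
  move=> _ X mX; rewrite setTI.
  exact: (smallest_sub (sigma_algebra_measurable _) horizontal_measurable mX).
exact: (measurableT_comp (measurable_decoupled i t0) (measurable_fun_pair mU mV)).
Qed.

Variables (k : nat) (t : 'I_k -> R) (C : 'I_k -> set R) (i0 : 'I_n).
Variables (s u : R).
Hypotheses (u0 : 0 <= u) (ts : forall j, 0 <= t j <= s).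
Hypotheses (mC : forall j, measurable (C j)) (s0 : 0 <= s).
Variables (lo hi : 'rV[R]_n.+1).

Let EE : set (T * T) :=
  [set z | forall j, C j (beta i0 (A (t j) z.1) z.2)].

Let mEE : measurable (EE : set (g_sigma_algebraType GB * g_sigma_algebraType GH)).
Proof.
rewrite (_ : EE = \bigcap_j [set z | C j (beta i0 (A (t j) z.1) z.2)]); last first.
  by apply/seteqP; split => [w h j _|w h j]; [exact: h|exact: h].
apply: fin_bigcap_measurable; first exact: finite_finset.
move=> j _; have /andP[tj0 _] := ts j.
have := measurable_beta_A i0 tj0 measurableT (mC j).
by rewrite setTI.
Qed.

(** Three stages of conditioning: [phi1] is the event itself, in [phi2] the horizontal increments
    after A_s are integrated out, in [phi3] also the vertical ones after [s]. *)
Let phi1 (z : T * T) : \bar R :=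
  ((\1_EE z * \prod_(i < n) \1_`[lo ord0 (lift ord_max i), hi ord0 (lift ord_max i)]
      (beta i (A (s + u) z.1) z.2)) *
   \1_`[lo ord0 ord_max, hi ord0 ord_max] (Y (s + u) z.1))%:E.

Let phi2 (z : T * T) : \bar R :=
  (\1_EE z * box_density Q mu lo hi u (decoupled s z.1 z.2) (incr_path bmB s0 z.1))%:E.

Let phi3 (z : T * T) : \bar R :=
  ((\1_EE z)%:E * box_prob Q mu lo hi u (decoupled s z.1 z.2))%E.

Let m1EE : measurable_fun setT
  (\1_EE : g_sigma_algebraType GB * g_sigma_algebraType GH -> R).
Proof. by have := measurable_indic mEE. Qed.

Let mphi1 : measurable_fun setT
  (phi1 : g_sigma_algebraType GB * g_sigma_algebraType GH -> \bar R).
Proof.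
apply/measurable_EFinP; apply: measurable_funM; first apply: measurable_funM => //.
  apply: measurable_prod => i _.
  apply: (measurableT_comp (measurable_indic (measurable_itv _))).
  by apply: measurable_beta_A; exact: addr_ge0.
apply: (measurableT_comp (measurable_indic (measurable_itv _))).
have mY : measurable_fun (setT : set (g_sigma_algebraType GB)) (Y (s + u)).
  by apply: measurable_Y; apply: mBB; exact: addr_ge0.
exact: (measurableT_comp mY measurable_fst).
Qed.

Let mphi2 : measurable_fun setT
  (phi2 : g_sigma_algebraType GB * g_sigma_algebraType GH -> \bar R).
Proof.
apply/measurable_EFinP; apply: measurable_funM => //.
apply: (@measurable_box_density _ _ _ _ _ _ _ _ u
  (fun z : g_sigma_algebraType GB * g_sigma_algebraType GH => decoupled s z.1 z.2)
  (fun z => incr_path bmB s0 z.1)) => //.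
  by move=> i; exact: measurable_decoupled.
have mI : measurable_fun (setT : set (g_sigma_algebraType GB)) (incr_path bmB s0).
  apply: (@measurable_path_of R T _ (incr_path_cont bmB s0) _ (g_sigma_algebraType GB) id) => r r0.
  by apply: measurable_funB; apply: mBB => //; exact: addr_ge0.
exact: (measurableT_comp mI measurable_fst).
Qed.

Let mphi3 : measurable_fun setT
  (phi3 : g_sigma_algebraType GB * g_sigma_algebraType GH -> \bar R).
Proof.
apply: emeasurable_funM; first exact/measurable_EFinP.
by apply: measurable_box_prob => // i; exact: measurable_decoupled.
Qed.

(** Once the vertical path is fixed all clock values are constants. The event [EE] then concerns the
    horizontal motion up to A_s only, and [horizontal_markov] applies between A_s and A_(s+u). *)
Let phi12 w : (\int[P]_w' phi1 (w, w') = \int[P]_w' phi2 (w, w'))%E.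
Proof.
pose E' := [set w' | EE (w, w')].
have EE' w' : \1_EE (w, w') = \1_E' w' :> R.
  by rewrite !indicE; congr (_%:R); apply/idP/idP; rewrite !inE.
have AA : A s w <= A (s + u) w by rewrite A_le// lerDl.
have sE' : <<s horizontal_gen beta `[0, A s w] >> E'.
  rewrite (_ : E' = \bigcap_j (beta i0 (A (t j) w) @^-1` C j)); last first.
    by apply/seteqP; split => [w' h j _|w' h j]; [exact: h|exact: h].
  apply: (@fin_bigcap_measurable _ (g_sigma_algebraType (horizontal_gen beta `[0, A s w]))).
    exact: finite_finset.
  move=> j _; have /andP[tj0 tjs] := ts j.
  rewrite -[X in measurable X]setTI.
  have mb : measurable_fun
      (setT : set (g_sigma_algebraType (horizontal_gen beta `[0, A s w])))
      (beta i0 (A (t j) w)).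
    by apply: measurable_horizontal; rewrite /= in_itv/= A_ge0 A_le.
  exact: (mb measurableT (C j) (mC j)).
have H := horizontal_markov drv bm0 (A_ge0 s w) AA
  (fun i => lo ord0 (lift ord_max i)) (fun i => hi ord0 (lift ord_max i)) sE'.
have phi1E w' : phi1 (w, w') =
  ((\1_E' w' * \prod_(i < n) \1_`[lo ord0 (lift ord_max i), hi ord0 (lift ord_max i)]
      (beta i (A (s + u) w) w')) *
    \1_`[lo ord0 ord_max, hi ord0 ord_max] (Y (s + u) w))%:E.
  by rewrite /phi1 EE'.
have phi2E w' : phi2 (w, w') =
  ((\1_E' w' * \prod_(i < n) itv_kernel (wiener bm0) (lo ord0 (lift ord_max i))
    (hi ord0 (lift ord_max i)) (beta i (A s w) w') (A (s + u) w - A s w)) *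
    \1_`[lo ord0 ord_max, hi ord0 ord_max] (Y (s + u) w))%:E.
  rewrite /phi2 EE' /box_density mulrA/= !decoupled_max Y_incr A_incr//.
  congr (_ * _ * _)%:E; apply: eq_bigr => i _.
  by rewrite decoupled_lift.
under [RHS]eq_integral do rewrite phi2E.
under [LHS]eq_integral do rewrite phi1E.
have [YJ|YJ] := boolP (Y (s + u) w \in `[lo ord0 ord_max, hi ord0 ord_max]%classic).
  rewrite indicE YJ.
  under eq_integral do rewrite mulr1.
  under [RHS]eq_integral do rewrite mulr1.
  exact: H.
rewrite indicE (negbTE YJ).
under eq_integral do rewrite mulr0.
by under [RHS]eq_integral do rewrite mulr0.
Qed.

(** Once the horizontal path is fixed, [EE] and the position at [s] depend on B up to [s], and the
    remaining factor on the increments of B after [s], by scaling of the clock. *)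
Let phi23 w' : (\int[P]_w phi2 (w, w') = \int[P]_w phi3 (w, w'))%E.
Proof.
pose E' := [set w | EE (w, w')].
have EE' w : \1_EE (w, w') = \1_E' w :> R.
  by rewrite !indicE; congr (_%:R); apply/idP/idP; rewrite !inE.
pose U := g_sigma_algebraType (process_gen B `[0, s]).
have mB r : 0 <= r <= s -> measurable_fun (setT : set U) (B r).
  by move=> rs; apply: measurable_process_gen; rewrite /= in_itv.
have mbA i r : 0 <= r <= s -> measurable_fun (setT : set U) (fun w => beta i (A r w) w').
  move=> /andP[r0 rs].
  have cb : measurable_fun setT (fun x : R => beta i (Num.max x 0) w').
    apply: continuous_measurable_fun.
    exact: (continuous_clamp (@bm_continuous _ _ _ _ _ _ (bmb i) w')).
  have mA : measurable_fun (setT : set U) (A r).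
    apply: measurable_A => // x /andP[x0 xr]; apply: mB.
    by rewrite x0 (le_trans xr).
  have := measurableT_comp cb mA.
  by congr (measurable_fun _ _); apply/funext => w; rewrite /= max_l.
have mE' : measurable (E' : set U).
  rewrite (_ : E' = \bigcap_j [set w | C j (beta i0 (A (t j) w) w')]); last first.
    by apply/seteqP; split => [w h j _|w h j]; [exact: h|exact: h].
  apply: fin_bigcap_measurable; first exact: finite_finset.
  by move=> j _; have := mbA i0 (t j) (ts j) measurableT (C j) (mC j); rewrite setTI.
pose phi (z : U * pathT R) : \bar R :=
  (\1_E' z.1 * box_density Q mu lo hi u (decoupled s z.1 w') z.2)%:E.
have phi0 z : (0 <= phi z)%E by rewrite lee_fin mulr_ge0// box_density_ge0.
have mdec i : measurable_fun (setT : set U) (fun w => decoupled s w w' ord0 i).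
  case: (unliftP ord_max i) => [j ->|->].
    rewrite (_ : (fun w => _) = (fun w => beta j (A s w) w')).
      by apply: mbA; rewrite lexx s0.
    by apply/funext => w; rewrite decoupled_lift.
  rewrite (_ : (fun w => _) = Y s).
    by apply: measurable_Y; apply: mB; rewrite lexx s0.
  by apply/funext => w; rewrite decoupled_max.
have mphi : measurable_fun setT phi.
  apply/measurable_EFinP; apply: measurable_funM.
    exact: (measurableT_comp (measurable_indic mE') measurable_fst).
  apply: (@measurable_box_density _ _ _ _ _ _ _ _ u
    (fun z : U * pathT R => decoupled s z.1 w') snd) => // i.
  exact: (measurableT_comp (mdec i) measurable_fst).
transitivity (\int[P]_w phi (w, incr_path bmB s0 w))%E.
  by apply: eq_integral => w _; rewrite /phi2 EE'.
rewrite (markov_freeze bmB bm0 s0 mphi phi0).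
apply: eq_integral => w _; rewrite /phi3 EE'.
transitivity (\int[Q]_v ((\1_E' w)%:E *
    (box_density Q mu lo hi u (decoupled s w w') v)%:E))%E.
  by apply: eq_integral => v _; rewrite -EFinM.
rewrite ge0_integralZl_EFin//.
- by move=> v _; rewrite lee_fin box_density_ge0.
- apply/measurable_EFinP.
  exact: (@measurable_box_density _ _ _ _ _ _ _ (pathT R) u (fun=> decoupled s w w') id).
Qed.

(** The past event constrains the single coordinate [i0]; it will be the first one. *)
Lemma box_markov :
  (\int[P]_w (\1_[set w | forall j, C j (hyp_representation mu b B beta (t j) w ord0 (lift ord_max i0))] w *
     \1_[set x : 'rV[R]_n.+1 | forall i, lo ord0 i <= x ord0 i <= hi ord0 i]
       (hyp_representation mu b B beta (s + u) w))%:E =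
   \int[P]_w ((\1_[set w | forall j, C j (hyp_representation mu b B beta (t j) w ord0 (lift ord_max i0))] w)%:E *
     box_prob Q mu lo hi u (hyp_representation mu b B beta s w)))%E.
Proof.
have indE w : \1_[set w | forall j, C j (hyp_representation mu b B beta (t j) w ord0
    (lift ord_max i0))] w = \1_EE (w, w) :> R.
  rewrite !indicE (_ : (w \in _) = ((w, w) \in EE))//.
  apply/idP/idP; rewrite !inE => h j; have := h j.
    by rewrite -decoupled_diag decoupled_lift.
  by rewrite /= -decoupled_diag decoupled_lift.
transitivity (\int[P]_w phi1 (w, w))%E.
  apply: eq_integral => w _; rewrite indE /phi1 -mulrA; congr (_ * _)%:E.
  have [h|h] := pselect (forall i, lo ord0 i <= hyp_representation mu b B beta (s + u) w ord0 i <= hi ord0 i).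
    rewrite indicE mem_set// big1 ?mul1r.
      rewrite indicE mem_set//= in_itv/=; have := h ord_max.
      by rewrite -decoupled_diag decoupled_max.
    move=> i _; rewrite indicE mem_set//= in_itv/=; have := h (lift ord_max i).
    by rewrite -decoupled_diag decoupled_lift.
  rewrite indicE memNset//; have /existsNP[i] := h.
  rewrite -decoupled_diag; case: (unliftP ord_max i) => [j ->|->].
    rewrite decoupled_lift => hj; rewrite (bigD1 j)//= indicE memNset ?mul0r//=.
  by rewrite decoupled_max => hj; rewrite [X in _ * X]indicE memNset ?mulr0//= in_itv.
have phi10 z : (0 <= phi1 z)%E.
  by rewrite lee_fin !mulr_ge0// prodr_ge0// => i _; rewrite indicE.
have phi20 z : (0 <= phi2 z)%E by rewrite lee_fin mulr_ge0// box_density_ge0.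
have phi30 z : (0 <= phi3 z)%E by rewrite mule_ge0// box_prob_ge0.
(* From the diagonal to a double integral with the horizontal variable inside for [phi12]; then the
   order is exchanged for [phi23], and finally the way back to the diagonal. *)
have [-> _] := independent_fubini vertical_measurable horizontal_measurable
  vertical_horizontal_independent mphi1 phi10.
under eq_integral do rewrite phi12.
have [_ ->] := independent_fubini vertical_measurable horizontal_measurable
  vertical_horizontal_independent mphi2 phi20.
under eq_integral do rewrite phi23.
have [E1 E2] := independent_fubini vertical_measurable horizontal_measurable
  vertical_horizontal_independent mphi3 phi30.
by rewrite -E2 -E1; apply: eq_integral => w _; rewrite /phi3 indE.
Qed.

End Representation.

Definition box (R : realType) (n : nat) (lo hi : 'rV[R]_n) : set 'rV[R]_n :=
  [set x | forall i, lo ord0 i <= x ord0 i <= hi ord0 i].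

Section BorelRow.
Context {R : realType} {n : nat}.

Definition rowT := g_sigma_algebraType [set U : set 'rV[R]_n.+1 | open U].

Lemma measurable_coord i : measurable_fun setT (fun x : rowT => (x : 'rV[R]_n.+1) ord0 i).
Proof.
apply: (@measurability _ _ rowT R setT _ (@RGenOpens.G R)).
  exact: RGenOpens.measurableE.
move=> _ [_ [x [y ->]] <-]; rewrite setTI; apply: sub_sigma_algebra.
apply: (@open_comp _ _ (fun M : 'rV[R]_n.+1 => M ord0 i) `]x, y[%classic).
  by move=> M _; exact: coord_continuous.
exact: interval_open.
Qed.

Lemma borel_coord i (C : set R) : measurable C ->
  borel_rV [set x : 'rV[R]_n.+1 | C (x ord0 i)].
Proof.
by move=> mC; have := measurable_coord i measurableT mC; rewrite setTI.
Qed.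

Lemma borel_box (lo hi : 'rV[R]_n.+1) : borel_rV (box lo hi).
Proof.
rewrite (_ : box lo hi = \bigcap_i
    [set x : 'rV[R]_n.+1 | `[lo ord0 i, hi ord0 i]%classic (x ord0 i)]); last first.
  apply/seteqP; split => x h i; first by move=> _; rewrite /= in_itv; exact: h.
  by have := h i I; rewrite /= in_itv.
apply: (@fin_bigcap_measurable _ rowT); first exact: finite_finset.
by move=> i _; apply: borel_coord; exact: measurable_itv.
Qed.

Lemma same_law_event (d d' : measure_display) (T : measurableType d)
    (T' : measurableType d') (P : probability T R) (P' : probability T' R)
    (X : R -> T -> 'rV[R]_n.+1) (X' : R -> T' -> 'rV[R]_n.+1)
    (k : nat) (t : 'I_k -> R) (A : 'I_k -> set 'rV[R]_n.+1) (s : R) A0 :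
  same_law P X P' X' -> (forall j, 0 <= t j) -> (forall j, borel_rV (A j)) ->
  0 <= s -> borel_rV A0 ->
  P ([set w | forall j, A j (X (t j) w)] `&` [set w | A0 (X s w)]) =
  P' ([set w | forall j, A j (X' (t j) w)] `&` [set w | A0 (X' s w)]).
Proof.
move=> law t0 mA s0 mA0.
pose t' (j : 'I_k.+1) := if unlift ord_max j is Some i then t i else s.
pose A' (j : 'I_k.+1) := if unlift ord_max j is Some i then A i else A0.
have := law k.+1 t' A'; rewrite /t' /A'.
have aux (S : Type) (Z : R -> S -> 'rV[R]_n.+1) :
    [set w | forall j, A j (Z (t j) w)] `&` [set w | A0 (Z s w)] =
    [set w | forall j, A' j (Z (t' j) w)].
  apply/seteqP; split => [w [h h0] j|w h].
    by rewrite /A' /t'; case: (unlift ord_max j).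
  split => [j|/=].
    by have := h (lift ord_max j); rewrite /A' /t' liftK.
  by have := h ord_max; rewrite /A' /t' unlift_none.
rewrite !aux; apply => j; first by case: (unlift ord_max j).
by case: (unlift ord_max j).
Qed.

End BorelRow.
Arguments rowT : clear implicits.

(** * Transfer of the Markov property to X *)

Section ProcessMarkov.
Context {R : realType} {d d0 : measure_display}.
Context {T : measurableType d} {T0 : measurableType d0}.
Variables (P : probability T R) (P0 : probability T0 R).
Variables (n : nat) (mu : R) (z : 'rV[R]_n.+1) (X : R -> T -> 'rV[R]_n.+1).
Variables (a0 : R) (W0 : R -> T0 -> R).
Hypothesis n0 : (0 < n)%N.
Hypothesis hbm : hyp_brownian_motion mu z P X.
Hypothesis bm0 : brownian_motion P0 a0 W0.

Let Q := wiener bm0.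

Lemma measurable_process t : 0 <= t -> measurable_fun setT (X t : T -> rowT R n).
Proof. by move=> t0 _ A mA; rewrite setTI; case: hbm => _ + _ _; exact. Qed.

Lemma measurable_process_coord t i : 0 <= t ->
  measurable_fun setT (fun w => X t w ord0 i).
Proof.
by move=> t0; exact: (measurableT_comp (measurable_coord i) (measurable_process t0)).
Qed.

Variables (k : nat) (t : 'I_k -> R) (C : 'I_k -> set R) (s u : R).
Variables (lo hi : 'rV[R]_n.+1).
Hypotheses (u0 : 0 <= u) (ts : forall j, 0 <= t j <= s).
Hypotheses (mC : forall j, measurable (C j)) (s0 : 0 <= s).

Let E := [set w | forall j, C j (X (t j) w ord0 ord0)].

Let mE : measurable E.
Proof.
rewrite (_ : E = \bigcap_j [set w | C j (X (t j) w ord0 ord0)]); last first.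
  by apply/seteqP; split => [w h j _|w h j]; [exact: h|exact: h].
apply: fin_bigcap_measurable; first exact: finite_finset.
move=> j _; have /andP[tj0 _] := ts j.
by have := measurable_process_coord ord0 tj0 measurableT (mC j); rewrite setTI.
Qed.

(** Only finite-dimensional laws pass between X and its representation. The left side is such a
    probability; the right side is reduced to them through the law of the function under the
    integral. *)
Lemma process_markov :
  (P (E `&` [set w | box lo hi (X (s + u) w)]) =
   \int[P]_(w in E) box_prob Q mu lo hi u (X s w))%E.
Proof.
case: hbm => _ _ _ [d' [T' [P' [B [beta [drv law]]]]]].
pose Z := hyp_representation mu (z ord0 ord_max) B beta.
pose i0 : 'I_n := Ordinal n0.
(* As [n] is positive, the first coordinate differs from the last one and is horizontal. *)
have i00 : lift ord_max i0 = ord0 :> 'I_n.+1 by apply: val_inj; rewrite /= /bump leqNgt n0.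
have mZ r i : 0 <= r -> measurable_fun setT (fun w => Z r w ord0 i).
  by move=> r0; exact: (measurable_hyp_representation drv).
pose E' := [set w | forall j, C j (Z (t j) w ord0 (lift ord_max i0))].
have mE' : measurable E'.
  rewrite (_ : E' = \bigcap_j [set w | C j (Z (t j) w ord0 (lift ord_max i0))]); last first.
    by apply/seteqP; split => [w h j _|w h j]; [exact: h|exact: h].
  apply: fin_bigcap_measurable; first exact: finite_finset.
  move=> j _; have /andP[tj0 _] := ts j.
  by have := mZ _ (lift ord_max i0) tj0 measurableT _ (mC j); rewrite setTI.
have tr (A0 : set 'rV[R]_n.+1) r : 0 <= r -> borel_rV A0 ->
    P (E `&` [set w | A0 (X r w)]) = P' (E' `&` [set w | A0 (Z r w)]).
  move=> r0 mA0; rewrite /E' i00.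
  apply: (@same_law_event R n _ _ _ _ P P' X Z k t
    (fun j => [set x | C j (x ord0 ord0)]) r A0 law _ _ r0 mA0).
    by move=> j; case/andP: (ts j).
  by move=> j; exact: borel_coord.
have mbox : measurable [set w | box lo hi (Z (s + u) w)].
  rewrite (_ : [set w | _] = \bigcap_i
      ((fun w => Z (s + u) w ord0 i) @^-1` `[lo ord0 i, hi ord0 i])); last first.
    apply/seteqP; split => w h i; first by move=> _; rewrite /= in_itv; exact: h.
    by have := h i I; rewrite /= in_itv.
  apply: fin_bigcap_measurable; first exact: finite_finset.
  move=> i _; have := mZ _ i (addr_ge0 s0 u0) measurableT _ (measurable_itv `[lo ord0 i, hi ord0 i]).
  by rewrite setTI.
rewrite (tr _ _ (addr_ge0 s0 u0) (borel_box lo hi)).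
transitivity (\int[P']_(w in E') box_prob Q mu lo hi u (Z s w))%E.
  have := @box_markov _ _ _ _ _ P' P0 n _ B beta a0 W0 drv bm0 mu (z ord0 ord_max)
    k t C i0 s u u0 ts mC s0 lo hi.
  rewrite -/Z -/E' -/Q => H.
  rewrite (_ : P' _ = \int[P']_w (\1_E' w * \1_(box lo hi) (Z (s + u) w))%:E)%E.
    rewrite H [RHS]integral_mkcond; apply: eq_integral => w _.
    rewrite patchE indicE; case: (w \in E'); first by rewrite mul1e.
    by rewrite mul0e.
  rewrite -[X in P' X]setIT -integral_indic//; last exact: measurableI.
  apply: eq_integral => w _; rewrite !indicE -natrM mulnb; congr (_%:R%:E).
  congr nat_of_bool; apply/idP/idP; rewrite !inE.
    by move=> [? ?]; apply/andP; split; rewrite inE.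
  by move=> /andP[]; rewrite !inE.
pose F := box_prob Q mu lo hi u.
pose h w := if w \in E then F (X s w) else 0%E.
pose h' w := if w \in E' then F (Z s w) else 0%E.
have mF (A : set (\bar R)) : measurable A -> borel_rV (F @^-1` A).
  move=> mA; have mF0 : measurable_fun setT (fun x : rowT R n => F x).
    by apply: measurable_box_prob => // i; exact: measurable_coord.
  by have := mF0 measurableT A mA; rewrite setTI.
have mFX : measurable_fun setT (fun w => F (X s w)).
  by apply: measurable_box_prob => // i; exact: measurable_process_coord.
have mFZ : measurable_fun setT (fun w => F (Z s w)).
  by apply: measurable_box_prob => // i; exact: mZ.
have mh : measurable_fun setT h.
  rewrite (_ : h = fun w => ((\1_E w)%:E * F (X s w))%E).
    apply: emeasurable_funM => //.
    by apply/measurable_EFinP; exact: measurable_indic.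
  by apply/funext => w; rewrite /h indicE; case: ifP; rewrite (mul1e, mul0e).
have mh' : measurable_fun setT h'.
  rewrite (_ : h' = fun w => ((\1_E' w)%:E * F (Z s w))%E).
    apply: emeasurable_funM => //.
    by apply/measurable_EFinP; exact: measurable_indic.
  by apply/funext => w; rewrite /h' indicE; case: ifP; rewrite (mul1e, mul0e).
pose fh : {mfun T >-> \bar R} := HB.pack h (isMeasurableFun.Build _ _ _ _ h mh).
pose fh' : {mfun T' >-> \bar R} := HB.pack h' (isMeasurableFun.Build _ _ _ _ h' mh').
have F0 x : (0 <= F x)%E by exact: box_prob_ge0.
have h0 w : (0 <= h w)%E by rewrite /h; case: ifP.
have h'0 w : (0 <= h' w)%E by rewrite /h'; case: ifP.
rewrite integral_mkcond [RHS]integral_mkcond.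
(* The absolute value makes the integrand nonnegative on all of the extended reals; [h] and [h'] are
   nonnegative anyway. *)
transitivity (\int[distribution P' fh']_y `|y|)%E.
  rewrite ge0_integral_distribution//.
  by apply: eq_integral => w _; rewrite /= gee0_abs.
transitivity (\int[distribution P fh]_y `|y|)%E; last first.
  rewrite ge0_integral_distribution//.
  by apply: eq_integral => w _; rewrite /= gee0_abs.
apply: eq_measure_integral => A mA _.
(* If 0 is not in A1, then [h] can take a value in A1 only on [E], so the preimage is a
   finite-dimensional event. Sets containing 0 are treated through their complements. *)
have N0 (A1 : set (\bar R)) : measurable A1 -> ~ A1 0%E ->
    P' (h' @^-1` A1) = P (h @^-1` A1).
  move=> mA1 A10.
  have -> : h @^-1` A1 = E `&` [set w | (F @^-1` A1) (X s w)].
    apply/seteqP; split => w; rewrite /preimage /= /h.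
      by case: ifPn => // /set_mem.
    by move=> [wE]; rewrite mem_set.
  have -> : h' @^-1` A1 = E' `&` [set w | (F @^-1` A1) (Z s w)].
    apply/seteqP; split => w; rewrite /preimage /= /h'.
      by case: ifPn => // /set_mem.
    by move=> [wE]; rewrite mem_set.
  by rewrite (tr (F @^-1` A1))//; exact: mF.
rewrite /distribution /pushforward /=.
have [A0|] := pselect (A 0%E); last exact: N0.
have mhA : measurable (h @^-1` A) by rewrite -[X in measurable X]setTI; exact: (mh measurableT A mA).
have mhA' : measurable (h' @^-1` A) by rewrite -[X in measurable X]setTI; exact: (mh' measurableT A mA).
have nA0 : ~ (~` A) 0%E by move=> nA; exact: nA A0.
have H := N0 _ (measurableC mA) nA0.
suff : P' (h' @^-1` A) = P (h @^-1` A) by [].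
rewrite -[h' @^-1` A]setCK -[h @^-1` A]setCK.
rewrite (probability_setC _ (measurableC mhA')) (probability_setC _ (measurableC mhA)).
by congr (1 - _)%E; exact: H.
Qed.

End ProcessMarkov.

Section ProcessStart.
Context {R : realType} {d d0 : measure_display}.
Context {T : measurableType d} {T0 : measurableType d0}.
Variables (P : probability T R) (P0 : probability T0 R).
Variables (n : nat) (mu : R) (z : 'rV[R]_n.+1) (X : R -> T -> 'rV[R]_n.+1).
Variables (a0 : R) (W0 : R -> T0 -> R).
Hypothesis n0 : (0 < n)%N.
Hypothesis hbm : hyp_brownian_motion mu z P X.
Hypothesis bm0 : brownian_motion P0 a0 W0.

Let Q := wiener bm0.

Lemma measurable_start : measurable [set w | X 0 w = z].
Proof.
rewrite (_ : [set w | _] = \bigcap_i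
    ((fun w => X 0 w ord0 i) @^-1` [set z ord0 i])); last first.
  apply/seteqP; split => w /= h; first by move=> i _ /=; rewrite h.
  by apply/rowP => i; exact: h.
apply: fin_bigcap_measurable; first exact: finite_finset.
move=> i _; have := measurable_process_coord hbm i (lexx 0) measurableT (measurable_set1 (z ord0 i)).
by rewrite setTI.
Qed.

Lemma process_start : P [set w | X 0 w = z] = 1%E.
Proof.
have bz : borel_rV [set z].
  rewrite (_ : [set z] = \bigcap_i
      [set x : 'rV[R]_n.+1 | [set z ord0 i] (x ord0 i)]); last first.
    by apply/seteqP; split => [x -> i //|x h]; apply/rowP => i; exact: h.
  apply: (@fin_bigcap_measurable _ (rowT R n)); first exact: finite_finset.
  by move=> i _; apply: borel_coord; exact: measurable_set1.
case: hbm => _ _ _ [d' [T' [P' [B [beta [drv law]]]]]].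
have := @same_law_event R n _ _ _ _ P P' X _ 0 (fun=> 0) (fun=> setT) 0 [set z] law.
have I0 (S : Type) (F : 'I_0 -> S -> Prop) : [set w | forall j, F j w] = setT.
  by apply/seteqP; split => // w _ [].
rewrite !I0 !setTI => -> //; last by case.
set Z := hyp_representation _ _ _ _.
have mS : measurable [set w | [set z] (Z 0 w)].
  rewrite (_ : [set w | _] = \bigcap_i ((fun w => Z 0 w ord0 i) @^-1` [set z ord0 i])); last first.
    apply/seteqP; split => w /= h; first by move=> i _ /=; rewrite h.
    by apply/rowP => i; exact: h.
  apply: fin_bigcap_measurable; first exact: finite_finset.
  move=> i _; have mZ := measurable_hyp_representation drv mu (z ord0 ord_max) i (lexx 0).
  by have := mZ measurableT _ (measurable_set1 (z ord0 i)); rewrite setTI.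
have [bmB bmb _] := drv.
have ae_start : {ae P', forall w, [set z] (Z 0 w)}.
  have aeb : {ae P', forall w, forall i, beta i 0 w = z ord0 (lift ord_max i)}.
    by apply: filter_forall => i; exact: bm_start (bmb i).
  have aeB := bm_start bmB.
  near=> w; have bw : forall i, beta i 0 w = z ord0 (lift ord_max i) by near: w.
  have Bw : B 0 w = 0 by near: w.
  apply/rowP => i; rewrite mxE.
  case: (unliftP ord_max i) => [j ->|->].
    rewrite [clock _ _ _ _ _](_ : _ = 0); last exact: path_clock0.
    exact: bw.
  by rewrite /vertical_part Bw mulr0 subr0 expR0 mulr1.
have : P' (~` [set w | [set z] (Z 0 w)]) = 0%E.
  have [N [mN N0 sN]] := ae_start.
  by apply: subset_measure0 N0 => //; exact: measurableC.
move=> h; rewrite -[X in P' X]setCK probability_setC; last exact: measurableC.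
by rewrite h sube0.
Unshelve. all: by end_near. Qed.

(** The Markov property at time 0 with an empty family of past conditions, X_0 being [z] almost
    surely. *)
Lemma process_box_prob (u : R) (lo hi : 'rV[R]_n.+1) : 0 <= u ->
  P [set w | box lo hi (X u w)] = box_prob Q mu lo hi u z.
Proof.
move=> u0.
have I0 (S : Type) (F : 'I_0 -> S -> Prop) : [set w | forall j, F j w] = setT.
  by apply/seteqP; split => // w _ [].
have := @process_markov _ _ _ _ _ P P0 n mu z X a0 W0 n0 hbm bm0 0 (fun=> 0) (fun=> setT)
  0 u lo hi u0.
rewrite I0 setTI add0r => ->; [|by case|by []|exact: lexx].
transitivity (\int[P]_w box_prob Q mu lo hi u z)%E; last first.
  rewrite (integral_cst P measurableT) [X in (_ * X)%E](_ : _ = 1%E) ?mule1//.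
  exact: probability_setT.
have mX : measurable_fun setT (fun w => box_prob Q mu lo hi u (X 0 w)).
  by apply: measurable_box_prob => // i; exact: (measurable_process_coord hbm i (lexx 0)).
apply: ae_eq_integral; [by []|exact: mX|exact: measurable_cst|].
- exists (~` [set w | X 0 w = z]); split.
  + by apply: measurableC; exact: measurable_start.
  + transitivity (1 - P [set w | X 0 w = z])%E.
      exact: (probability_setC P measurable_start).
    by rewrite process_start subee.
  + by move=> w h hz; apply: h => _; rewrite hz.
Qed.

End ProcessStart.

(** * Gaussian bounds for small boxes *)

Lemma ge0_integral_density (R : realType) (d : measure_display)
    (T : measurableType d) (m mu : {measure set T -> \bar R}) (p : T -> R)
    (f : T -> \bar R) :
  measurable_fun setT p -> (forall x, 0 <= p x) ->
  (forall A, measurable A -> m A = \int[mu]_(x in A) (p x)%:E)%E ->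
  measurable_fun setT f -> (forall x, 0 <= f x)%E ->
  (\int[m]_x f x = \int[mu]_x (f x * (p x)%:E))%E.
Proof.
Import HBNNSimple.
move=> mp p0 mE mf f0.
have mpE : measurable_fun setT (EFin \o p) by exact/measurable_EFinP.
pose f_ := nnsfun_approx measurableT mf.
transitivity (limn (fun n => \int[m]_x (f_ n x)%:E))%E.
  rewrite -monotone_convergence//.
  - by apply: eq_integral => y _; apply/esym/cvg_lim => //; exact: cvg_nnsfun_approx.
  - by move=> n; exact/measurable_EFinP/measurable_funP.
  - by move=> n y _; rewrite lee_fin.
  - by move=> y _ i j ij; rewrite lee_fin; exact/lefP/nd_nnsfun_approx.
transitivity (limn (fun n => \int[mu]_x ((f_ n x)%:E * (p x)%:E)))%E; last first.
  rewrite -monotone_convergence//.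
  - apply: eq_integral => y _; apply/cvg_lim => //.
    by apply: cvgeZr => //; exact: cvg_nnsfun_approx.
  - move=> n; apply: emeasurable_funM => //; exact/measurable_EFinP/measurable_funP.
  - by move=> n y _; rewrite mule_ge0// lee_fin.
  - move=> y _ i j ij; rewrite lee_wpmul2r ?lee_fin//; exact/lefP/nd_nnsfun_approx.
congr (limn _); apply/funext => n.
transitivity (\int[m]_x (\sum_(k \in range (f_ n)) (k * \1_(f_ n @^-1` [set k]) x)%:E))%E.
  by apply: eq_integral => x _; rewrite fimfunE -fsumEFin.
rewrite ge0_integral_fsum//; last 2 first.
- by move=> y; apply/measurable_EFinP; exact: measurable_funM.
- by move=> y x _; rewrite nnfun_muleindic_ge0.
transitivity (\int[mu]_x (\sum_(k \in range (f_ n))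
    ((k * \1_(f_ n @^-1` [set k]) x)%:E * (p x)%:E)))%E; last first.
  apply: eq_integral => x _; rewrite [in RHS]fimfunE -fsumEFin// ge0_mule_fsuml//.
  by move=> k; rewrite nnfun_muleindic_ge0.
rewrite ge0_integral_fsum//; last 2 first.
- move=> y; apply: emeasurable_funM => //; apply/measurable_EFinP; exact: measurable_funM.
- by move=> y x _; rewrite mule_ge0 ?nnfun_muleindic_ge0// lee_fin.
apply: eq_fsbigr => k /set_mem[x0 _ kE].
have k0 : 0 <= k by rewrite -kE.
have mk : measurable (f_ n @^-1` [set k]) by [].
under eq_integral do rewrite EFinM.
rewrite ge0_integralZl_EFin//; last by apply/measurable_EFinP.
rewrite integral_indic// setIT mE// integral_mkcond.
rewrite -ge0_integralZl_EFin//; last 2 first.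
- by move=> x _; rewrite patchE; case: ifP => //; rewrite lee_fin.
- by apply: (measurable_restrictT _ mk).1; exact: measurable_funTS.
apply: eq_integral => x _; rewrite patchE EFinM -muleA indicE; congr (_ * _)%E.
by case: ifP; rewrite (mul1e, mul0e).
Qed.

Section CameronMartin.
Context {R : realType}.

Lemma ge0_integral_normal_prob (s : R) (f : R -> \bar R) :
  measurable_fun setT f -> (forall x, 0 <= f x)%E ->
  (\int[normal_prob 0 s]_x f x =
   \int[lebesgue_measure]_x (f x * (normal_pdf 0 s x)%:E))%E.
Proof.
move=> mf f0; apply: ge0_integral_density => //.
- exact: measurable_normal_pdf.
- by move=> x; exact: normal_pdf_ge0.
Qed.

(** Completing the square: 2 x - x^2 / (2 s) = 2 s - (x - 2 s)^2 / (2 s). The factor 2 comes from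
    the square of Y in the clock. *)
Lemma cameron_martin (s : R) (h : R -> \bar R) : 0 < s ->
  measurable_fun setT h -> (forall x, 0 <= h x)%E ->
  (\int[normal_prob 0 (Num.sqrt s)]_x ((expR (2 * x))%:E * h x) =
   (expR (2 * s))%:E * \int[normal_prob 0 (Num.sqrt s)]_x h (2 * s + x)%R)%E.
Proof.
move=> s0 mh h0.
have ss0 : Num.sqrt s != 0 by rewrite gt_eqF// sqrtr_gt0.
have mn : measurable_fun setT (fun x => (normal_pdf 0 (Num.sqrt s) x)%:E).
  by apply/measurable_EFinP; exact: measurable_normal_pdf.
have me : measurable_fun setT (fun x : R => (expR (2 * x))%:E).
  by apply/measurable_EFinP; apply: measurableT_comp => //; exact: measurable_funM.
have mhs : measurable_fun setT (fun x : R => h (2 * s + x)).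
  by apply: (measurableT_comp mh); exact: measurable_funD.
rewrite !ge0_integral_normal_prob//; last 2 first.
- exact: emeasurable_funM.
- by move=> x; rewrite mule_ge0// lee_fin expR_ge0.
rewrite (@lebesgue_integral_shift R _ setT (2 * s))//; last 2 first.
- by do 2 apply: emeasurable_funM => //.
- by move=> x; rewrite !mule_ge0// lee_fin ?expR_ge0// normal_pdf_ge0.
rewrite -ge0_integralZl_EFin ?expR_ge0//; last 2 first.
- by move=> x _; rewrite mule_ge0// lee_fin normal_pdf_ge0.
- exact: emeasurable_funM.
apply: eq_integral => x _.
rewrite muleAC -EFinM muleCA muleC; congr (_ * _)%E.
rewrite -EFinM; congr (_%:E).
rewrite !normal_pdfE// /normal_fun sqr_sqrtr ?ltW// !subr0.
rewrite [RHS]mulrCA [LHS]mulrCA; congr (_ * _); rewrite -!expRD; congr expR.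
by field; rewrite gt_eqF.
Qed.

End CameronMartin.

(** The k-th power of the inequality z <= exp z, at z = c (1 + v) / k. *)
Lemma expR_power_bound (R : realType) (k : nat) (c v : R) : (0 < k)%N ->
  0 < c -> 0 <= v ->
  (1 + v) ^+ k * expR (- (c * v)) <= (k%:R / c) ^+ k * expR c.
Proof.
move=> k0 c0 v0.
have k0' : 0 < k%:R :> R by rewrite ltr0n.
have h : 1 + v <= k%:R / c * expR (c * (1 + v) / k%:R).
  rewrite -ler_pdivrMl ?divr_gt0// invf_div.
  have := expR_ge1Dx (c * (1 + v) / k%:R); apply: le_trans.
  by rewrite mulrAC lerDr.
have := lerXn2r k _ _ h; rewrite !nnegrE => /(_ _ _) H.
have {H} H : (1 + v) ^+ k <= (k%:R / c) ^+ k * expR (c * (1 + v)).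
  rewrite (le_trans (H _ _)) ?addr_ge0//.
    by rewrite mulr_ge0 ?divr_ge0 ?ltW// expR_gt0.
  by rewrite exprMn -expRM_natr divfK ?gt_eqF.
apply: (le_trans (ler_wpM2r (expR_ge0 _) H)).
rewrite -mulrA -expRD; apply: ler_wpM2l.
  by rewrite exprn_ge0// divr_ge0// ltW.
by rewrite ler_expR; lra.
Qed.

Lemma normal_peak_sqrt_le (R : realType) (a : R) : 0 < a ->
  normal_peak (Num.sqrt a) <= 1 + a^-1.
Proof.
move=> a0; have ia0 : 0 < a^-1 by rewrite invr_gt0.
have X0 : 0 <= 1 + a^-1 by rewrite addr_ge0// ltW.
have Y0 : 0 < a * pi *+ 2 by rewrite mulrn_wgt0// mulr_gt0// pi_gt0.
have Y1 : (a * pi *+ 2)^-1 <= (1 + a^-1) ^+ 2.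
  apply: (@le_trans _ _ a^-1); last by nra.
  rewrite lef_pV2 ?posrE// -mulrnAr ler_peMr ?ltW//.
  by have := pi_ge2 R; rewrite mulr2n; lra.
rewrite /normal_peak sqr_sqrtr; last exact: ltW.
rewrite -sqrtrV; last exact: ltW.
by rewrite -(ger0_norm X0) -sqrtr_sqr; exact: ler_wsqrtr.
Qed.

(** The exponential beats even the power n + 1 of 1 + 1 / a. The spare factor is kept because its
    inverse a / (1 + a) is at most 1 and at most a: each bound serves one case of
    [box_prob_bound]. *)
Lemma gauss_peak_bound (R : realType) (n : nat) (c : R) : 0 < c ->
  exists2 K : R, 0 <= K & forall a : R, 0 < a ->
    normal_peak (Num.sqrt a) ^+ n * expR (- (c / a)) <= K * (1 + a^-1)^-1.
Proof.
move=> c0; exists ((n.+1%:R / c) ^+ n.+1 * expR c).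
  by rewrite mulr_ge0 ?expR_ge0// exprn_ge0// divr_ge0// ltW.
move=> a a0.
have ia0 : 0 < a^-1 by rewrite invr_gt0.
rewrite ler_pdivlMr ?addr_gt0//.
apply: le_trans (expR_power_bound (ltn0Sn n) c0 (ltW ia0)).
have X0 : 0 <= 1 + a^-1 by rewrite addr_ge0// ltW.
rewrite exprSr mulrAC; apply: ler_wpM2r; first exact: expR_ge0.
apply: ler_wpM2r => //.
apply: lerXn2r; [by rewrite nnegrE normal_peak_ge0|by rewrite nnegrE|].
exact: normal_peak_sqrt_le.
Qed.

Section WienerKernel.
Context {R : realType} {d0 : measure_display} {T0 : measurableType d0}.
Variables (P0 : probability T0 R) (a0 : R) (W0 : R -> T0 -> R).
Hypothesis bm0 : brownian_motion P0 a0 W0.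

Let Q := wiener bm0.

Lemma wiener_marginal (a : R) (S : set R) : 0 < a -> measurable S ->
  Q [set v : pathT R | S ((v : cpath R) a)] = normal_prob 0 (Num.sqrt a) S.
Proof.
move=> a1 mS; case: (bm0) => _ _ _ /(_ 0 a S (lexx 0) a1 mS) h _.
rewrite subr0 in h; rewrite -h /Q /wiener /distribution /pushforward/=.
by congr (P0 _); apply/seteqP; split => w; rewrite /preimage/= add0r.
Qed.

Lemma wiener_integral (a : R) (f : R -> \bar R) : 0 < a ->
  measurable_fun setT f -> (forall x, 0 <= f x)%E ->
  (\int[Q]_v f ((v : cpath R) a) = \int[normal_prob 0 (Num.sqrt a)]_x f x)%E.
Proof.
move=> a1 mf f0.
pose e (v : pathT R) : measurableTypeR R := (v : cpath R) a.
have me : measurable_fun setT e by apply: measurable_path_eval; exact: ltW.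
pose fe : {mfun pathT R >-> measurableTypeR R} := HB.pack e (isMeasurableFun.Build _ _ _ _ e me).
transitivity (\int[distribution Q fe]_x f x)%E.
  by rewrite ge0_integral_distribution.
apply: eq_measure_integral => A mA _.
exact: (wiener_marginal a1 mA).
Qed.

Lemma itv_kernelE (lo hi m a : R) : 0 < a ->
  ((itv_kernel Q lo hi m a)%:E =
   \int[lebesgue_measure]_(x in `[(lo - m)%R, (hi - m)%R])
     (normal_pdf 0 (Num.sqrt a) x)%:E)%E.
Proof.
move=> a1; rewrite /itv_kernel fineK; last by rewrite fin_num_measure//; exact: measurable_itv_set.
rewrite max_l ?ltW//.
transitivity (Q [set v : pathT R | `[lo - m, hi - m]%classic ((v : cpath R) a)]).
  by congr (Q _); apply/seteqP; split => v; rewrite /= in_itv/= lerBlDl lerBrDl.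
exact: wiener_marginal.
Qed.

Lemma itv_kernel_le (lo hi m a delta : R) : 0 < a -> lo <= hi -> 0 <= delta ->
  (forall x, lo <= m + x <= hi -> delta <= `|x|) ->
  itv_kernel Q lo hi m a <=
  (hi - lo) * (normal_peak (Num.sqrt a) * expR (- (delta ^+ 2 / 2 / a))).
Proof.
move=> a1 lohi d1 h; rewrite -lee_fin itv_kernelE//.
have sa : Num.sqrt a != 0 by rewrite gt_eqF// sqrtr_gt0.
set K := normal_peak _ * _.
apply: (@le_trans _ _ (\int[lebesgue_measure]_(x in `[(lo - m)%R, (hi - m)%R]) K%:E)%E).
  apply: ge0_le_integral_nonmeas => x; first by rewrite lee_fin normal_pdf_ge0.
  rewrite /= in_itv/= lerBlDl lerBrDl => /h dx.
  rewrite lee_fin normal_pdfE// /K ler_wpM2l ?normal_peak_ge0//.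
  rewrite /normal_fun ler_expR subr0 sqr_sqrtr; last exact: ltW.
  have -> : - x ^+ 2 / (a *+ 2) = - (x ^+ 2 / 2 / a) by field; rewrite gt_eqF.
  rewrite lerN2; apply: ler_wpM2r; first by rewrite invr_ge0 ltW.
  apply: ler_wpM2r => //.
  by rewrite -(real_normK (num_real x)) lerXn2r// nnegrE.
rewrite integral_cst//= lebesgue_measure_itv/= lte_fin; case: ifPn => [_|].
  by rewrite -EFinB -EFinM lee_fin opprB addrA subrK mulrC.
by rewrite mule0 lee_fin mulr_ge0 ?subr_ge0// mulr_ge0 ?normal_peak_ge0// expR_ge0.
Qed.

Lemma itv_kernelN (lo hi a : R) : 0 < a -> lo <= hi ->
  itv_kernel Q (- hi) (- lo) 0 a = itv_kernel Q lo hi 0 a.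
Proof.
move=> a1 lohi; apply: EFin_inj; rewrite !itv_kernelE// !subr0.
have sa : Num.sqrt a != 0 by rewrite gt_eqF// sqrtr_gt0.
rewrite integration_by_substitution_oppr//; last first.
  by apply: continuous_subspaceT; exact: continuous_normal_pdf.
apply: eq_integral => x _; rewrite /= !normal_pdfE//; congr (_ * _)%:E.
by rewrite /normal_fun !subr0 sqrrN.
Qed.

Lemma wiener_markov (lo hi m s u : R) (h : R -> \bar R) : 0 <= s -> s <= u ->
  measurable_fun setT h -> (forall x, 0 <= h x)%E ->
  (\int[Q]_v (h ((v : cpath R) s) * (\1_`[lo, hi] (m + (v : cpath R) u))%:E) =
   \int[Q]_v (h ((v : cpath R) s) *
     (itv_kernel Q lo hi (m + (v : cpath R) s) (u - s))%:E))%E.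
Proof.
move=> s0 su mh h0.
have u0 : 0 <= u by exact: le_trans su.
have us : 0 <= u - s by rewrite subr_ge0.
pose U := g_sigma_algebraType (process_gen W0 `[0, s]).
pose D (w : U) : R := W0 s w - W0 0 w.
have mD : measurable_fun setT D.
  by apply: measurable_funB; apply: measurable_process_gen;
    rewrite /= in_itv/= ?lexx ?s0.
pose phi (z : U * pathT R) : \bar R :=
  (h (D z.1) * (\1_`[lo, hi] (m + (D z.1 + (z.2 : cpath R) (u - s))))%:E)%E.
have phi0 z : (0 <= phi z)%E by rewrite mule_ge0// lee_fin.
have mphi : measurable_fun setT phi.
  apply: emeasurable_funM.
    exact: (measurableT_comp (measurableT_comp mh mD) measurable_fst).
  apply/measurable_EFinP.
  apply: (measurableT_comp (measurable_indic (measurable_itv _))).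
  apply: measurable_funD => //; apply: measurable_funD.
    exact: (measurableT_comp mD measurable_fst).
  exact: (measurableT_comp (measurable_path_eval us) measurable_snd).
have me1 : measurable_fun setT (fun v : pathT R =>
    h ((v : cpath R) s) * (\1_`[lo, hi] (m + (v : cpath R) u))%:E)%E.
  apply: emeasurable_funM; first exact: (measurableT_comp mh (measurable_path_eval s0)).
  apply/measurable_EFinP.
  apply: (measurableT_comp (measurable_indic (measurable_itv _))).
  by apply: measurable_funD => //; exact: measurable_path_eval.
have me2 : measurable_fun setT (fun v : pathT R => h ((v : cpath R) s) *
     (itv_kernel Q lo hi (m + (v : cpath R) s) (u - s))%:E)%E.
  apply: emeasurable_funM; first exact: (measurableT_comp mh (measurable_path_eval s0)).
  apply/measurable_EFinP; apply: measurable_itv_kernel => //.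
  by apply: measurable_funD => //; exact: measurable_path_eval.
rewrite /Q /wiener ge0_integral_distribution//; last first.
  by move=> v; rewrite mule_ge0// lee_fin.
rewrite ge0_integral_distribution//; last first.
  by move=> v; rewrite mule_ge0// lee_fin itv_kernel_ge0.
transitivity (\int[P0]_w phi (w, incr_path bm0 s0 w))%E.
  apply: eq_integral => w _; rewrite /phi /D /=.
  have E : W0 s w - W0 0 w + (W0 u w - W0 s w) = W0 u w - W0 0 w by ring.
  by rewrite !add0r subrKC E.
rewrite (markov_freeze bm0 bm0 s0 mphi phi0).
apply: eq_integral => w _.
rewrite /phi /= add0r -/(D w) -/Q.
pose S := [set v : pathT R | lo <= m + D w + (v : cpath R) (Num.max (u - s) 0) <= hi].
have mS : measurable S by exact: measurable_itv_set.
have mSE : measurable_fun setT (fun v : pathT R => (\1_S v : R)%:E).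
  by apply/measurable_EFinP; exact: measurable_indic.
transitivity (\int[Q]_v (h (D w) * (\1_S v)%:E))%E.
  apply: eq_integral => v _; rewrite !indicE.
  rewrite (_ : (m + _ \in _) = (v \in S))//.
  by apply/idP/idP => /set_mem h'; apply/mem_set; move: h';
    rewrite /S /= in_itv/= max_l// (addrA m (D w)).
rewrite ge0_integralZl//.
rewrite integral_indic// setIT /itv_kernel fineK//.
by rewrite fin_num_measure.
Qed.

(** Weighting by exp(2 v_s) adds a drift 2 up to time [s]. The Markov property at [s] reduces the
    claim to a Gaussian shift of v_s and is then used backwards. *)
Lemma wiener_tilt (lo hi s u : R) : 0 < s -> s <= u ->
  (\int[Q]_v ((expR (2 * (v : cpath R) s))%:E * (\1_`[lo, hi] ((v : cpath R) u))%:E) =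
   (expR (2 * s) * itv_kernel Q lo hi (2 * s) u)%:E)%E.
Proof.
move=> s0 su.
have me : measurable_fun setT (fun x : R => (expR (2 * x))%:E).
  by apply/measurable_EFinP; apply: measurableT_comp => //; exact: measurable_funM.
have mk (m : R) : measurable_fun setT (fun x : R => (itv_kernel Q lo hi (m + x) (u - s))%:E).
  by apply/measurable_EFinP; apply: measurable_itv_kernel => //; exact: measurable_funD.
have k0 (m x : R) : (0 <= (itv_kernel Q lo hi (m + x) (u - s))%:E)%E.
  by rewrite lee_fin itv_kernel_ge0.
transitivity (\int[Q]_v ((expR (2 * (v : cpath R) s))%:E *
    (\1_`[lo, hi] (0 + (v : cpath R) u)%R)%:E))%E.
  by apply: eq_integral => v _; rewrite add0r.
rewrite (@wiener_markov lo hi 0 s u (fun x => (expR (2 * x))%:E) (ltW s0) su me); last first.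
  by move=> x; rewrite lee_fin expR_ge0.
rewrite (@wiener_integral s (fun x => (expR (2 * x))%:E * (itv_kernel Q lo hi (0 + x) (u - s))%:E)%E)//; last 2 first.
- exact: emeasurable_funM.
- by move=> x; rewrite mule_ge0// lee_fin expR_ge0.
rewrite (@cameron_martin R s (fun x => (itv_kernel Q lo hi (0 + x) (u - s))%:E))//.
rewrite EFinM; congr (_ * _)%E.
under eq_integral do rewrite add0r.
rewrite -(@wiener_integral s (fun x => (itv_kernel Q lo hi (2 * s + x) (u - s))%:E))//.
transitivity (\int[Q]_v (1%E * (itv_kernel Q lo hi (2 * s + (v : cpath R) s)%R (u - s)%R)%:E))%E.
  by apply: eq_integral => v _; rewrite mul1e.
rewrite -(@wiener_markov lo hi (2 * s) s u (fun=> 1%E) (ltW s0) su)//.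
have u0 : 0 < u by exact: lt_le_trans su.
under eq_integral do rewrite mul1e.
have mS := measurable_itv_set lo hi (2 * s) u.
rewrite /itv_kernel fineK ?fin_num_measure// -[X in Q X]setIT -integral_indic//.
apply: eq_integral => v _; rewrite !indicE.
congr (_%:R%:E); congr nat_of_bool.
by apply/idP/idP => /set_mem h; apply/mem_set; move: h;
  rewrite /= in_itv/= max_l// ltW.
Qed.

End WienerKernel.

(** * The uniform bound on box probabilities *)

Section BoxBound.
Context {R : realType} {d0 : measure_display} {T0 : measurableType d0}.
Variables (P0 : probability T0 R) (a0 : R) (W0 : R -> T0 -> R).
Hypothesis bm0 : brownian_motion P0 a0 W0.

Let Q := wiener bm0.

Lemma itv_probE (lo hi u : R) : 0 <= u ->
  (\int[Q]_v (\1_`[lo, hi] ((v : cpath R) u))%:E = (itv_kernel Q lo hi 0 u)%:E)%E.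
Proof.
move=> u0; have mS := measurable_itv_set lo hi 0 u.
rewrite /itv_kernel fineK ?fin_num_measure// -[X in Q X]setIT -integral_indic//.
apply: eq_integral => v _; rewrite !indicE.
congr (_%:R%:E); congr nat_of_bool.
by apply/idP/idP => /set_mem h; apply/mem_set; move: h;
  rewrite /= in_itv/= max_l// add0r.
Qed.

(** As the drift is downward, Y_s^2 <= b^2 exp(2 v_s). After exchanging the integrals, [wiener_tilt]
    bounds each time s by exp(2 u) (hi - lo) (1 + 1 / u), up to b^2; integration over s in ]0, u]
    leaves the factor u (1 + 1 / u) = 1 + u, without singularity at u = 0. *)
Lemma path_clock_tilt_le (mu b lo hi u : R) : 0 <= mu -> 0 < u -> lo <= hi ->
  (\int[Q]_v (path_clock mu b (v : cpath R) u * \1_`[lo, hi] ((v : cpath R) u))%:E <=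
   (b ^+ 2 * expR (2 * u) * (hi - lo) * (1 + u))%:E)%E.
Proof.
move=> mu0 u0 lohi.
pose g (z : R * pathT R) : \bar R :=
  (b ^+ 2 * expR (2 * (z.2 : cpath R) (Num.max z.1 0)) * \1_`]0, u] z.1 *
   \1_`[lo, hi] ((z.2 : cpath R) u))%:E.
have g0 z : (0 <= g z)%E.
  rewrite lee_fin; apply: mulr_ge0 => //; apply: mulr_ge0 => //.
  by apply: mulr_ge0; [exact: sqr_ge0|exact: expR_ge0].
have mg : measurable_fun setT g.
  apply/measurable_EFinP; apply: measurable_funM; first apply: measurable_funM.
  - apply: measurable_funM => //; apply: measurableT_comp => //.
    by apply: measurable_funM => //; exact: measurable_path_eval2.
  - exact: (measurableT_comp (measurable_indic (measurable_itv _)) measurable_fst).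
  - apply: (measurableT_comp (measurable_indic (measurable_itv _))).
    exact: (measurableT_comp (measurable_path_eval (ltW u0)) measurable_snd).
apply: (@le_trans _ _ (\int[Q]_v \int[lebesgue_measure]_s g (s, v))%E).
  apply: ge0_le_integral_nonmeas => v _.
    by rewrite lee_fin mulr_ge0// path_clock_ge0.
  rewrite EFinM (path_clock_fineE mu b u (@path_cont _ v)).
  have mcl : measurable_fun setT
      (fun x : R => ((b * expR ((v : cpath R) (Num.max x 0) - mu * x)) ^+ 2)%:E).
    by apply/measurable_EFinP; exact: (measurable_clamped mu b (@path_cont _ v)).
  (* Time 0 is dropped because [wiener_tilt] needs s > 0. *)
  rewrite -integral_itv_obnd_cbnd; last exact: measurable_funTS.
  rewrite integral_mkcond muleC -ge0_integralZl_EFin//; last 2 first.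
  - by move=> s _; rewrite patchE; case: ifP => // _; rewrite lee_fin sqr_ge0.
  - by apply: (measurable_restrictT _ _).1 => //; exact: measurable_funTS.
  apply: ge0_le_integral_nonmeas => s _.
    by rewrite mule_ge0 ?lee_fin// patchE; case: ifP => // _; rewrite lee_fin sqr_ge0.
  rewrite patchE /g/= [X in (_ <= X%:E)%E]mulrC [X in (_ <= X)%E]EFinM; apply: lee_wpmul2l.
    by rewrite lee_fin.
  rewrite indicE; case: ifPn => [su|]; last first.
    by rewrite mulr0.
  rewrite mulr1 lee_fin exprMn; apply: ler_wpM2l; first exact: sqr_ge0.
  rewrite -expRM_natl ler_expR; move: su; rewrite inE/= in_itv/= => /andP[s0 _].
  rewrite (max_l (ltW s0)); apply: ler_wpM2l => //.
  by rewrite lerBlDr lerDl mulr_ge0// ltW.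
rewrite -(@fubini_tonelli _ _ _ _ _ lebesgue_measure Q g)//.
apply: (@le_trans _ _ (\int[lebesgue_measure]_(s in `]0%R, u])
    (b ^+ 2 * expR (2 * u) * ((hi - lo) * (1 + u^-1)))%:E)%E).
  rewrite [leRHS]integral_mkcond.
  apply: ge0_le_integral_nonmeas => s _; first by apply: integral_ge0.
  rewrite patchE; case: ifPn => [|su]; last first.
    by rewrite integral0_eq// => v _; rewrite /g/= indicE (negbTE su) mulr0 mul0r.
  rewrite inE/= in_itv/= => /andP[s0 su].
  have -> : (\int[Q]_v g (s, v) = \int[Q]_v ((b ^+ 2)%:E *
      ((expR (2 * (v : cpath R) s))%:E * (\1_`[lo, hi] ((v : cpath R) u))%:E)))%E.
    apply: eq_integral => v _; rewrite /g/= max_l ?(ltW s0)//.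
    rewrite indicE mem_set/= ?in_itv/= ?s0 ?su// mulr1 -!EFinM mulrA//.
  rewrite ge0_integralZl_EFin ?sqr_ge0//; last first.
  - apply: emeasurable_funM; apply/measurable_EFinP.
      apply: measurableT_comp => //; apply: measurable_funM => //.
      by apply: measurable_path_eval; exact: ltW.
    apply: (measurableT_comp (measurable_indic (measurable_itv _))).
    by apply: measurable_path_eval; exact: ltW.
  rewrite (wiener_tilt bm0 lo hi s0 su) -EFinM lee_fin -mulrA.
  apply: ler_wpM2l; first exact: sqr_ge0.
  apply: ler_pM; [exact: expR_ge0|exact: itv_kernel_ge0| |].
    by rewrite ler_expR ler_pM2l.
  have := @itv_kernel_le _ _ _ _ _ _ bm0 lo hi (2 * s) u 0 u0 lohi (lexx 0) (fun x _ => normr_ge0 x).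
  move=> /le_trans; apply; apply: ler_wpM2l; first by rewrite subr_ge0.
  rewrite expr0n/= !mul0r oppr0 expR0 mulr1.
  exact: normal_peak_sqrt_le.
rewrite integral_cst//= lebesgue_measure_itv/= lte_fin u0 sube0 -EFinM lee_fin.
rewrite le_eqVlt; apply/orP; left; apply/eqP; field.
by rewrite gt_eqF.
Qed.

(* Uniform in the time: as u -> 0 the vertical density blows up, which is
   compensated by the horizontal displacement delta. *)
Lemma box_prob_bound (n : nat) (mu tmax delta : R) (y : 'rV[R]_n.+1) (i0 : 'I_n) :
  0 < mu -> 0 < delta -> 0 < y ord0 ord_max ->
  exists2 K : R, 0 <= K & forall (r u : R) (z : 'rV[R]_n.+1),
    0 < r -> r <= delta -> r <= y ord0 ord_max / 2 -> 0 < u -> u <= tmax ->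
    0 < z ord0 ord_max ->
    2 * delta <= `|y ord0 (lift ord_max i0) - z ord0 (lift ord_max i0)| ->
    (box_prob Q mu (y - const_mx r) (y + const_mx r) u z <=
     (K * (2 * r) ^+ n.+1)%:E)%E.
Proof.
move=> mu0 d1 yn0.
have c0 : 0 < delta ^+ 2 / 2 by rewrite divr_gt0// exprn_gt0.
have [K1 K10 hK1] := gauss_peak_bound n c0.
have h0 : 0 < (1 ^+ 2 / 2 : R) by rewrite divr_gt0// exprn_gt0.
have [K2 K20 hK2] := gauss_peak_bound 1 h0.
set yn := y ord0 ord_max in yn0 *.
(* A start above height [M] forces the driving path below -1 at time [u] if the box is to be
   reached; this displacement is the 1 in [h0]. *)
pose M := 2 * yn * expR (1 + mu * tmax).
have M0 : 0 < M by rewrite !mulr_gt0// expR_gt0.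
(* The sign of [tmax] is unknown, hence the absolute value of [K3] in the constant. *)
pose K3 := M ^+ 2 * expR (2 * tmax) * (1 + tmax).
exists (K1 * (2 / yn) * (K2 + `|K3|)).
  by rewrite mulr_ge0// ?addr_ge0// mulr_ge0// divr_ge0// ltW.
move=> r u z r0 rd ry u0 ut zn0 dz.
set zn := z ord0 ord_max in zn0 *.
set lo := y - const_mx r; set hi := y + const_mx r.
have loE i : lo ord0 i = y ord0 i - r by rewrite !mxE.
have hiE i : hi ord0 i = y ord0 i + r by rewrite !mxE.
have r2 : 0 <= 2 * r by rewrite mulr_ge0// ltW.
have lon : 0 < lo ord0 ord_max by rewrite loE -/yn; lra.
have hin : 0 < hi ord0 ord_max by rewrite hiE -/yn; lra.
(* In logarithmic scale the vertical condition reads v_u in [L, H], an interval of length at most (2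
   / yn) (2 r) by ln (1 + x) <= x and lo_n >= yn / 2. *)
pose L := ln (lo ord0 ord_max) - ln zn + mu * u.
pose H := ln (hi ord0 ord_max) - ln zn + mu * u.
have LH : L <= H.
  by rewrite !lerD2r ler_ln ?posrE// loE hiE; lra.
have HL : H - L <= 2 / yn * (2 * r).
  have -> : H - L = ln (hi ord0 ord_max / lo ord0 ord_max).
    by rewrite ln_div ?posrE// /H /L; ring.
  have -> : hi ord0 ord_max / lo ord0 ord_max = 1 + 2 * r / lo ord0 ord_max.
    have e : hi ord0 ord_max = lo ord0 ord_max + 2 * r by rewrite hiE loE; ring.
    by rewrite e mulrDl mulfV// gt_eqF.
  apply: le_trans (le_ln1Dx _) _.
    by rewrite (lt_le_trans (ltrN10 R))// divr_ge0// ltW.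
  rewrite mulrC; apply: ler_wpM2r => //.
  rewrite -[leRHS]invrK invf_div lef_pV2 ?posrE ?divr_gt0//.
  by rewrite loE -/yn; lra.
have prodle (a : R) : 0 < a ->
    \prod_(i < n) itv_kernel Q (lo ord0 (lift ord_max i)) (hi ord0 (lift ord_max i))
      (z ord0 (lift ord_max i)) a <= (2 * r) ^+ n * (K1 * (1 + a^-1)^-1).
  move=> a1.
  have pk0 : 0 <= normal_peak (Num.sqrt a) by exact: normal_peak_ge0.
  have w i : hi ord0 (lift ord_max i) - lo ord0 (lift ord_max i) = 2 * r.
    by rewrite loE hiE; ring.
  have lohi i : lo ord0 (lift ord_max i) <= hi ord0 (lift ord_max i).
    by rewrite -subr_ge0 w.
  apply: (@le_trans _ _ ((2 * r) ^+ n * (normal_peak (Num.sqrt a) ^+ n *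
      expR (- (delta ^+ 2 / 2 / a))))); last first.
    by apply: ler_wpM2l; [exact: exprn_ge0|exact: hK1].
  (* Only the coordinate [i0], where the start is far from the box, contributes the exponential; the
     others are bounded by the peak of the density. *)
  apply: (@le_trans _ _ (\prod_(i < n) (2 * r * normal_peak (Num.sqrt a) *
      if i == i0 then expR (- (delta ^+ 2 / 2 / a)) else 1))).
    apply: ler_prod => i _; rewrite itv_kernel_ge0 /=.
    rewrite -(w i) -mulrA; case: eqVneq => [->|_].
      apply: (itv_kernel_le bm0) => //; first exact: ltW.
      move=> x; rewrite loE hiE => /andP[h1 h2].
      have := ler_distD (z ord0 (lift ord_max i0) + x) (y ord0 (lift ord_max i0)) (z ord0 (lift ord_max i0)).
      move=> h3; have := le_trans dz h3.
      have -> : z ord0 (lift ord_max i0) + x - z ord0 (lift ord_max i0) = x by ring.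
      have : `|y ord0 (lift ord_max i0) - (z ord0 (lift ord_max i0) + x)| <= r.
        by rewrite ler_norml; apply/andP; split; lra.
      lra.
    have := @itv_kernel_le _ _ _ _ _ _ bm0 (lo ord0 (lift ord_max i)) (hi ord0 (lift ord_max i))
      (z ord0 (lift ord_max i)) a 0 a1 (lohi i) (lexx 0) (fun x _ => normr_ge0 x).
    by rewrite expr0n/= !mul0r oppr0 expR0.
  rewrite big_split/= prodr_const card_ord exprMn -mulrA.
  rewrite (bigD1 i0)//= eqxx big1 ?mulr1// => i /negbTE -> //.
have densle v : (box_density Q mu lo hi u z v <=
    (2 * r) ^+ n * K1 * (1 + (path_clock mu zn (v : cpath R) u)^-1)^-1 *
    \1_`[L, H] ((v : cpath R) u)).
  rewrite /box_density -/zn.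
  have a1 : 0 < path_clock mu zn (v : cpath R) u.
    by apply: path_clock_gt0 => //; [exact: path_cont|rewrite gt_eqF].
  apply: ler_pM => //.
  - by rewrite prodr_ge0// => i _; exact: itv_kernel_ge0.
  - by rewrite -mulrA; exact: prodle.
  rewrite !indicE; case: (boolP (_ \in `[lo _ _, _]%classic)) => // /set_mem.
  rewrite /= in_itv/= => /andP[h1 h2].
  have ze : 0 < zn * expR ((v : cpath R) u - mu * u) by rewrite mulr_gt0// expR_gt0.
  have lnE : ln (zn * expR ((v : cpath R) u - mu * u)) =
      ln zn + ((v : cpath R) u - mu * u).
    by rewrite lnM ?posrE ?expR_gt0// expRK.
  rewrite mem_set//= in_itv/=; apply/andP; split.
    have : ln (lo ord0 ord_max) <= ln (zn * expR ((v : cpath R) u - mu * u)).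
      by rewrite ler_ln.
    by rewrite lnE /L; lra.
  have : ln (zn * expR ((v : cpath R) u - mu * u)) <= ln (hi ord0 ord_max).
    by rewrite ler_ln.
  by rewrite lnE /H; lra.
have K1r : 0 <= (2 * r) ^+ n * K1 by rewrite mulr_ge0// exprn_ge0.
rewrite [leRHS](_ : _ = ((2 * r) ^+ n * K1 * (2 / yn * (2 * r)) * K2 +
   (2 * r) ^+ n * K1 * (2 / yn * (2 * r)) * `|K3|)%:E); last first.
  by rewrite exprS; congr (_%:E); ring.
(* High starts: the horizontal factor (1 + 1 / a)^-1 is bounded by 1, and the vertical density at
   distance at least 1 stays bounded as u tends to 0. *)
have [Mz|zM] := leP M zn.
  apply: (@le_trans _ _ ((2 * r) ^+ n * K1 * (2 / yn * (2 * r)) * K2)%:E); last first.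
    by rewrite lee_fin lerDl mulr_ge0// mulr_ge0// mulr_ge0// divr_ge0// ltW.
  apply: (@le_trans _ _ (\int[Q]_v (((2 * r) ^+ n * K1)%:E * (\1_`[L, H] ((v : cpath R) u))%:E))%E).
    apply: ge0_le_integral_nonmeas => v _; first by rewrite lee_fin box_density_ge0.
    rewrite lee_fin (le_trans (densle v))//; apply: ler_wpM2r => //.
    rewrite ler_piMr// invf_le1 ?lerDl ?invr_ge0 ?path_clock_ge0//.
    by rewrite ltr_pwDl// invr_ge0 path_clock_ge0.
  rewrite ge0_integralZl_EFin//; last first.
    apply/measurable_EFinP.
    apply: (measurableT_comp (measurable_indic (measurable_itv _))).
    by apply: measurable_path_eval; exact: ltW.
  rewrite (itv_probE L H (ltW u0)) -EFinM lee_fin -!mulrA.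
  do 2 (apply: ler_wpM2l; first by rewrite ?exprn_ge0).
  apply: le_trans (itv_kernel_le bm0 u0 LH ler01 _) _.
    move=> x; rewrite add0r => /andP[_ xH].
    have lnhi : ln (hi ord0 ord_max) <= ln (2 * yn).
      by rewrite ler_ln ?posrE ?mulr_gt0// hiE -/yn; lra.
    have lnM' : ln (2 * yn) + (1 + mu * tmax) <= ln zn.
      rewrite -[1 + mu * tmax]expRK -lnM ?posrE ?mulr_gt0 ?expR_gt0//.
      by rewrite ler_ln ?posrE.
    have mut : mu * u <= mu * tmax by rewrite ler_pM2l.
    have x1 : x <= -1 by move: xH; rewrite /H; lra.
    by rewrite ler0_norm; lra.
  rewrite [leRHS](_ : _ = (2 / yn * (2 * r)) * K2); last by rewrite !mulrA.
  apply: ler_pM => //.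
  - by rewrite subr_ge0.
  - by rewrite mulr_ge0 ?normal_peak_ge0 ?expR_ge0.
  - have := hK2 _ u0; rewrite expr1 => /le_trans; apply.
    have iu0 : 0 <= u^-1 by rewrite invr_ge0 ltW.
    by rewrite ler_piMr// invf_le1 ?lerDl// ltr_pwDl.
(* Low starts: the horizontal factor is bounded by the clock a, whose expectation on the vertical
   event is under control as zn < M. *)
apply: (@le_trans _ _ ((2 * r) ^+ n * K1 * (2 / yn * (2 * r)) * `|K3|)%:E); last first.
  by rewrite lee_fin lerDr mulr_ge0// mulr_ge0// mulr_ge0// divr_ge0// ltW.
apply: (@le_trans _ _ (\int[Q]_v (((2 * r) ^+ n * K1)%:E *
    (path_clock mu zn (v : cpath R) u * \1_`[L, H] ((v : cpath R) u))%:E))%E).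
  apply: ge0_le_integral_nonmeas => v _; first by rewrite lee_fin box_density_ge0.
  rewrite -EFinM lee_fin (le_trans (densle v))// mulrA; apply: ler_wpM2r => //.
  apply: ler_wpM2l => //.
  have a1 : 0 < path_clock mu zn (v : cpath R) u.
    by apply: path_clock_gt0 => //; [exact: path_cont|rewrite gt_eqF].
  rewrite -[leRHS]invrK lef_pV2 ?posrE ?invr_gt0// ?lerDr//.
  by rewrite addr_gt0// invr_gt0.
rewrite ge0_integralZl_EFin//; last 2 first.
- by move=> v _; rewrite lee_fin mulr_ge0// path_clock_ge0.
- apply/measurable_EFinP; apply: measurable_funM.
    apply: (@measurable_path_clock R _ (pathT R) (fun t v => (v : cpath R) t)) => //.
    + by move=> x /andP[x0 _]; exact: measurable_path_eval.
    + by move=> v; exact: path_cont.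
    + exact: ltW.
  apply: (measurableT_comp (measurable_indic (measurable_itv _))).
  by apply: measurable_path_eval; exact: ltW.
rewrite -(mulrA ((2 * r) ^+ n * K1)) [leRHS]EFinM; apply: lee_wpmul2l; first by rewrite lee_fin.
apply: (le_trans (path_clock_tilt_le _ (ltW mu0) u0 LH)).
rewrite lee_fin (_ : _ * (1 + u) = (H - L) * (zn ^+ 2 * expR (2 * u) * (1 + u))); last by ring.
apply: ler_pM => //.
- by rewrite subr_ge0.
- apply: mulr_ge0; last by rewrite addr_ge0// ltW.
  by apply: mulr_ge0; [exact: sqr_ge0|exact: expR_ge0].
apply: le_trans (ler_norm _); rewrite /K3.
apply: ler_pM.
- by apply: mulr_ge0; [exact: sqr_ge0|exact: expR_ge0].
- by rewrite addr_ge0// ltW.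
- apply: ler_pM; rewrite ?sqr_ge0 ?expR_ge0//.
    by rewrite lerXn2r ?nnegrE// ltW.
  by rewrite ler_expR ler_pM2l.
- by rewrite lerD2l.
Qed.

End BoxBound.

(** * Box probabilities and the transition density *)

Section Reflection.
Context {R : realType} {d0 : measure_display} {T0 : measurableType d0}.
Variables (P0 : probability T0 R) (a0 : R) (W0 : R -> T0 -> R).
Hypothesis bm0 : brownian_motion P0 a0 W0.

(** Only the factor of the first coordinate changes. As [z] lies on the hyperplane, it concerns a
    centred Gaussian and two opposite intervals. *)
Lemma box_prob_reflect (n : nat) (mu r u : R) (y z : 'rV[R]_n.+1) :
  (0 < n)%N -> 0 <= r -> 0 < u -> 0 < z ord0 ord_max -> z ord0 ord0 = 0 ->
  box_prob (wiener bm0) mu (reflect1 y - const_mx r) (reflect1 y + const_mx r) u z =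
  box_prob (wiener bm0) mu (y - const_mx r) (y + const_mx r) u z.
Proof.
move=> n0 r0 u0 zn z0.
have max0 : (ord_max == ord0 :> 'I_n.+1) = false.
  by apply/negbTE; rewrite -val_eqE/= -lt0n.
apply: eq_integral => v _; rewrite /box_density; congr (_ * _)%:E; last first.
  by rewrite !mxE max0.
apply: eq_bigr => i _; rewrite !mxE.
have a1 : 0 < path_clock mu (z ord0 ord_max) (v : cpath R) u.
  by apply: path_clock_gt0 => //; [exact: path_cont|rewrite gt_eqF].
case: eqVneq => [->|//]; rewrite z0.
rewrite -(itv_kernelN bm0 a1); last by lra.
by congr itv_kernel; ring.
Qed.

End Reflection.

Section RowIntegral.
Context {R : realType}.

Lemma lebesgue_integral_rV_ge0 (n : nat) (f : 'rV[R]_n -> \bar R) :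
  (forall x, 0 <= f x)%E -> (0 <= lebesgue_integral_rV f)%E.
Proof.
elim: n f => [|n ih] f f0 /=; first exact: f0.
by apply: integral_ge0 => a _; apply: ih => v; exact: f0.
Qed.

Lemma le_lebesgue_integral_rV (n : nat) (f g : 'rV[R]_n -> \bar R) :
  (forall x, 0 <= f x)%E -> (forall x, f x <= g x)%E ->
  (lebesgue_integral_rV f <= lebesgue_integral_rV g)%E.
Proof.
elim: n f g => [|n ih] f g f0 fg /=; first exact: fg.
apply: ge0_le_integral_nonmeas => a _; first exact: lebesgue_integral_rV_ge0.
by apply: ih.
Qed.

Lemma row_mx_head (n : nat) (a : R) (v : 'rV[R]_n) :
  (row_mx (const_mx a) v : 'rV[R]_(1 + n)) ord0 ord0 = a.
Proof.
by rewrite (_ : ord0 = lshift n ord0 :> 'I_(1 + n)) ?row_mxEl ?mxE//; exact: val_inj.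
Qed.

Lemma row_mx_tail (n : nat) (a : R) (v : 'rV[R]_n) i :
  (row_mx (const_mx a) v : 'rV[R]_(1 + n)) ord0 (lift ord0 i) = v ord0 i.
Proof.
by rewrite (_ : lift ord0 i = rshift 1 i :> 'I_(1 + n)) ?row_mxEr//; exact: val_inj.
Qed.

Lemma lebesgue_integral_rV_box (n : nat) (lo hi : 'rV[R]_n) (c : R) :
  0 <= c -> (forall i, lo ord0 i <= hi ord0 i) ->
  lebesgue_integral_rV (fun x => (c * \1_(box lo hi) x)%:E) =
  (c * \prod_i (hi ord0 i - lo ord0 i))%:E.
Proof.
elim: n lo hi c => [|n ih] lo hi c c0 lohi /=.
  by rewrite big_ord0 mulr1 indicE mem_set ?mulr1// => -[].
pose lo' : 'rV[R]_n := \row_i lo ord0 (lift ord0 i).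
pose hi' : 'rV[R]_n := \row_i hi ord0 (lift ord0 i).
have boxE (a : R) (v : 'rV[R]_n) : box lo hi (row_mx (const_mx a : 'rV[R]_1) v : 'rV[R]_(1 + n)) <->
    lo ord0 ord0 <= a <= hi ord0 ord0 /\ box lo' hi' v.
  split=> [h|[ha hv] i].
    split; first by have := h ord0; rewrite row_mx_head.
    by move=> i; have := h (lift ord0 i); rewrite row_mx_tail !mxE.
  case: (unliftP ord0 i) => [j ->|->]; last by rewrite row_mx_head.
  by rewrite row_mx_tail; have := hv j; rewrite !mxE.
transitivity (\int[lebesgue_measure]_a
    ((c * \prod_i (hi' ord0 i - lo' ord0 i))%:E *
     (\1_`[lo ord0 ord0, hi ord0 ord0] a)%:E))%E.
  apply: eq_integral => a _.
  rewrite -ih//; last by move=> i; rewrite !mxE.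
  rewrite [in RHS]indicE; case: (boolP (a \in `[lo ord0 ord0, hi ord0 ord0]%classic)) => ha.
    rewrite mule1; congr lebesgue_integral_rV; apply/funext => v.
    rewrite !indicE; congr (_ * _%:R)%:E; congr nat_of_bool.
    move: ha; rewrite inE/= in_itv/= => ha.
    apply/idP/idP => /set_mem h; apply/mem_set; first by have /boxE[] := h.
    exact/boxE.
  rewrite mule0 (_ : (fun v => _) = (fun v : 'rV[R]_n => (0 * \1_(box lo' hi') v)%:E)).
    by rewrite ih ?mul0r// => i; rewrite !mxE.
  apply/funext => v; rewrite mul0r indicE memNset ?mulr0//.
  move=> /boxE[ha' _]; move: ha; rewrite notin_setE; apply.
  by rewrite /= in_itv.
have c1 : 0 <= c * \prod_i (hi' ord0 i - lo' ord0 i).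
  by rewrite mulr_ge0// prodr_ge0// => i _; rewrite subr_ge0 !mxE.
have mi : measurable_fun setT (fun a : R => (\1_`[lo ord0 ord0, hi ord0 ord0] a : R)%:E).
  by apply/measurable_EFinP; exact: measurable_indic.
rewrite ge0_integralZl_EFin//.
rewrite integral_indic//= setIT lebesgue_measure_itv/= lte_fin.
have -> : (if (lo ord0 ord0 < hi ord0 ord0)%R then (hi ord0 ord0)%:E - (lo ord0 ord0)%:E else 0)%E =
    ((hi ord0 ord0 - lo ord0 ord0)%R)%:E :> \bar R.
  have := lohi ord0; rewrite le_eqVlt => /orP[/eqP ->|->]; last by rewrite EFinB.
  by rewrite ltxx subrr.
rewrite -EFinM big_ord_recl -mulrA; congr (c * _)%:E; rewrite mulrC; congr (_ * _).
by apply: eq_bigr => i _; rewrite !mxE.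
Qed.

End RowIntegral.

Section DensityLimit.
Context {R : realType}.

(** Comparison with constants on the box uses monotonicity only, so no slice of [g] has to be
    measurable. The lower bound must be nonnegative. *)
Lemma hyp_integral_box_approx (n : nat) (y : 'rV[R]_n.+1) (r a b : R)
    (g : 'rV[R]_n.+1 -> R) :
  0 <= r -> 0 <= a ->
  (forall x, box (y - const_mx r) (y + const_mx r) x ->
    a <= (x ord0 ord_max) ^- n.+1 * g x <= b) ->
  ((a * (2 * r) ^+ n.+1)%:E <=
     hyp_integral (box (y - const_mx r) (y + const_mx r)) (fun x => (g x)%:E))%E /\
  (hyp_integral (box (y - const_mx r) (y + const_mx r)) (fun x => (g x)%:E) <=
     (b * (2 * r) ^+ n.+1)%:E)%E.
Proof.
move=> r0 a0 h.
set lo := y - _; set hi := y + _.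
have lohi i : lo ord0 i <= hi ord0 i by rewrite !mxE; lra.
have lohir i : hi ord0 i - lo ord0 i = 2 * r by rewrite !mxE; ring.
have boxy : box lo hi y by move=> i; rewrite !mxE; apply/andP; split; lra.
have b0 : 0 <= b by have /andP[h1 h2] := h _ boxy; exact: le_trans (le_trans a0 h1) h2.
have E c : 0 <= c -> lebesgue_integral_rV (fun x => (c * \1_(box lo hi) x)%:E) =
    (c * (2 * r) ^+ n.+1)%:E.
  move=> c0; rewrite lebesgue_integral_rV_box//; congr (_ * _)%:E.
  by rewrite (eq_bigr (fun=> 2 * r)) ?prodr_const ?card_ord// => i _; exact: lohir.
rewrite /hyp_integral; split.
  rewrite -E//; apply: le_lebesgue_integral_rV => x.
    by rewrite lee_fin mulr_ge0.
  rewrite patchE indicE; case: (boolP (x \in _)) => [/set_mem xb|_].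
    by rewrite mulr1 -EFinM lee_fin; have /andP[] := h _ xb.
  by rewrite mulr0.
rewrite -E//; apply: le_lebesgue_integral_rV => x.
  rewrite patchE; case: ifPn => [/set_mem xb|//].
  by rewrite -EFinM lee_fin; have /andP[h1 _] := h _ xb; exact: le_trans h1.
rewrite patchE indicE; case: (boolP (x \in _)) => [/set_mem xb|_].
  by rewrite mulr1 -EFinM lee_fin; have /andP[] := h _ xb.
by rewrite mulr0.
Qed.

(** Joint continuity of [p] makes one [delta] serve for time, start and box size together; the grid
    sum varies all three at once. *)
Lemma hyp_density_near (n : nat) (p : R -> 'rV[R]_n.+1 -> 'rV[R]_n.+1 -> R)
    (s : R) (z y : 'rV[R]_n.+1) (e : R) :
  (forall (t : R) x y, 0 < t -> hyp_space x -> hyp_space y -> 0 <= p t x y) ->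
  {within [set z : R * 'rV[R]_n.+1 * 'rV[R]_n.+1 |
                [/\ 0 < z.1.1, hyp_space z.1.2 & hyp_space z.2] ],
        continuous (fun z => p z.1.1 z.1.2 z.2)} ->
  0 < s -> hyp_space z -> hyp_space y -> 0 < e ->
  exists2 delta : R, 0 < delta & forall s' z' r,
    `|s - s'| < delta -> ball z delta z' -> 0 < s' -> hyp_space z' ->
    0 < r -> r < delta ->
    let I := hyp_integral (box (y - const_mx r) (y + const_mx r)) (fun x => (p s' z' x)%:E) in
    ((((y ord0 ord_max) ^- n.+1 * p s z y - e) * (2 * r) ^+ n.+1)%:E <= I)%E /\
    (I <= (((y ord0 ord_max) ^- n.+1 * p s z y + e) * (2 * r) ^+ n.+1)%:E)%E.
Proof.
move=> p0 pc s0 zh yh e0.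
set S := [set _ | _] in pc; set l := _ * p s z y.
pose q0 : R * 'rV[R]_n.+1 * 'rV[R]_n.+1 := (s, z, y).
have Sq0 : S q0 by split.
have cp : (fun q => p q.1.1 q.1.2 q.2) @ within S (nbhs q0) --> p s z y.
  rewrite (nbhs_subspace_in Sq0); have := pc q0.
  exact.
have cy : (fun q : R * 'rV[R]_n.+1 * 'rV[R]_n.+1 => (q.2 ord0 ord_max) ^- n.+1)
    @ within S (nbhs q0) --> (y ord0 ord_max) ^- n.+1.
  apply: cvg_within_filter.
  have cn : continuous (fun q : R * 'rV[R]_n.+1 * 'rV[R]_n.+1 => q.2 ord0 ord_max).
    move=> q; apply: (@continuous_comp _ _ _ snd (fun M : 'rV[R]_n.+1 => M ord0 ord_max)).
      exact: cvg_snd.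
    exact: coord_continuous.
  have ce : {for y ord0 ord_max, continuous (fun x : R => x ^- n.+1)}.
    apply: cvgV; first by rewrite expf_neq0// gt_eqF.
    exact: exprn_continuous.
  exact: (@continuous_comp _ _ _ (fun q : R * 'rV[R]_n.+1 * 'rV[R]_n.+1 => q.2 ord0 ord_max)
    (fun x : R => x ^- n.+1) q0 (cn q0) ce).
have : \forall q \near within S (nbhs (q0 : R * 'rV[R]_n.+1 * 'rV[R]_n.+1)),
    `|l - ((q : R * 'rV[R]_n.+1 * 'rV[R]_n.+1).2 ord0 ord_max) ^- n.+1 * p q.1.1 q.1.2 q.2| <= e.
  by move: (e) e0; apply/cvgrPdist_le; exact: cvgM.
move=> /nbhs_ballP[d /= d0 hd].
(* The second bound keeps the box inside the upper half-space. *)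
exists (Num.min d (y ord0 ord_max)); first by rewrite lt_min d0.
move=> s' z' r; rewrite lt_min => /andP[ss' _] bz s'0 z'h r0.
rewrite lt_min => /andP[rd ry].
have bz' : ball z d z' by apply: le_ball bz; rewrite ge_min lexx.
have boxP x : box (y - const_mx r) (y + const_mx r) x ->
    hyp_space x /\ `|l - (x ord0 ord_max) ^- n.+1 * p s' z' x| <= e.
  move=> bx; have xh : hyp_space x.
    by have /andP[+ _] := bx ord_max; rewrite !mxE /hyp_space/=; lra.
  split=> //; apply: (hd (s', z', x)); last by split.
  split; first by split.
  split=> // i j /=; rewrite [i]ord1; have := bx j; rewrite !mxE => /andP[h1 h2].
  by rewrite /ball/= ltr_norml; apply/andP; split; lra.
have [||h1 h2] := @hyp_integral_box_approx n y r (Num.max (l - e) 0) (l + e) (p s' z') (ltW r0).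
- by rewrite le_max lexx orbT.
- move=> x /boxP[xh]; rewrite ler_norml => /andP[k1 k2].
  apply/andP; split; last by lra.
  rewrite ge_max; apply/andP; split; first by lra.
  by rewrite mulr_ge0 ?p0// invr_ge0 exprn_ge0// ltW.
split=> //; apply: le_trans h1; rewrite lee_fin; apply: ler_wpM2r.
  by rewrite exprn_ge0// mulr_ge0// ltW.
by rewrite le_max lexx.
Qed.

End DensityLimit.

(** * Survival and the exit time *)

Lemma probability_integral_ext (R : realType) (d : measure_display)
    (T : measurableType d) (P : probability T R) (G : set (set T)) (A : set T)
    (f : T -> \bar R) :
  G `<=` measurable -> setI_closed G -> G setT -> measurable A ->
  measurable_fun setT f -> (forall x, 0 <= f x)%E ->
  (forall E, G E -> P (E `&` A) = \int[P]_(x in E) f x)%E ->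
  forall E, <<s G >> E -> (P (E `&` A) = \int[P]_(x in E) f x)%E.
Proof.
move=> Gm GI GT mA mf f0 h.
pose m2 (E : set T) : \bar R := (\int[P]_(x in E) f x)%E.
have m20 : m2 set0 = 0%E by rewrite /m2 integral_set0.
have m2ge0 E : (0 <= m2 E)%E by exact: integral_ge0.
have m2s : semi_sigma_additive m2.
  move=> F mF tF mUF; rewrite /m2 ge0_integral_bigcup//; last exact: measurable_funTS.
  by apply: is_cvg_nneseries_cond => k _ _; exact: integral_ge0.
pose M2 : {measure set T -> \bar R} := HB.pack m2 (isMeasure.Build _ _ _ m2 m20 m2ge0 m2s).
pose M1 : {measure set T -> \bar R} := mrestr P mA.
have := @finite_measure_ext R d T G M1 M2 Gm GI GT; apply.
  have : (P (setT `&` A) <= 1)%E by apply: probability_le1; exact: measurableI.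
  by move=> /le_lt_trans; apply; rewrite ltry.
exact: h.
Qed.

Lemma continuous_ge_rat (R : realType) (g : R -> R) (c : R) :
  continuous g -> (forall q : rat, c <= g (ratr q)) -> forall r, c <= g r.
Proof.
move=> cg gq r; rewrite leNgt; apply/negP => gr.
have oU : open (g @^-1` `]-oo, c[%classic).
  by apply: open_comp; [move=> *; exact: cg|exact: interval_open].
have [||s [Us [q _ qs]]] := @dense_rat R (g @^-1` `]-oo, c[%classic).
- by exists r; rewrite /= in_itv.
- by [].
by move: Us; rewrite /= in_itv/= -qs ltNge gq.
Qed.

Definition survives (R : realType) (f : R -> R) (s : R) : Prop :=
  forall r, 0 <= r <= s -> 0 < f r.

Section Survival.
Context {R : realType}.
Implicit Types f : R -> R.

Let clamp (s r : R) := Num.max (Num.min r s) 0.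

Let clampP (s r : R) : 0 <= s -> 0 <= clamp s r <= s.
Proof. by move=> s0; rewrite /clamp ge_max s0 ge_min le_max !lexx !orbT. Qed.

(** A positive continuous function on a compact interval has a positive lower bound; this gives a
    countable description of survival. Clamping sends every rational into [0, s], so only the past
    of [s] is consulted. *)
Lemma survivesP f (s : R) : {within `[0, +oo[, continuous f} -> 0 <= s ->
  survives f s <-> exists l : nat, forall q : rat, l.+1%:R^-1 <= f (clamp s (ratr q)).
Proof.
move=> cf s0; have cg := continuous_clamp cf.
split=> [h|[l hl] r /andP[r0 rs]]; last first.
  have cc : continuous (fun r => f (clamp s r)).
    move=> u; apply: (@continuous_comp _ _ _ (fun r => Num.min r s) (fun r => f (Num.max r 0))).
      exact: (@continuous_min R R id (fun=> s) u cvg_id (cvg_cst _)).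
    exact: cg.
  have := @continuous_ge_rat R _ _ cc hl r.
  rewrite /clamp (min_idPl rs) (max_idPl r0); apply: lt_le_trans.
  by rewrite invr_gt0 ltr0n.
have [||c cs hc] := @EVT_min R (fun r => f (Num.max r 0)) 0 s.
- exact: s0.
- by apply: continuous_subspaceT.
have fc : 0 < f (Num.max c 0).
  by apply: h; move: cs; rewrite in_itv/= => /andP[c0 cs]; rewrite (max_idPl c0) c0.
have [l hl] : exists l : nat, l.+1%:R^-1 < f (Num.max c 0).
  by have [l hl] := ltr_add_invr fc; rewrite add0r in hl; exists l.
exists l => q; apply: le_trans (ltW hl) _.
have /andP[k0 ks] := clampP (ratr q) s0.
by have := hc (clamp s (ratr q)); rewrite in_itv/= k0 ks (max_idPl k0); exact.
Qed.

Lemma survives_past (T : pointedType) (W : R -> T -> R) (s s' : R) :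
  (forall w, {within `[0, +oo[, continuous (fun r => W r w)}) ->
  0 <= s' -> s' <= s ->
  <<s process_gen W [set r | 0 <= r <= s] >> [set w | survives (fun r => W r w) s'].
Proof.
move=> cW s'0 s's.
pose G := process_gen W [set r | 0 <= r <= s].
have s0 : 0 <= s by exact: le_trans s's.
rewrite (_ : [set w | _] = \bigcup_l \bigcap_q
    [set w | `[l.+1%:R^-1, +oo[%classic (W (clamp s' (ratr q)) w)]); last first.
  apply/seteqP; split => w.
    move=> /(survivesP (cW w) s'0)[l hl]; exists l => // q _.
    by rewrite /= in_itv/= andbT.
  move=> [l _ hl]; apply/(survivesP (cW w) s'0); exists l => q.
  by have := hl q I; rewrite /= in_itv/= andbT.
have [G0 GC GU] := @smallest_sigma_algebra _ setT G.
apply: GU => l.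
have GI : @measurable _ (g_sigma_algebraType G) (\bigcap_q
    [set w | `[l.+1%:R^-1, +oo[%classic (W (clamp s' (ratr q)) w)]).
  rewrite -[X in measurable X]setCK setC_bigcap; apply: measurableC.
  apply: bigcupT_measurable_rat => q; apply: measurableC.
  have := @measurable_process_gen R T W [set r | 0 <= r <= s] (clamp s' (ratr q)) _
    measurableT _ (measurable_itv `[l.+1%:R^-1, +oo[).
  rewrite setTI; apply.
  have /andP[k0 k] := clampP (ratr q) s'0.
  by rewrite /= k0/=; exact: le_trans k s's.
exact: GI.
Qed.
End Survival.

Section PastMarkov.
Context {R : realType} {d d0 : measure_display}.
Context {T : measurableType d} {T0 : measurableType d0}.
Variables (P : probability T R) (P0 : probability T0 R).
Variables (n : nat) (mu : R) (z : 'rV[R]_n.+1) (X : R -> T -> 'rV[R]_n.+1).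
Variables (a0 : R) (W0 : R -> T0 -> R).
Hypothesis n0 : (0 < n)%N.
Hypothesis hbm : hyp_brownian_motion mu z P X.
Hypothesis bm0 : brownian_motion P0 a0 W0.

Let Q := wiener bm0.

Lemma continuous_process_coord i w :
  {within `[0, +oo[, continuous (fun r => X r w ord0 i)}.
Proof.
case: hbm => _ _ cX _ r.
exact: (@continuous_comp _ _ _ _ (fun M : 'rV[R]_n.+1 => M ord0 i) r (cX w r)
  (@coord_continuous _ _ _ _ _ _)).
Qed.

Definition past (s : R) : set (set T) :=
  <<s process_gen (fun r w => X r w ord0 ord0) [set r | 0 <= r <= s] >>.

Lemma past_measurable s E : past s E -> measurable E.
Proof.
apply: smallest_sub; first exact: sigma_algebra_measurable.
move=> _ [r [A [/andP[r0 _] mA ->]]].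
by rewrite -[X in measurable X]setTI; exact: (measurable_process_coord hbm).
Qed.

Lemma process_markov_past (s u : R) (lo hi : 'rV[R]_n.+1) (E : set T) :
  0 <= s -> 0 <= u -> past s E ->
  (P (E `&` [set w | box lo hi (X (s + u) w)]) =
   \int[P]_(w in E) box_prob Q mu lo hi u (X s w))%E.
Proof.
move=> s0 u0 /sub_process_gen_fin_cylinder.
apply: probability_integral_ext.
- by apply: fin_cylinder_measurable => r /andP[r0 _]; exact: (measurable_process_coord hbm).
- exact: fin_cylinderI.
- exact: fin_cylinderT.
- case: hbm => _ mX _ _; exact: (mX _ _ (addr_ge0 s0 u0) (borel_box lo hi)).
- by apply: measurable_box_prob => // i; exact: (measurable_process_coord hbm i s0).
- by move=> w; exact: box_prob_ge0.
move=> _ [l [C [ls mC ->]]].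
rewrite (_ : [set w | _] = [set w | forall j : 'I_(size l),
    C (nth 0 l j) (X (nth 0 l j) w ord0 ord0)]); last first.
  apply/seteqP; split => w h j; first by apply: h; rewrite mem_nth.
  by move=> /(nthP 0)[i il <-]; exact: (h (Ordinal il)).
apply: (@process_markov _ _ _ _ _ P P0 n mu z X a0 W0 n0 hbm bm0 _
  (fun j : 'I_(size l) => nth 0 l j) (fun j => C (nth 0 l j))) => // j.
by apply: ls; rewrite mem_nth.
Qed.

End PastMarkov.

(** * The exit time from D along a continuous path *)

Section ExitTime.
Context {R : realType} {d : measure_display} {T : measurableType d} {n : nat}.
Variables (X : R -> T -> 'rV[R]_n.+1) (w : T).
Hypothesis Xhyp : forall t : R, 0 <= t -> hyp_space (X t w).

Let f (r : R) : R := X r w ord0 ord0.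
Let tau := exit_time X (@half_space R n) w.

Hypothesis cf : {within `[0, +oo[, continuous f}.
Hypothesis f0 : 0 < f 0.

(** By continuity positivity at [s] persists a little longer, whence the strict inequality. *)
Lemma survives_lt_exit (s : R) : 0 <= s -> survives f s -> (s%:E < tau)%E.
Proof.
move=> s0 fs.
have g0 : 0 < f (Num.max s 0) by rewrite (max_idPl s0); apply: fs; rewrite s0 lexx.
have [e /= e0 he] : \forall r \near s, 0 < f (Num.max r 0).
  exact: (@cvgr_gt R R (nbhs s) _ (fun r => f (Num.max r 0)) _ (@continuous_clamp _ _ cf s) _ g0).
apply: (@lt_le_trans _ _ (s + e)%:E); first by rewrite lte_fin ltrDl.
apply: le_ereal_inf_tmp => _ [r [r0 nD] <-]; rewrite lee_fin leNgt; apply/negP => rse.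
apply: nD; split; first exact: Xhyp (ltW r0).
have [rs|sr] := leP r s; first by apply: fs; rewrite (ltW r0).
have := he r; rewrite (max_idPl (ltW r0)); apply.
by rewrite /= ltr0_norm; lra.
Qed.

Lemma lt_exit_survives (s : R) : (s%:E < tau)%E -> survives f s.
Proof.
move=> st r /andP[]; rewrite le_eqVlt => /predU1P[<- //|r0 rs].
apply: contrapT => nr.
have : (tau <= r%:E)%E.
  by apply: ge_ereal_inf; exists r%:E; rewrite ?lexx//; exists r => //; split => // -[].
by move=> /(lt_le_trans st); rewrite lte_fin ltNge rs.
Qed.

Lemma survives_exitE (s : R) : 0 <= s -> survives f s <-> (s%:E < tau)%E.
Proof. by move=> s0; split; [exact: survives_lt_exit|exact: lt_exit_survives]. Qed.

Lemma exit_gt0 : (0 < tau)%E.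
Proof.
by apply: survives_lt_exit => // r r0; have -> : r = 0 by apply/eqP; rewrite eq_le andbC.
Qed.

(** A positive value would mean survival beyond [s], and a negative one would already be negative
    shortly before [s]. *)
Lemma exit_zero (s : R) : tau = s%:E -> f s = 0.
Proof.
move=> ts; have s0 : 0 < s by rewrite -lte_fin -ts exit_gt0.
have lt_s r : 0 <= r -> r < s -> 0 < f r.
  move=> r0 rs; apply: (@lt_exit_survives r); last by rewrite r0 lexx.
  by rewrite ts lte_fin.
apply/eqP; rewrite eq_le; apply/andP; split.
  rewrite leNgt; apply/negP => fs.
  have : survives f s.
    move=> r /andP[r0]; rewrite le_eqVlt => /predU1P[-> //|]; exact: lt_s.
  by move=> /(survives_lt_exit (ltW s0)); rewrite ts ltxx.
rewrite leNgt; apply/negP => fs.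
have g0 : f (Num.max s 0) < 0 by rewrite (max_idPl (ltW s0)).
have [e /= e0 he] : \forall r \near s, f (Num.max r 0) < 0.
  exact: (@cvgr_lt R R (nbhs s) _ (fun r => f (Num.max r 0)) _ (@continuous_clamp _ _ cf s) _ g0).
pose r := Num.max (s - e / 2) 0.
have r0 : 0 <= r by rewrite le_max lexx orbT.
have rs : r < s by rewrite gt_max s0 andbT; lra.
have := lt_s _ r0 rs; apply/negP; rewrite -leNgt; apply: ltW.
rewrite -[X in f X](max_idPl r0); apply: he => /=.
rewrite gtr0_norm ?subr_gt0//.
have : s - e / 2 <= r by rewrite le_max lexx.
lra.
Qed.

Lemma exit_time_lt (s : R) : f s < 0 -> 0 < s -> (tau < s%:E)%E.
Proof.
move=> fs s0; have : (tau <= s%:E)%E.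
  apply: ge_ereal_inf; exists s%:E; rewrite ?lexx//; exists s => //; split => // -[_].
  by rewrite ltNge (ltW fs).
rewrite le_eqVlt => /predU1P[/exit_zero h|//].
by rewrite h ltxx in fs.
Qed.

Lemma exit_fin (s : R) : (tau < s%:E)%E -> exists2 r, tau = r%:E & 0 < r < s.
Proof.
move=> ts; exists (fine tau).
  by rewrite fineK// ge0_fin_numE ?(ltW exit_gt0)// (lt_trans ts)// ltry.
rewrite -!lte_fin fineK ?exit_gt0//.
by rewrite ge0_fin_numE ?(ltW exit_gt0)// (lt_trans ts)// ltry.
Qed.

End ExitTime.

Section Reflect1.
Context {R : realType} {n : nat}.
Implicit Types y : 'rV[R]_n.+1.

Lemma reflect1_first y : reflect1 y ord0 ord0 = - y ord0 ord0.
Proof. by rewrite mxE eqxx. Qed.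

Lemma reflect1_last y : (0 < n)%N -> reflect1 y ord0 ord_max = y ord0 ord_max.
Proof. by move=> n0; rewrite mxE -val_eqE/= gtn_eqF. Qed.

Lemma hyp_space_reflect1 y : (0 < n)%N -> hyp_space y -> hyp_space (reflect1 y).
Proof. by move=> n0; rewrite /hyp_space/= reflect1_last. Qed.

End Reflect1.

(** * Normalised box probabilities *)

Section BoxRatio.
Context {R : realType} {d d0 : measure_display}.
Context {T : measurableType d} {T0 : measurableType d0}.
Variables (n : nat) (mu : R) (P : 'rV[R]_n.+1 -> probability T R).
Variables (X : R -> T -> 'rV[R]_n.+1) (p : R -> 'rV[R]_n.+1 -> 'rV[R]_n.+1 -> R).
Variables (P0 : probability T0 R) (a0 : R) (W0 : R -> T0 -> R).
Hypotheses (n0 : (0 < n)%N) (mu0 : 0 < mu).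
Hypothesis hbm : forall x, hyp_space x -> hyp_brownian_motion mu x (P x) X.
Hypothesis ctd : continuous_transition_density P X p.
Hypothesis bm0 : brownian_motion P0 a0 W0.

(** A mean density for Lebesgue measure and not for dV: as r tends to 0 it approximates p(u, z, y)
    divided by the (n+1)-st power of the last coordinate of y. *)
Definition box_ratio (y : 'rV[R]_n.+1) (r u : R) (z : 'rV[R]_n.+1) : R :=
  fine (box_prob (wiener bm0) mu (y - const_mx r) (y + const_mx r) u z) /
  (2 * r) ^+ n.+1.

Lemma box_ratio_ge0 y r u z : 0 <= r -> 0 <= box_ratio y r u z.
Proof.
move=> r0; apply: divr_ge0; first by apply: fine_ge0; exact: box_prob_ge0.
by rewrite exprn_ge0// mulr_ge0.
Qed.

Lemma box_ratioE y r u z : 0 < r ->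
  ((box_ratio y r u z * (2 * r) ^+ n.+1)%:E =
   box_prob (wiener bm0) mu (y - const_mx r) (y + const_mx r) u z)%E.
Proof.
move=> r0; rewrite /box_ratio divfK; last by rewrite expf_neq0// gt_eqF// mulr_gt0.
by rewrite fineK// box_prob_fin_num.
Qed.

Lemma hyp_space_box (y : 'rV[R]_n.+1) r :
  r < y ord0 ord_max -> box (y - const_mx r) (y + const_mx r) `<=` @hyp_space R n.
Proof.
by move=> ry x /(_ ord_max)/andP[+ _]; rewrite !mxE /hyp_space/=; lra.
Qed.

(** Here the measures [P z'] of all starting points enter: under each of them the kernel equals the
    integral of [p] over the box. *)
Lemma box_ratio_near (s : R) (z y : 'rV[R]_n.+1) (e : R) :
  0 < s -> hyp_space z -> hyp_space y -> 0 < e ->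
  exists2 delta : R, 0 < delta & forall s' z' r,
    `|s - s'| < delta -> ball z delta z' -> 0 < s' -> hyp_space z' ->
    0 < r -> r < delta ->
    `|(y ord0 ord_max) ^- n.+1 * p s z y - box_ratio y r s' z'| <= e.
Proof.
case: ctd => p0 pc pd s0 zh yh e0.
have [dl dl0 hd] := hyp_density_near p0 pc s0 zh yh e0.
exists (Num.min dl (y ord0 ord_max)); first by rewrite lt_min dl0.
move=> s' z' r; rewrite lt_min => /andP[ss' _] bz s'0 z'h r0.
rewrite lt_min => /andP[rd ry].
have bz' : ball z dl z' by apply: le_ball bz; rewrite ge_min lexx.
have [] := hd s' z' r ss' bz' s'0 z'h r0 rd.
rewrite -(pd s' z' _ s'0 z'h (borel_box _ _) (hyp_space_box ry)).
rewrite (process_box_prob n0 (hbm z'h) bm0 _ _ (ltW s'0)) -box_ratioE//.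
have pr : 0 < (2 * r) ^+ n.+1 by rewrite exprn_gt0// mulr_gt0.
rewrite !lee_fin !ler_pM2r// => h1 h2.
by rewrite ler_norml; apply/andP; split; lra.
Qed.

(** The symmetry is exact for every box, and passes to the density as the box shrinks. *)
Lemma density_reflect (s : R) (z y : 'rV[R]_n.+1) :
  0 < s -> hyp_space z -> hyp_space y -> z ord0 ord0 = 0 ->
  p s z (reflect1 y) = p s z y.
Proof.
move=> s0 zh yh z0; have yh' := hyp_space_reflect1 n0 yh.
have yn : 0 < (y ord0 ord_max) ^- n.+1 by rewrite invr_gt0 exprn_gt0.
apply: (mulfI (lt0r_neq0 yn)); apply/eqP; rewrite -subr_eq0 -normr_le0.
apply/ler_addgt0Pl => e e0; rewrite addr0.
have e2 : 0 < e / 2 by rewrite divr_gt0.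
have [d1 d10 h1] := box_ratio_near s0 zh yh e2.
have [d2 d20 h2] := box_ratio_near s0 zh yh' e2.
pose r := Num.min d1 d2 / 2.
have r0 : 0 < r by rewrite divr_gt0// lt_min d10.
have rd1 : r < d1.
  have : Num.min d1 d2 <= d1 by rewrite ge_min lexx.
  by rewrite /r; lra.
have rd2 : r < d2.
  have : Num.min d1 d2 <= d2 by rewrite ge_min lexx orbT.
  by rewrite /r; lra.
have := h1 s z r; have := h2 s z r; rewrite subrr normr0.
move=> /(_ d20 (ballxx _ d20) s0 zh r0 rd2) k2 /(_ d10 (ballxx _ d10) s0 zh r0 rd1) k1.
rewrite reflect1_last// in k2.
have E : box_ratio (reflect1 y) r s z = box_ratio y r s z.
  by rewrite /box_ratio (box_prob_reflect bm0)// ltW.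
rewrite E in k2; move: k1 k2; rewrite !ler_norml => /andP[? ?] /andP[? ?].
by apply/andP; split; lra.
Qed.

Lemma box_ratio_bound (t c : R) (y : 'rV[R]_n.+1) :
  hyp_space y -> 0 < c ->
  exists K rho : R, [/\ 0 <= K, 0 < rho & forall r u z,
    0 < r -> r <= rho -> 0 < u -> u <= t -> hyp_space z ->
    c <= `|y ord0 ord0 - z ord0 ord0| -> box_ratio y r u z <= K].
Proof.
move=> yh c0; have c2 : 0 < c / 2 by rewrite divr_gt0.
pose i0 : 'I_n := Ordinal n0.
have i00 : lift ord_max i0 = ord0 :> 'I_n.+1 by apply: val_inj; rewrite /= /bump leqNgt n0.
have [K K0 hK] := @box_prob_bound _ _ _ _ _ _ bm0 n mu t (c / 2) y i0 mu0 c2 yh.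
exists K, (Num.min (c / 2) (y ord0 ord_max / 2)); split => //.
  by rewrite lt_min c2 divr_gt0.
move=> r u z r0; rewrite le_min => /andP[rc ry] u0 ut zh hz.
have := hK r u z r0 rc ry u0 ut zh; rewrite i00 mulrC divfK//.
move=> /(_ hz); rewrite -box_ratioE// lee_fin ler_pM2r//.
by rewrite exprn_gt0// mulr_gt0.
Qed.

End BoxRatio.

(** As [h] is measurable on [D] only, it is majorised off [D] by +oo, whose integral over a null set
    is 0. It is applied to Hunt's integrand, known to be measurable only where X_0 = x. *)
Lemma integral_full_measure (R : realType) (d : measure_display)
    (T : measurableType d) (mu : {measure set T -> \bar R}) (D : set T)
    (h : T -> \bar R) :
  measurable D -> mu (~` D) = 0%E -> (forall w, 0 <= h w)%E -> measurable_fun D h ->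
  (\int[mu]_w h w = \int[mu]_(w in D) h w)%E.
Proof.
move=> mD D0 h0 mh; apply/eqP; rewrite eq_le; apply/andP; split; last first.
  rewrite integral_mkcond; apply: ge0_le_integral_nonmeas => w _.
    by rewrite patchE; case: ifP.
  by rewrite patchE; case: ifP.
have mhD : measurable_fun setT (h \_ D) by exact: (measurable_restrictT h mD).1.
have mC : measurable (~` D) by exact: measurableC.
apply: (@le_trans _ _ (\int[mu]_w ((h \_ D) w + (cst +oo \_ (~` D)) w))%E).
  apply: ge0_le_integral_nonmeas => // w _; rewrite !patchE in_setC.
  case: (boolP (w \in D)) => /= wD; first by rewrite adde0.
  by rewrite add0e leey.
rewrite ge0_integralD//; last 3 first.
- by move=> w _; rewrite patchE; case: ifP.
- by move=> w _; rewrite patchE; case: ifP => //=; rewrite ?le0y.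
- exact: (measurable_restrictT (cst +oo%E) mC).1.
rewrite -!integral_mkcond integral_cst// D0 mule0 adde0//.
Qed.

Section SurvivalGrid.
Context {R : realType} {T : Type}.
Variables (W : R -> T -> R) (c : R).
Implicit Types (h : R) (w : T).

Definition survival_event (s : R) : set T := [set w | survives (W^~ w) s].

(* The bound on [W] at the end of the cell keeps the process away from the
   target box, so that [box_prob_bound] applies; it holds automatically for
   small [h] since [W] vanishes at the passage time. *)
Definition passage_cell h (k : nat) : set T :=
  (survival_event (k%:R * h) `\` survival_event (k.+1%:R * h)) `&`
  [set w | `|W (k.+1%:R * h) w| < c].

Lemma survival_event_le (s s' : R) : s <= s' -> survival_event s' `<=` survival_event s.
Proof. by move=> ss w h r /andP[r0 rs]; apply: h; rewrite r0 (le_trans rs). Qed.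

Lemma sum_passage_cell_le1 h w N : 0 <= h ->
  \sum_(k < N) (\1_(passage_cell h k) w : R) <= 1.
Proof.
(* The stronger bound makes the induction work: a path in the next cell has survived up to its start
   and not up to its end. *)
move=> h0; suff : \sum_(k < N) (\1_(passage_cell h k) w : R) <=
    1 - \1_(survival_event (N%:R * h)) w.
  by move=> /le_trans; apply; rewrite gerBl.
elim: N => [|N ih].
  by rewrite big_ord0 subr_ge0 indicE lern1; case: (_ \in _).
rewrite big_ord_recr/=; apply: le_trans (lerD ih (lexx _)) _.
rewrite -addrA lerD2l -lerBrDl opprK addrC !indicE.
case: (boolP (w \in passage_cell h N)) => [/set_mem[[s1 s2] _]|_].
  by rewrite (mem_set s1) (memNset s2) subr0.
case: (boolP (w \in survival_event (N.+1%:R * h))) => [/set_mem s2|_].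
  rewrite mem_set ?subrr//; apply: survival_event_le s2.
  by rewrite ler_wpM2r// ler_nat.
by rewrite subr0.
Qed.

End SurvivalGrid.

Lemma grid_cell (R : realType) (h s : R) : 0 < h -> 0 < s ->
  exists k : nat, k%:R * h < s <= k.+1%:R * h.
Proof.
move=> h0 s0.
have [m hm] : exists m : nat, s <= m%:R * h.
  exists (Num.truncn (s / h)).+1; rewrite -ler_pdivrMr//; apply: ltW.
  exact: truncnS_gt.
have ex : exists m : nat, s <= m%:R * h by exists m.
case: (ex_minnP ex) => -[|k] hk mink; first by move: hk; rewrite mul0r leNgt s0.
exists k; rewrite hk andbT ltNge; apply/negP => hk'.
by have := mink _ hk'; rewrite ltnn.
Qed.

(** * The grid sum and its limit *)

Section PassageSum.
Context {R : realType} {d d0 : measure_display}.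
Context {T : measurableType d} {T0 : measurableType d0}.
Variables (P : probability T R) (P0 : probability T0 R).
Variables (n : nat) (mu : R) (x : 'rV[R]_n.+1) (X : R -> T -> 'rV[R]_n.+1).
Variables (a0 : R) (W0 : R -> T0 -> R).
Hypothesis n0 : (0 < n)%N.
Hypothesis hbm : hyp_brownian_motion mu x P X.
Hypothesis bm0 : brownian_motion P0 a0 W0.
Variables (c t : R) (y : 'rV[R]_n.+1).
Hypothesis t0 : 0 < t.

Let W (r : R) (w : T) : R := X r w ord0 ord0.

Let cW w : {within `[0, +oo[, continuous (W^~ w)}.
Proof. exact: (continuous_process_coord hbm). Qed.

Lemma past_passage_cell (h : R) (k : nat) : 0 <= h ->
  past X (k.+1%:R * h) (passage_cell W c h k).
Proof.
move=> h0; set s := k.+1%:R * h.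
have s0 : 0 <= s by rewrite mulr_ge0.
pose G := process_gen W [set r | 0 <= r <= s].
have surv s' : 0 <= s' -> s' <= s ->
    @measurable _ (g_sigma_algebraType G) (survival_event W s').
  exact: (@survives_past R T W s s' cW).
suff : @measurable _ (g_sigma_algebraType G) (passage_cell W c h k) by [].
apply: measurableI.
  apply: measurableD; apply: surv => //; first by rewrite mulr_ge0.
  by rewrite /s ler_wpM2r// ler_nat.
have -> : [set w | `|W s w| < c] = W s @^-1` [set a | `|a| < c] by [].
have ms : measurable_fun (setT : set (g_sigma_algebraType G)) (W s).
  by apply: measurable_process_gen; rewrite /= s0 lexx.
rewrite -[X in measurable X]setTI; apply: ms => //.
rewrite (_ : [set a : R | _] = `]- c, c[%classic); first exact: measurable_itv.
by apply/seteqP; split => a /=; rewrite in_itv/= ltr_norml.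
Qed.

Lemma measurable_passage_cell (h : R) (k : nat) : 0 <= h -> measurable (passage_cell W c h k).
Proof. by move=> h0; exact: (past_measurable hbm (@past_passage_cell h k h0)). Qed.

(** Of the [N.+1] cells of [0, t] only the first [N] are summed, so that the end of a cell lies
    strictly before [t] and positive time remains. *)
Definition mesh (N : nat) : R := t / N.+1%:R.

Lemma mesh_gt0 N : 0 < mesh N.
Proof. by rewrite divr_gt0. Qed.

Lemma mesh_lt N (k : 'I_N) : k.+1%:R * mesh N < t.
Proof.
rewrite /mesh mulrCA gtr_pMr// ltr_pdivrMr// mul1r ltr_nat ltnS.
exact: ltn_ord.
Qed.

Definition passage_sum (N : nat) (r : R) (w : T) : R :=
  \sum_(k < N) \1_(passage_cell W c (mesh N) k) w *
    box_ratio mu bm0 y r (t - k.+1%:R * mesh N) (X (k.+1%:R * mesh N) w).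

Lemma measurable_box_ratio (r s u : R) : 0 <= s -> 0 <= u ->
  measurable_fun setT (fun w => box_ratio mu bm0 y r u (X s w)).
Proof.
move=> s0 u0; apply: measurable_funM; last exact: measurable_cst.
have mb : measurable_fun setT (fun w =>
    box_prob (wiener bm0) mu (y - const_mx r) (y + const_mx r) u (X s w)).
  by apply: measurable_box_prob => // i; exact: (measurable_process_coord hbm).
exact: (measurableT_comp (fine_measurable measurableT) mb).
Qed.

Lemma measurable_passage_sum N r : measurable_fun setT (passage_sum N r).
Proof.
apply: measurable_sum => k; apply: measurable_funM.
  by apply: measurable_indic; apply: measurable_passage_cell; exact: ltW (mesh_gt0 N).
apply: measurable_box_ratio; first by rewrite mulr_ge0// ltW ?mesh_gt0.
by rewrite subr_ge0 ltW ?mesh_lt.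
Qed.

Lemma passage_sum_ge0 N r w : 0 <= r -> 0 <= passage_sum N r w.
Proof. by move=> r0; apply: sumr_ge0 => k _; rewrite mulr_ge0// box_ratio_ge0. Qed.

Let bx r := [set w | box (y - const_mx r) (y + const_mx r) (X t w)].

(** A cell belongs to the past of its right end, where the Markov property is applied. *)
Lemma integral_passage_cell (h : R) (k : nat) (r : R) : 0 <= h -> 0 < r -> k.+1%:R * h <= t ->
  (\int[P]_w (\1_(passage_cell W c h k) w *
     box_ratio mu bm0 y r (t - k.+1%:R * h) (X (k.+1%:R * h) w))%:E =
   \int[P]_w (((2 * r) ^- n.+1)%:E *
     (\1_(passage_cell W c h k) w * \1_(bx r) w)%:E))%E.
Proof.
move=> h0 r0; set s := _ * h => st; set E := passage_cell _ _ _ _.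
have s0 : 0 <= s by rewrite mulr_ge0.
have u0 : 0 <= t - s by rewrite subr_ge0.
have mE : measurable E by exact: measurable_passage_cell.
have mbx : measurable (bx r).
  by case: hbm => _ mX _ _; exact: (mX _ _ (ltW t0) (borel_box _ _)).
have q0 : 0 <= (2 * r) ^- n.+1 by rewrite invr_ge0 exprn_ge0// mulr_ge0// ltW.
have H := process_markov_past n0 hbm bm0 (y - const_mx r) (y + const_mx r) s0 u0
  (@past_passage_cell h k h0).
rewrite (_ : s + (t - s) = t) in H; last by ring.
rewrite ge0_integralZl_EFin//; last first.
  by apply/measurable_EFinP; apply: measurable_funM; exact: measurable_indic.
rewrite [X in (_ * X)%E](_ : _ = P (E `&` bx r)); last first.
  rewrite -[X in P X]setIT -integral_indic//; last exact: measurableI.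
  apply: eq_integral => w _; rewrite !indicE -natrM mulnb; congr (_%:R%:E).
  congr nat_of_bool; apply/idP/idP; rewrite !inE.
    by move=> /andP[]; rewrite !inE.
  by move=> [? ?]; apply/andP; split; rewrite inE.
rewrite H [X in (_ * X)%E]integral_mkcond -ge0_integralZl_EFin//; last 2 first.
- by move=> w _; rewrite patchE; case: ifP => // _; exact: box_prob_ge0.
- apply: (measurable_restrictT _ mE).1; apply: measurable_funTS.
  by apply: measurable_box_prob => // i; exact: (measurable_process_coord hbm).
apply: eq_integral => w _; rewrite patchE indicE.
case: ifP => _; last by rewrite mul0r mule0.
rewrite mul1r /box_ratio EFinM fineK ?box_prob_fin_num//.
exact: muleC.

Qed.

Lemma integral_passage_sum N r : 0 < r ->
  (\int[P]_w (passage_sum N r w)%:E =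
   \int[P]_w (((2 * r) ^- n.+1)%:E *
     ((\sum_(k < N) \1_(passage_cell W c (mesh N) k) w) * \1_(bx r) w)%:E))%E.
Proof.
move=> r0; have h0 := ltW (mesh_gt0 N).
have st (k : 'I_N) := ltW (mesh_lt k).
have mbx : measurable (bx r).
  by case: hbm => _ mX _ _; exact: (mX _ _ (ltW t0) (borel_box _ _)).
have q0 : 0 <= (2 * r) ^- n.+1 by rewrite invr_ge0 exprn_ge0// mulr_ge0// ltW.
transitivity (\sum_(k < N) \int[P]_w (((2 * r) ^- n.+1)%:E *
     (\1_(passage_cell W c (mesh N) k) w * \1_(bx r) w)%:E))%E.
  rewrite [RHS](eq_bigr _ (fun k _ => esym (integral_passage_cell h0 r0 (st k)))).
  rewrite -ge0_integral_sum//.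
  - by apply: eq_integral => w _; rewrite sumEFin.
  - move=> k; apply/measurable_EFinP; apply: measurable_funM.
      by apply: measurable_indic; exact: measurable_passage_cell.
    by apply: measurable_box_ratio; rewrite ?subr_ge0// mulr_ge0.
  - by move=> k w _; rewrite lee_fin mulr_ge0// box_ratio_ge0// ltW.
rewrite -ge0_integral_sum//.
- apply: eq_integral => w _; rewrite -ge0_sume_distrr.
    by rewrite sumEFin mulr_suml.
  by move=> k _; rewrite lee_fin mulr_ge0.
- move=> k; apply/measurable_EFinP; apply: measurable_funM => //.
  apply: measurable_funM; last exact: measurable_indic.
  by apply: measurable_indic; exact: measurable_passage_cell.
- by move=> k w _; rewrite -EFinM lee_fin !mulr_ge0.
Qed.

Section Pathwise.
Variable w : T.
Hypothesis start : 0 < W 0 w.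

Let tau := exit_time X (@half_space R n) w.

Let Xhyp (r : R) : 0 <= r -> hyp_space (X r w).
Proof. by case: hbm => + _ _ _; exact. Qed.

Lemma passage_cellP (h : R) (k : nat) : 0 <= h ->
  passage_cell W c h k w <->
  [/\ ((k%:R * h)%:E < tau)%E, (tau <= (k.+1%:R * h)%:E)%E &
      `|W (k.+1%:R * h) w| < c].
Proof.
move=> h0.
have S (j : nat) : survival_event W (j%:R * h) w <-> ((j%:R * h)%:E < tau)%E.
  exact: (survives_exitE Xhyp (@cW w) start (mulr_ge0 (ler0n _ _) h0)).
split=> [[[/S h1 h2] h3]|[/S h1 h2 h3]]; split => //.
  by rewrite leNgt; apply/negP => /S.
by split => // /S; rewrite ltNge h2.
Qed.

Lemma sum_passage_cell_miss N (a : 'I_N -> R) : (t%:E <= tau)%E ->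
  \sum_(k < N) \1_(passage_cell W c (mesh N) k) w * a k = 0.
Proof.
move=> tt; apply: big1 => k _; rewrite indicE memNset ?mul0r//.
move=> /(passage_cellP _ (ltW (mesh_gt0 N)))[_ + _].
by move=> /(le_trans tt); rewrite lee_fin leNgt mesh_lt.
Qed.

Lemma mesh_small (e : R) : 0 < e ->
  exists N0, forall N, (N0 <= N)%N -> mesh N < e.
Proof.
move=> e0; exists (Num.truncn (t / e)) => N hN.
rewrite /mesh ltr_pdivrMr// mulrC -ltr_pdivrMr//.
apply: lt_le_trans (truncnS_gt _) _.
by rewrite ler_nat ltnS.
Qed.

Lemma sum_passage_cell_hit (s : R) : 0 < c -> tau = s%:E -> s < t ->
  exists N0, forall N, (N0 <= N)%N -> exists k : 'I_N,
    [/\ s <= k.+1%:R * mesh N, k.+1%:R * mesh N < s + mesh N,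
        `|W (k.+1%:R * mesh N) w| < c &
      forall a : 'I_N -> R,
        \sum_(j < N) \1_(passage_cell W c (mesh N) j) w * a j = a k].
Proof.
move=> c0 ts st.
have Ws : W s w = 0 := exit_zero Xhyp (@cW w) start ts.
have s0 : 0 < s by rewrite -lte_fin -ts; exact: (exit_gt0 Xhyp (@cW w) start).
have g0 : `|W (Num.max s 0) w| < c by rewrite (max_idPl (ltW s0)) Ws normr0.
have [e /= e0 he] : \forall r \near s, `|W (Num.max r 0) w| < c.
  apply: (@cvgr_lt R R (nbhs s) _ (fun r => `|W (Num.max r 0) w|) _ _ _ g0).
  by apply: cvg_norm; exact: (@continuous_clamp _ _ (@cW w) s).
(* A mesh below [e] keeps the first coordinate below [c] at the end of the cell; a mesh below t - s
   keeps the cell among the first [N]. *)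
have [N0 hN0] : exists N0, forall N, (N0 <= N)%N -> mesh N < Num.min e (t - s).
  by apply: mesh_small; rewrite lt_min e0 subr_gt0.
exists N0 => N /hN0; rewrite lt_min => /andP[he1 hts].
have h0 := mesh_gt0 N.
have [k /andP[k1 k2]] := grid_cell h0 s0.
have ksh : k.+1%:R * mesh N < s + mesh N by rewrite -natr1 mulrDl mul1r ltrD2r.
have kN : (k < N)%N.
  rewrite -ltnS -(ltr_nat R) -(ltr_pM2r h0).
  rewrite [ltRHS](_ : _ = t); first by lra.
  by rewrite /mesh mulrC divfK.
exists (Ordinal kN); rewrite /=; split => //.
  have k0 : 0 <= k.+1%:R * mesh N by rewrite mulr_ge0// ltW.
  rewrite -[X in W X](max_idPl k0); apply: he => /=.
  by rewrite ler0_norm; lra.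
move=> a; rewrite (bigD1 (Ordinal kN))//= big1 ?addr0.
  rewrite indicE mem_set ?mul1r//; apply/(passage_cellP _ (ltW h0)); split.
  - by rewrite ts lte_fin.
  - by rewrite ts lee_fin.
  - have k0 : 0 <= k.+1%:R * mesh N by rewrite mulr_ge0// ltW.
    rewrite -[X in W X](max_idPl k0); apply: he => /=.
    by rewrite ler0_norm; lra.
move=> j jk; rewrite indicE memNset ?mul0r//.
move=> /(passage_cellP _ (ltW h0))[]; rewrite ts lte_fin lee_fin => j1 j2 _.
move: jk; rewrite -val_eqE/=.
have : (j < k.+1)%N by rewrite -(ltr_nat R) -(ltr_pM2r h0); exact: lt_le_trans k2.
have : (k < j.+1)%N by rewrite -(ltr_nat R) -(ltr_pM2r h0); exact: lt_le_trans j2.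
by rewrite !ltnS eqn_leq => -> ->.
Qed.

End Pathwise.

End PassageSum.

(** * Passage to the limit and Hunt's formula *)

Section ReflectionPrinciple.
Context {R : realType} {d d0 : measure_display}.
Context {T : measurableType d} {T0 : measurableType d0}.
Variables (n : nat) (mu : R) (P : 'rV[R]_n.+1 -> probability T R).
Variables (X : R -> T -> 'rV[R]_n.+1) (p : R -> 'rV[R]_n.+1 -> 'rV[R]_n.+1 -> R).
Variables (P0 : probability T0 R) (a0 : R) (W0 : R -> T0 -> R).
Hypotheses (n0 : (0 < n)%N) (mu0 : 0 < mu).
Hypothesis hbm : forall x, hyp_space x -> hyp_brownian_motion mu x (P x) X.
Hypothesis ctd : continuous_transition_density P X p.
Hypothesis bm0 : brownian_motion P0 a0 W0.
Variables (x y : 'rV[R]_n.+1) (t : R).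
Hypotheses (hx : half_space x) (hy : half_space y) (t0 : 0 < t).

Let yb := reflect1 y.
(** A point whose first coordinate is less than [c] in absolute value is at horizontal distance at
    least [c] from the reflected target. *)
Let c := y ord0 ord0 / 2.
Let Om := [set w | X 0 w = x].
Let tau := exit_time X (@half_space R n).
Let ratio r u z := box_ratio mu bm0 yb r u z.
Let psum N r w := passage_sum mu X bm0 c t yb N r w.

Let xh : hyp_space x. Proof. by case: hx. Qed.
Let yh : hyp_space y. Proof. by case: hy. Qed.
Let ybh : hyp_space yb. Proof. exact: hyp_space_reflect1. Qed.
Let y1 : 0 < y ord0 ord0. Proof. by case: hy. Qed.
Let c0 : 0 < c. Proof. by rewrite divr_gt0. Qed.

Let hbmx := hbm xh.

Let mOm : measurable Om.
Proof. exact: (measurable_start hbmx). Qed.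

Let OmC : P x (~` Om) = 0%E.
Proof.
have := probability_setC (P x) mOm; rewrite /Om (process_start hbmx) => ->.
by rewrite subee.
Qed.

Let start w : Om w -> 0 < X 0 w ord0 ord0.
Proof. by move=> ->; case: hx. Qed.

Let Xhyp w (r : R) : 0 <= r -> hyp_space (X r w).
Proof. by case: hbmx => + _ _ _; exact. Qed.

Let cW w : {within `[0, +oo[, continuous (fun r => X r w ord0 ord0)}.
Proof. exact: (continuous_process_coord hbmx). Qed.

Let mpsum N r : measurable_fun setT (psum N r).
Proof. exact: (measurable_passage_sum hbmx). Qed.

Let psum_ge0 N r w : 0 <= r -> 0 <= psum N r w.
Proof. by move=> r0; exact: passage_sum_ge0. Qed.

(** At most one cell contains the path, and there [box_ratio_bound] applies. *)
Let psum_bound : exists K rho : R, [/\ 0 <= K, 0 < rho & forall N r w,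
  0 < r -> r <= rho -> psum N r w <= K].
Proof.
have [K [rho [K0 rho0 hK]]] := @box_ratio_bound R d0 T0 n mu P0 a0 W0 n0 mu0 bm0 t c yb ybh c0.
exists K, rho; split => // N r w r0 rr.
apply: (@le_trans _ _ (\sum_(k < N)
  \1_(passage_cell (fun r w => X r w ord0 ord0) c (mesh t N) k) w * K)).
  apply: ler_sum => k _; rewrite indicE.
  case: (boolP (w \in _)) => [/set_mem[_ /= hc]|_]; last by rewrite !mul0r.
  rewrite !mul1r; have kt := mesh_lt t0 k.
  have k0 : 0 <= k.+1%:R * mesh t N by rewrite mulr_ge0// ltW// mesh_gt0.
  apply: hK => //; [by rewrite subr_gt0|by rewrite gerBl|exact: Xhyp|].
  rewrite reflect1_first; move: hc; rewrite ltr_norml => /andP[h1 h2].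
  have : c * 2 = y ord0 ord0 by rewrite divfK.
  set a := X _ w ord0 ord0 in h1 h2 *.
  by move=> cE; rewrite ltr0_norm; lra.
rewrite -mulr_suml -[leRHS]mul1r ler_wpM2r//.
by apply: sum_passage_cell_le1; rewrite ltW// mesh_gt0.
Qed.

(** The condition on [r] puts the box around the reflected point inside {x_1 < 0}. A path ending
    there has left D before [t], so for large N exactly one cell catches it and the sum of
    indicators is 1. *)
Let integral_psum r : 0 < r -> r < y ord0 ord0 ->
  (\int[P x]_w (psum N r w)%:E)%E @[N --> \oo] --> (ratio r t x)%:E.
Proof.
move=> r0 ry.
pose q := (2 * r) ^- n.+1.
have q0 : 0 <= q by rewrite invr_ge0 exprn_ge0// mulr_ge0// ltW.
pose bx := [set w | box (yb - const_mx r) (yb + const_mx r) (X t w)].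
have mbx : measurable bx.
  by case: hbmx => _ mX _ _; exact: (mX _ _ (ltW t0) (borel_box _ _)).
pose S N w : R := \sum_(k < N)
  \1_(passage_cell (fun r w => X r w ord0 ord0) c (mesh t N) k) w.
have S0 N w : 0 <= S N w by exact: sumr_ge0.
have S1 N w : S N w <= 1 by apply: sum_passage_cell_le1; rewrite ltW// mesh_gt0.
have mS N : measurable_fun setT (S N).
  apply: measurable_sum => k; apply: measurable_indic.
  by apply: (measurable_passage_cell hbmx); rewrite ltW// mesh_gt0.
pose f N w := (q%:E * (S N w * \1_bx w)%:E)%E.
have mf N : measurable_fun setT (f N).
  apply: emeasurable_funM; first exact: measurable_cst.
  by apply/measurable_EFinP; apply: measurable_funM => //; exact: measurable_indic.
have f0 N w : (0 <= f N w)%E by rewrite /f -EFinM lee_fin !mulr_ge0.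
have E N : (\int[P x]_w (psum N r w)%:E = \int[P x]_(w in Om) f N w)%E.
  rewrite -[RHS]integral_full_measure//; last exact: measurable_funTS.
  exact: (integral_passage_sum n0 hbmx).
under eq_fun do rewrite E.
have -> : (ratio r t x)%:E = (\int[P x]_(w in Om) (q * \1_bx w)%:E)%E.
  rewrite -[RHS]integral_full_measure//; last 2 first.
  - by move=> w; rewrite lee_fin mulr_ge0.
  - apply: measurable_funTS; apply/measurable_EFinP; apply: measurable_funM => //.
  under eq_integral do rewrite EFinM.
  rewrite ge0_integralZl_EFin//; last first.
    by apply/measurable_EFinP; exact: measurable_indic.
  rewrite integral_indic// setIT.
  rewrite [X in (_ * X)%E](process_box_prob n0 hbmx bm0 _ _ (ltW t0)).
  by rewrite /ratio /box_ratio mulrC EFinM fineK// box_prob_fin_num.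
have [|||||_ _] // := @dominated_convergence _ _ _ (P x) Om mOm f
  (fun w => (q * \1_bx w)%:E) (EFin \o cst q).
- by move=> N; exact: measurable_funTS.
- apply: measurable_funTS; apply/measurable_EFinP; apply: measurable_funM => //.
- apply: aeW => w wOm.
  have [wb|wb] := pselect (bx w); last first.
    rewrite /f indicE memNset//; apply: cvg_near_cst; apply: nearW => N.
    by rewrite !mulr0 mule0.
  have Wt : X t w ord0 ord0 < 0.
    by have /andP[_] := wb ord0; rewrite !mxE eqxx; lra.
  have tt : (tau w < t%:E)%E := exit_time_lt (@Xhyp w) (@cW w) (start wOm) Wt t0.
  have [s ts /andP[s0 st]] := exit_fin (@Xhyp w) (@cW w) (start wOm) tt.
  have [N0 hN0] := sum_passage_cell_hit hbmx t0 (start wOm) c0 ts st.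
  apply: cvg_near_cst; exists N0 => // N /= /hN0[k [_ _ _ hk]].
  have S1' : S N w = 1.
    by rewrite -(hk (fun=> 1)); apply: eq_bigr => j _; rewrite mulr1.
  by rewrite /f S1' mul1r -EFinM.
- exact: finite_measure_integrable_cst.
- apply: aeW => w N wOm; rewrite gee0_abs// /f -EFinM lee_fin/= ler_piMr//.
  by rewrite mulr_ile1.
Qed.

Let g w : R := if (tau w < t%:E)%E then
  (yb ord0 ord_max) ^- n.+1 * p (t - fine (tau w)) (X (fine (tau w)) w) yb else 0.

Let near_path w (s e : R) : 0 <= s -> 0 < e ->
  exists2 eta : R, 0 < eta &
    forall r, 0 <= r -> `|s - r| < eta -> ball (X s w) e (X r w).
Proof.
move=> s0 e0; case: hbmx => _ _ cX _.
have sI : `[0, +oo[%classic s by rewrite /= in_itv/= s0.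
have cs : (fun r => X r w) @ within `[0, +oo[%classic (nbhs s) --> X s w.
  by rewrite (nbhs_subspace_in sI); have := cX w s.
have [eta /= eta0 he] := cs _ (nbhsx_ballx (X s w) e e0).
exists eta => // r r0 sr; apply: he => //.
by rewrite /= in_itv/= r0.
Qed.

(** The box size and the mesh may tend to 0 at unrelated speeds; right continuity of the path at the
    exit time brings the rounded position to the exit position. *)
Let cvg_psum (rs : nat -> R) (Ns : nat -> nat) w : Om w ->
  (forall m, 0 < rs m) ->
  (forall e, 0 < e -> exists M, forall m, (M <= m)%N -> rs m < e) ->
  (forall m, (m <= Ns m)%N) ->
  psum (Ns m) (rs m) w @[m --> \oo] --> g w.
Proof.
move=> wOm rs0 rse Nsm; rewrite /g.
case: ltP => tt; last first.
  apply: cvg_near_cst; apply: nearW => m.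
  exact: (sum_passage_cell_miss hbmx c t0 (start wOm) _ tt).
have [s ts /andP[s0 st]] := exit_fin (@Xhyp w) (@cW w) (start wOm) tt.
rewrite [tau w]ts/=; apply/cvgrPdist_le => e e0.
have st0 : 0 < t - s by rewrite subr_gt0.
have [dl dl0 hd] := box_ratio_near n0 hbm ctd bm0 st0 (Xhyp w (ltW s0)) ybh e0.
have [eta eta0 he] := near_path w (ltW s0) dl0.
have [N0 hN0] := sum_passage_cell_hit hbmx t0 (start wOm) c0 ts st.
have [N1 hN1] : exists N1, forall N, (N1 <= N)%N -> mesh t N < Num.min eta dl.
  by apply: mesh_small; rewrite lt_min eta0.
have [M hM] := rse _ dl0.
exists (maxn M (maxn N0 N1)) => // m /=; rewrite !geq_max => /and3P[mM mN0 mN1].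
have [k [sk1 sk2 _ hk]] := hN0 _ (leq_trans mN0 (Nsm m)).
have := hN1 _ (leq_trans mN1 (Nsm m)); rewrite lt_min => /andP[m1 m2].
rewrite /psum /passage_sum hk; apply: hd.
- by rewrite ger0_norm; lra.
- apply: he; first by apply: le_trans sk1; exact: ltW.
  by rewrite ler0_norm; lra.
- by rewrite subr_gt0; exact: mesh_lt.
- by apply: Xhyp; apply: le_trans sk1; exact: ltW.
- exact: rs0.
- exact: hM.
Qed.

Let measurable_g_integral :
  measurable_fun Om (EFin \o g) /\
  (\int[P x]_(w in Om) (g w)%:E = ((yb ord0 ord_max) ^- n.+1 * p t x yb)%:E)%E.
Proof.
have [K [rho [K0 rho0 hK]]] := psum_bound.
pose r1 := Num.min rho c.
have r10 : 0 < r1 by rewrite lt_min rho0.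
(* Merely a null sequence: r1 / (m + 1). *)
pose rs := mesh r1.
have rs0 m : 0 < rs m by exact: mesh_gt0.
have rs1 m : rs m <= r1.
  by rewrite /rs /mesh ler_pdivrMr// ler_peMr// ?ler1n// ltW.
have rse e : 0 < e -> exists M, forall m, (M <= m)%N -> rs m < e by exact: mesh_small.
have rsrho m : rs m <= rho by apply: le_trans (rs1 m) _; rewrite ge_min lexx.
have rsy m : rs m < y ord0 ord0.
  apply: le_lt_trans (rs1 m) _; apply: (@le_lt_trans _ _ c); first by rewrite ge_min lexx orbT.
  by have := y1; rewrite /c; lra.
pose I N r := (\int[P x]_w (psum N r w)%:E)%E.
(* The mesh is chosen after the box size, fine enough for the expectation of the grid sum to be
   within 1 / (m + 1) of its limit. *)
have exN m : exists N : nat, (m <= N)%N /\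
    `|ratio (rs m) t x - fine (I N (rs m))| <= m.+1%:R^-1.
  have /fine_cvgP[_ /cvgrPdist_le h] := integral_psum (rs0 m) (rsy m).
  have [|N1 _ hN1] := h m.+1%:R^-1; first by rewrite invr_gt0.
  exists (maxn m N1); split; first exact: leq_maxl.
  by apply: hN1; rewrite /= leq_maxr.
have [Ns hNs] := choice exN.
have cg w : Om w -> (psum (Ns m) (rs m) w)%:E @[m --> \oo] --> (g w)%:E.
  move=> wOm; apply: cvg_EFin; first exact: nearW.
  by apply: cvg_psum => // m; case: (hNs m).
(* Measurability of Hunt's integrand comes for free, as a pointwise limit of grid sums. *)
have mg : measurable_fun Om (EFin \o g).
  apply: (@emeasurable_fun_cvg _ _ _ _ (fun m w => (psum (Ns m) (rs m) w)%:E)) => //.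
  by move=> m; apply: measurable_funTS; apply/measurable_EFinP; exact: mpsum.
split => //.
have cI : I (Ns m) (rs m) @[m --> \oo] --> (\int[P x]_(w in Om) (g w)%:E)%E.
  have E m : I (Ns m) (rs m) = (\int[P x]_(w in Om) (psum (Ns m) (rs m) w)%:E)%E.
    apply: integral_full_measure => //.
      by move=> w; rewrite lee_fin psum_ge0// ltW.
    by apply: measurable_funTS; apply/measurable_EFinP; exact: mpsum.
  under eq_fun do rewrite E.
  have [|||||_ _] // := @dominated_convergence _ _ _ (P x) Om mOm
    (fun m w => (psum (Ns m) (rs m) w)%:E) (EFin \o g) (EFin \o cst K).
  - by move=> m; apply: measurable_funTS; apply/measurable_EFinP; exact: mpsum.
  - exact: aeW.
  - exact: finite_measure_integrable_cst.
  - apply: aeW => w m wOm; rewrite gee0_abs// lee_fin; last by rewrite psum_ge0// ltW.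
    exact: hK.
apply: (cvg_unique _ cI) => //.
set l := _ * p t x yb.
have Ifin m : I (Ns m) (rs m) \is a fin_num.
  rewrite ge0_fin_numE; last by apply: integral_ge0 => w _; rewrite lee_fin psum_ge0// ltW.
  apply: (@le_lt_trans _ _ (\int[P x]_w (cst K w)%:E)%E).
    by apply: ge0_le_integral_nonmeas => w _; rewrite lee_fin ?psum_ge0// ?hK// ltW.
  by have /integrable_lty := finite_measure_integrable_cst (P x) K measurableT; apply.
apply/fine_cvgP; split; first by apply: nearW => m; exact: Ifin.
apply/cvgrPdist_le => e e0; have e2 : 0 < e / 2 by rewrite divr_gt0.
have [dl dl0 hd] := box_ratio_near n0 hbm ctd bm0 t0 xh ybh e2.
have [M hM] := rse _ dl0.
have [M1 hM1] := @mesh_small R 1 (e / 2) e2.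
exists (maxn M M1) => // m /=; rewrite geq_max => /andP[mM mM1].
have := hd t x (rs m); rewrite subrr normr0.
move=> /(_ dl0 (ballxx _ dl0) t0 xh (rs0 m) (hM m mM)) k1.
have [_ k2] := hNs m; have := hM1 m mM1; rewrite /mesh mul1r => k3.
rewrite (_ : l - _ = (l - ratio (rs m) t x) + (ratio (rs m) t x - fine (I (Ns m) (rs m)))); last by ring.
apply: le_trans (ler_normD _ _) _.
by apply: le_trans (lerD k1 (le_trans k2 (ltW k3))) _; rewrite -splitr.
Qed.

Lemma killed_density_half_space :
  killed_density P X p (@half_space R n) t x y =
    (p t x y - p t x (reflect1 y))%:E.
Proof.
have [mg gI] := measurable_g_integral.
rewrite /killed_density EFinB; congr (_ - _)%E.
(* This factor undoes the change from dV to Lebesgue measure built into [g]. *)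
pose b : R := (y ord0 ord_max) ^+ n.+1.
have b0 : 0 < b by rewrite exprn_gt0.
have ybE : yb ord0 ord_max ^- n.+1 = b^-1 by rewrite reflect1_last.
case: ctd => p0 _ _.
rewrite integral_mkcond.
have taup w : (tau w < t%:E)%E -> 0 <= p (t - fine (tau w)) (X (fine (tau w)) w) y.
  move=> tt.
  have tau0 : (0 <= tau w)%E by apply: le_ereal_inf_tmp => _ [r [r0 _] <-]; rewrite lee_fin ltW.
  have tf : tau w \is a fin_num by rewrite ge0_fin_numE// (lt_trans tt)// ltry.
  apply: p0 => //; last by apply: Xhyp; exact: fine_ge0.
  by rewrite subr_gt0 -lte_fin fineK.
(* The exit position lies on the hyperplane, where the target [y] may be exchanged for its
   reflection. *)
have gE w : Om w -> (((fun w => (p (t - fine (tau w)) (X (fine (tau w)) w) y)%:E) \_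
    [set w | (tau w < t%:E)%E]) w = (b * g w)%:E)%E.
  move=> wOm; rewrite patchE /g; case: ifPn => [/set_mem/= tt|tt]; last first.
    rewrite ifF ?mulr0//; apply/negbTE/negP => h; move: tt => /negP; apply.
    exact/mem_set.
  rewrite tt ybE mulrA divff ?gt_eqF// mul1r.
  have [s ts /andP[s0 st]] := exit_fin (@Xhyp w) (@cW w) (start wOm) tt.
  rewrite [tau w]ts/= (density_reflect n0 hbm ctd bm0)//.
  - by rewrite subr_gt0.
  - exact: Xhyp (ltW s0).
  - exact: (exit_zero (@Xhyp w) (@cW w) (start wOm) ts).
have mbg : measurable_fun Om (fun w => (b * g w)%:E).
  under eq_fun do rewrite EFinM.
  by apply: emeasurable_funM.
have g0 w : Om w -> (0 <= (g w)%:E)%E.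
  move=> wOm; rewrite lee_fin -(pmulr_rge0 _ b0) -lee_fin -gE// patchE.
  by case: ifP => // /set_mem/= tt; rewrite lee_fin taup.
rewrite (integral_full_measure mOm OmC); last 2 first.
- by move=> w; rewrite patchE; case: ifP => // /set_mem/= tt; rewrite lee_fin taup.
- apply: (eq_measurable_fun _ _ mbg) => w /set_mem wOm.
  by rewrite gE.
transitivity (\int[P x]_(w in Om) (b%:E * (g w)%:E))%E.
  by apply: eq_integral => w /set_mem wOm; rewrite gE// EFinM.
rewrite ge0_integralZl_EFin//; last exact: ltW.
by rewrite gI ybE -EFinM mulrA divff ?gt_eqF// mul1r.
Qed.

End ReflectionPrinciple.

Theorem theorem1 (R : realType) (n : nat) (mu : R)
    (d : measure_display) (T : measurableType d)
    (P : 'rV[R]_n.+1 -> probability T R) (X : R -> T -> 'rV[R]_n.+1)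
    (p : R -> 'rV[R]_n.+1 -> 'rV[R]_n.+1 -> R) :
  (2 <= n.+1)%N -> 0 < mu ->
  (forall x, hyp_space x -> hyp_brownian_motion mu x (P x) X) ->
  continuous_transition_density P X p ->
  forall (x y : 'rV[R]_n.+1) (t : R), half_space x -> half_space y -> 0 < t ->
    killed_density P X p (@half_space R n) t x y =
      (p t x y - p t x (reflect1 y))%:E.
Proof.
move=> n2 mu0 hbm ctd x y t hx hy t0.
(* Any Brownian motion can define Wiener measure; the vertical one driving X under [P x] is at
   hand. *)
have [_ _ _ [d' [T' [P' [B [beta [[bmB _ _] _]]]]]]] := hbm x hx.1.
exact: (killed_density_half_space n2 mu0 hbm ctd bmB hx hy t0).
Qed.
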